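(* Let $\alpha=2$, $f_0,f_1>0$, and let $\nu$ be a compactly supported probability measure on $\mathbb{R}$ with $\#(\operatorname{supp}\nu)\ge5$. Then the Lyapunov exponent satisfies $L(E)>0$ for every $E\in\mathbb{R}$.
   Context: Lyapunov exponent of the generalized Anderson model (with $V_0\equiv0$): for $E,\lambda\in\mathbb{R}$ let $T_i(\lambda,E)=\begin{pmatrix}E-f_i\lambda&-1\\1&0\end{pmatrix}$ and let the $\alpha$-step transfer matrix be $M_\lambda(E)=T_{\alpha-1}(\lambda,E)\cdots T_0(\lambda,E)\in SL(2,\mathbb{R})$. Let $\lambda_1,\lambda_2,\dots$ be i.i.d. with law $\nu$. Then $L(E)=\lim_{n\to\infty}\frac1n\log\|M_{\lambda_n}(E)\cdots M_{\lambda_1}(E)\|$, which exists and is almost surely constant. *)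

(* Defs.v *)
From HB Require Import structures.
From mathcomp Require Import all_boot all_order all_algebra.
From mathcomp Require Import all_classical all_reals all_analysis.
Set Implicit Arguments. Unset Strict Implicit. Unset Printing Implicit Defensive.
Import Order.TTheory GRing.Theory Num.Theory.
Import numFieldNormedType.Exports.
Local Open Scope classical_set_scope.
Local Open Scope ring_scope.

Definition Tmat (R : realType) (f lam E : R) : 'M[R]_2 :=
  \matrix_(i < 2, j < 2)
    (if (i == 0 :> nat) && (j == 0 :> nat) then E - f * lam
     else if (i == 0 :> nat) then -1
     else if (j == 0 :> nat) then 1 else 0).

(* alpha = 2 : M_lam(E) = T_1(lam,E) T_0(lam,E) *)
Definition Mstep (R : realType) (f0 f1 lam E : R) : 'M[R]_2 :=
  Tmat f1 lam E *m Tmat f0 lam E.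

(* cocycle n w = M_{w (n-1)}(E) ... M_{w 0}(E)  (i.e. M_{lam_n} ... M_{lam_1}
   with lam_k = w (k-1)) *)
Fixpoint cocycle (R : realType) (f0 f1 E : R) (n : nat) (w : nat -> R)
  : 'M[R]_2 :=
  match n with
  | 0 => 1%:M
  | n'.+1 => Mstep f0 f1 (w n') E *m cocycle f0 f1 E n' w
  end.

Definition vnorm2 (R : realType) (v : 'cV[R]_2) : R :=
  Num.sqrt (\sum_(i < 2) v i 0 ^+ 2).

Definition opnorm (R : realType) (A : 'M[R]_2) : R :=
  sup [set vnorm2 (A *m v) | v in [set v : 'cV[R]_2 | vnorm2 v = 1]].

Definition msupport (R : realType) (nu : {measure set R -> \bar R}) : set R :=
  [set x | forall e : R, 0 < e -> (0 < nu (ball x e))%E].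

Definition compactly_supported (R : realType)
  (nu : {measure set R -> \bar R}) : Prop :=
  exists M : R, nu (~` `[-M, M]) = 0%E.

Definition card_ge (R : realType) (S : set R) (k : nat) : Prop :=
  exists x : 'I_k -> R, injective x /\ forall i, S (x i).

Definition iid_law (d : measure_display) (Omega : measurableType d)
  (R : realType) (P : probability Omega R) (lam : nat -> Omega -> R)
  (nu : {measure set R -> \bar R}) : Prop :=
  (forall n, measurable_fun setT (lam n)) /\
  (forall n (A : set R), measurable A -> P (lam n @^-1` A) = nu A) /\
  (* mutual independence: product rule for every finite subfamily
     (subfamilies are obtained by taking A i = setT) *)
  (forall (n : nat) (A : nat -> set R), (forall i, measurable (A i)) ->
     P (\bigcap_(i in `I_n) (lam i @^-1` A i)) =
     (\prod_(i < n) P (lam i @^-1` A i))%E).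

(* Main.v *)
(* Every vector of the plane is moved by the walk with independent steps
   [step f0 f1 E l]; [T F v] is the mean of [F] after one step from [v].

   Spectral gap. If [T] nearly preserved the L^2 norm of a function [f] on the
   plane with values in [0,1], the functional g |-> \int g f^2 would be almost
   invariant under the five increments between support points. The commutator of
   two increments has trace 2 + (f0 f1)^3 d1^2 d2^2 (d1 - d2)^2 > 2, so the mass
   of the functional would concentrate near its two eigenlines; but the increments
   carry any line to at least three well separated ones. Hence the mass of a disk
   decays under iteration, and the mean logarithmic norm of the product matrices
   grows at least linearly, at every energy.

   From norms to vectors. Three separated images of a vector cannot all be
   contracted by the next matrices, and each of them is charged by the law of the
   first step: the mean logarithmic growth of every single vector is at least
   linear. This contracts projective distances, so the growth depends on the vector
   up to a bounded error only; it is almost additive in time, hence equal to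
   k L + O(1) with L > 0.

   From means to almost sure limits. Exponential moments of the growth give
   Chernoff bounds, and Borel-Cantelli gives log |M_n ... M_1 v|^2 / n --> L for the
   two basis vectors, hence L / 2 for the operator norm. *)

Require Import Defs.
From HB Require Import structures.
From mathcomp Require Import all_boot all_order all_algebra.
From mathcomp Require Import all_classical all_reals all_analysis.
From mathcomp Require Import measurable_realfun zify ring lra.
Set Implicit Arguments. Unset Strict Implicit. Unset Printing Implicit Defensive.
Import Order.TTheory GRing.Theory Num.Theory.
Import numFieldNormedType.Exports.
Local Open Scope classical_set_scope.
Local Open Scope ring_scope.

(** * Averaging along a random action *)

(** Lebesgue measure on the plane takes the place of Furstenberg's stationary measures on the
    projective line. Every step preserves it, so the loss of squared L^2 norm under [T] is exactly a
    mean variance, and a small variance means almost invariance. Uniformity over energies comes from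
    the increments [M_l^{-1} M_m]: neither their traces nor those of their commutators contain [E].
    A gap for functions on the plane controls norms because a product of squared norm at most [s]
    sends the disk of squared radius [1 / s] into the unit disk. If such products have probability
    [p], the averaged indicator of the unit disk has squared L^2 norm at least of order [p^2 / s],
    while the gap makes it exponentially small in the number of steps. The exponent may not depend
    on the probability space carrying the sequence; it is therefore built from iterated averages
    over [nu] alone, and the random variables enter only at the end. Since logarithms of norms are
    unbounded, averaged functions are kept bounded on each level of an exhaustion that one step
    raises by one level. *)

Section Averaging.
Context {dS dX : measure_display} {S : measurableType dS}
  {X : measurableType dX} {R : realType} (nu : probability S R)
  (act : S -> X -> X) (B : nat -> set X).

Definition avg (F : X -> R) (x : X) : R := \int[nu]_l F (act l x).

(* Only such functions are averaged: on them the total function [avg] is an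
   honest integral, never the junk value of a divergent one. *)
Definition tame (F : X -> R) : Prop :=
  measurable_fun setT F /\
  forall r, exists C : R, forall x, B r x -> `|F x| <= C.

Hypothesis act_meas : measurable_fun setT (fun p : S * X => act p.1 p.2).
Hypothesis B_cover : forall x, exists r, B r x.
Hypothesis B_step : forall r l x, B r x -> B r.+1 (act l x).

Lemma act_meas1 x : measurable_fun setT (fun l => act l x).
Proof.
by apply: (measurableT_comp act_meas (pair2_measurable x)).
Qed.

Lemma integrable_bounded (F : S -> R) (C : R) : measurable_fun setT F ->
  (forall l, `|F l| <= C) -> nu.-integrable setT (EFin \o F).
Proof.
move=> mF bF; apply: measurable_bounded_integrable => //.
  by rewrite -ge0_fin_numE // fin_num_measure.
exists C; split; first exact: num_real.
by move=> c Cc l _; exact: le_trans (bF l) (ltW Cc).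
Qed.

Lemma tame_act F x : tame F -> measurable_fun setT (fun l => F (act l x)).
Proof.
by move=> [mF _]; exact: (measurableT_comp mF (act_meas1 x)).
Qed.

Lemma tame_actP F x : tame F -> exists C, forall l, `|F (act l x)| <= C.
Proof.
move=> [_ bF]; have [r Br] := B_cover x; have [C hC] := bF r.+1.
by exists C => l; apply: hC; exact: B_step.
Qed.

Lemma integrable_act F x : tame F ->
  nu.-integrable setT (EFin \o (fun l => F (act l x))).
Proof.
move=> tF; have [C hC] := tame_actP x tF.
exact: (integrable_bounded (C := C) (tame_act x tF)).
Qed.

Lemma tameD F G : tame F -> tame G -> tame (fun x => F x + G x).
Proof.
move=> [mF bF] [mG bG]; split; first exact: measurable_funD.
move=> r; have [C hC] := bF r; have [C' hC'] := bG r.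
exists (C + C') => x Bx; apply: le_trans (ler_normD _ _) _.
by apply: lerD; [exact: hC | exact: hC'].
Qed.

Lemma tame_cst c : tame (fun=> c).
Proof. by split; [exact: measurable_cst | move=> r; exists `|c|]. Qed.

Lemma tame_bounded (F : X -> R) (C : R) :
  measurable_fun setT F -> (forall x, `|F x| <= C) -> tame F.
Proof. by move=> mF bF; split => // r; exists C. Qed.

Lemma tameM F G : tame F -> tame G -> tame (fun x => F x * G x).
Proof.
move=> [mF bF] [mG bG]; split; first exact: measurable_funM.
move=> r; have [C hC] := bF r; have [C' hC'] := bG r.
exists (C * C') => x Bx; rewrite normrM.
by apply: ler_pM => //; [exact: hC | exact: hC'].
Qed.

Lemma tameZ c F : tame F -> tame (fun x => c * F x).
Proof. by move=> tF; apply: tameM => //; exact: tame_cst. Qed.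

Lemma tameB F G : tame F -> tame G -> tame (fun x => F x - G x).
Proof.
move=> tF tG; have := tameD tF (tameZ (-1) tG).
by congr tame; apply/funext => x; rewrite mulN1r.
Qed.

Lemma avgD F G x : tame F -> tame G ->
  avg (fun y => F y + G y) x = avg F x + avg G x.
Proof.
by move=> tF tG; rewrite /avg RintegralD//; exact: integrable_act.
Qed.

Lemma avgZ c F x : tame F -> avg (fun y => c * F y) x = c * avg F x.
Proof. by move=> tF; rewrite /avg RintegralZl//; exact: integrable_act. Qed.

Lemma avg_cst c x : avg (fun=> c) x = c.
Proof. rewrite /avg Rintegral_cst// [X in _ * X](_ : _ = 1) ?mulr1//.
exact: (congr1 fine (probability_setT nu)). Qed.

Lemma avg_le F G x : tame F -> tame G ->
  (forall l, F (act l x) <= G (act l x)) -> avg F x <= avg G x.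
Proof.
by move=> tF tG FG; apply: le_Rintegral => //; exact: integrable_act.
Qed.

Lemma avg_norm_le F C x : tame F -> (forall l, `|F (act l x)| <= C) ->
  `|avg F x| <= C.
Proof.
move=> tF h; rewrite ler_norml; apply/andP; split.
  rewrite -(avg_cst (- C) x); apply: avg_le => //; first exact: tame_cst.
  by move=> l; have := h l; rewrite ler_norml => /andP[].
rewrite -(avg_cst C x); apply: avg_le => //; first exact: tame_cst.
by move=> l; have := h l; rewrite ler_norml => /andP[].
Qed.

Lemma avg_meas F : tame F -> measurable_fun setT (avg F).
Proof.
move=> [mF bF].
have m2 : measurable_fun setT (fun p : X * S => (F (act p.2 p.1))%:E).
  apply/measurable_EFinP; apply: (measurableT_comp mF).
  have ms : measurable_fun setT (fun p : X * S => (p.2, p.1)).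
    by apply: measurable_fun_pair; [exact: measurable_snd|exact: measurable_fst].
  exact: (measurableT_comp act_meas ms).
rewrite /avg /Rintegral; apply: measurableT_comp => //.
under eq_fun do rewrite integralE.
have hp := @measurable_fun_fubini_tonelli_F _ _ X S R nu _
    (measurable_funepos m2) (fun p => funepos_ge0 _ p).
have hn := @measurable_fun_fubini_tonelli_F _ _ X S R nu _
    (measurable_funeneg m2) (fun p => funeneg_ge0 _ p).
have := emeasurable_funB hp hn; congr measurable_fun; apply/funext => x.
by congr (_ - _)%E; apply: eq_integral => y _; rewrite ?funeposE ?funenegE.
Qed.

(** One level is lost: a value on level [r] averages values on level [r.+1]. Boundedness on every
    level is thus stable under averaging. *)
Lemma tame_avg F : tame F -> tame (avg F).
Proof.
move=> tF; split; first exact: avg_meas.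
move=> r; have [_ bF] := tF; have [C hC] := bF r.+1; exists C => x Bx.
by apply: avg_norm_le => // l; apply: hC; exact: B_step.
Qed.

Lemma tame_iter n F : tame F -> tame (iter n avg F).
Proof. by move=> tF; elim: n => //= n; exact: tame_avg. Qed.

Lemma iter_avgD n F G x : tame F -> tame G ->
  iter n avg (fun y => F y + G y) x = iter n avg F x + iter n avg G x.
Proof.
move=> tF tG; elim: n x => //= n IH x; rewrite -avgD; try exact: tame_iter.
by congr avg; apply/funext.
Qed.

Lemma iter_avgZ n c F x : tame F ->
  iter n avg (fun y => c * F y) x = c * iter n avg F x.
Proof.
move=> tF; elim: n x => //= n IH x; rewrite -avgZ; last exact: tame_iter.
by congr avg; apply/funext.
Qed.

Lemma iter_avg_cst n c x : iter n avg (fun=> c) x = c.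
Proof.
elim: n x => //= n IH x; rewrite -[RHS](avg_cst c x).
by congr avg; apply/funext.
Qed.

(** Typical invariant sets [Y] are the unimodular matrices and the nonzero vectors; outside them the
    compared functions may take default values. *)
Lemma iter_avg_le n F G (Y : set X) : tame F -> tame G ->
  (forall l x, Y x -> Y (act l x)) -> (forall x, Y x -> F x <= G x) ->
  forall x, Y x -> iter n avg F x <= iter n avg G x.
Proof.
move=> tF tG Yact FG; elim: n => //= n IH x Yx.
by apply: avg_le; [exact: tame_iter..|]; move=> l; apply: IH; exact: Yact.
Qed.

Lemma iter_avg_eq_on n F G (Y : set X) :
  (forall l x, Y x -> Y (act l x)) -> (forall x, Y x -> F x = G x) ->
  forall x, Y x -> iter n avg F x = iter n avg G x.
Proof.
move=> Yact FG; elim: n => //= n IH x Yx.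
by congr fine; apply: eq_integral => l _; rewrite IH//; exact: Yact.
Qed.

(** After [n] steps only [Y (j + n)] is reached, so a comparison on a bounded region suffices;
    [moment_block] linearises an exponential on such a region. *)
Lemma iter_avg_le_reach n F G (Y : nat -> set X) : tame F -> tame G ->
  (forall j l x, Y j x -> Y j.+1 (act l x)) ->
  forall j, (forall x, Y (j + n)%N x -> F x <= G x) ->
  forall x, Y j x -> iter n avg F x <= iter n avg G x.
Proof.
move=> tF tG Yact; elim: n => [|n IH] j FG x Yx /=.
  by apply: FG; rewrite addn0.
apply: avg_le; [exact: tame_iter..|]; move=> l.
by apply: (IH j.+1); [rewrite addSnnS|exact: Yact].
Qed.

(** If every [A i] contained a point with [G < s / 5], these five points would violate the
    hypothesis on sums. So [G >= s / 5] on a whole set [A i], whose mass is at least [p]. *)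
Lemma avg_pigeon5 (G : S -> R) (A : 'I_5 -> set S) (p s : R) :
  measurable_fun setT G -> (forall l, 0 <= G l) ->
  (exists C, forall l, G l <= C) -> (forall i, measurable (A i)) ->
  0 <= p -> (forall i, (p%:E <= nu (A i))%E) ->
  (forall l : 'I_5 -> S, (forall i, A i (l i)) -> s <= \sum_i G (l i)) ->
  p * s / 5 <= \int[nu]_l G l.
Proof.
move=> mG G0 [C GC] mA p0 pA hs.
have iG : nu.-integrable setT (EFin \o G).
  by apply: (@integrable_bounded _ C) => // l; rewrite ger0_norm.
have [s0|s0] := leP s 0.
  apply: (@le_trans _ _ 0); last exact: Rintegral_ge0.
  by rewrite ler_pdivrMr// mul0r; exact: mulr_ge0_le0.
have [i hi] : exists i, forall l, A i l -> s / 5 <= G l.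
  apply: contrapT => /forallNP h.
  have /choice[l hl] : forall i, exists l, A i l /\ G l < s / 5.
    move=> i; have /existsNP[l /not_implyP[Al /negP]] := h i.
    by rewrite -ltNge; exists l.
  have := hs l (fun i => (hl i).1); apply/negP; rewrite -ltNge.
  have hi i := (hl i).2.
  rewrite !big_ord_recl big_ord0.
  move: (hi ord0) (hi (lift ord0 ord0)) (hi (lift ord0 (lift ord0 ord0))).
  move: (hi (lift ord0 (lift ord0 (lift ord0 ord0)))).
  move: (hi (lift ord0 (lift ord0 (lift ord0 (lift ord0 ord0))))).
  by move=> ? ? ? ? ?; lra.
have sp : 0 < s / 5 by rewrite divr_gt0.
have iA : nu.-integrable setT (EFin \o (\1_(A i) : S -> R)).
  exact: integrable_indic.
have -> : p * s / 5 = s / 5 * p by ring.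
apply: (@le_trans _ _ (\int[nu]_l (s / 5 * \1_(A i) l))).
  rewrite RintegralZl// ler_wpM2l ?(ltW sp)//.
  rewrite /Rintegral integral_indic// setIT -lee_fin fineK//; first exact: pA.
  exact: fin_num_measure.
apply: le_Rintegral => //.
  by apply: (@integrable_bounded _ (s / 5)) => [|l];
    [exact: measurable_funM|rewrite normrM ger0_norm ?(ltW sp)// ler_piMr ?(ltW sp)//
     indicE ger0_norm// lern1 leq_b1].
move=> l _; rewrite indicE; case: (boolP (l \in A i)) => [/set_mem Al|_].
  by rewrite mulr1; exact: hi.
by rewrite mulr0.
Qed.

End Averaging.

(** [h] intertwines the two actions; this passes between a matrix, its columns and the image of a
    vector. *)
Lemma iter_avg_equivariant {dS dX dY : measure_display} {S : measurableType dS}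
    {X : measurableType dX} {Y : measurableType dY} {R : realType}
    (nu : probability S R) (act : S -> X -> X) (act' : S -> Y -> Y)
    (h : X -> Y) (F : Y -> R) :
  (forall l x, h (act l x) = act' l (h x)) ->
  forall n x, iter n (avg nu act) (F \o h) x = iter n (avg nu act') F (h x).
Proof.
move=> hact; elim=> //= n IH x; congr fine; apply: eq_integral => l _.
by rewrite IH hact.
Qed.

(** * Trajectories driven by independent variables *)

Section IidTrajectory.
Context {d dX : measure_display} {Omega : measurableType d}
  {X : measurableType dX} {R : realType} (P : probability Omega R)
  (lam : nat -> Omega -> R) (nu : probability R R) (act : R -> X -> X)
  (B : nat -> X -> Prop).
Hypotheses (iid : iid_law P lam nu)
  (act_meas : measurable_fun setT (fun p : R * X => act p.1 p.2))
  (B_cover : forall x, exists r, B r x)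
  (B_step : forall r l x, B r x -> B r.+1 (act l x)).

Fixpoint trajectory (u : nat -> R) (x : X) (n : nat) : X :=
  if n is k.+1 then act (u k) (trajectory u x k) else x.

Let S x n w := trajectory (fun k => lam k w) x n.

Let lam_meas n : measurable_fun setT (lam n). Proof. by case: iid. Qed.

Lemma measurable_trajectory x n : measurable_fun setT (S x n).
Proof.
elim: n => [|n IH]; first exact: measurable_cst.
exact: (measurableT_comp act_meas (measurable_fun_pair (lam_meas n) IH)).
Qed.

Let measurable_preim (d' : measure_display) (Y : measurableType d') (f : Omega -> Y) Z :
  measurable_fun setT f -> measurable Z -> measurable (f @^-1` Z).
Proof. by move=> mf mZ; rewrite -[X in measurable X]setTI; exact: mf. Qed.

Definition tail_event n m (A : nat -> set R) : set Omega :=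
  \bigcap_(i in `I_m) (lam (n + i)%N @^-1` A i).

Lemma measurable_tail_event n m A : (forall i, measurable (A i)) ->
  measurable (tail_event n m A).
Proof.
move=> mA; apply: bigcap_measurableType => i _; exact: measurable_preim.
Qed.

Lemma tail_eventS n m A : tail_event n m.+1 A =
  lam n @^-1` A 0%N `&` tail_event n.+1 m (fun i => A i.+1).
Proof.
apply/seteqP; split => w /= h.
  split; first by have := h 0%N isT; rewrite addn0.
  by move=> i im; have := h i.+1 im; rewrite /= addnS addSn.
case: h => h0 h [|i] im; first by rewrite /= addn0.
by have := h i im; rewrite /= addnS addSn.
Qed.

Lemma tail_event0 n A : tail_event n 0 A = setT.
Proof. by apply/seteqP; split. Qed.

(** The length [m] of the future is arbitrary so that the induction closes: the variable that leads
    to the state at time [n.+1] belongs to the future at time [n]. *)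
Lemma trajectory_indep x n Z m A : measurable Z -> (forall i, measurable (A i)) ->
  P (S x n @^-1` Z `&` tail_event n m A) =
  (P (S x n @^-1` Z) * \prod_(i < m) nu (A i))%E.
Proof.
elim: n Z m A => [|n IH] Z m A mZ mA.
  have [Zx|Zx] := pselect (Z x).
    rewrite (_ : S x 0 @^-1` Z = setT); last by apply/seteqP; split.
    rewrite setTI [X in (X * _)%E](_ : _ = 1%E); last exact: probability_setT.
    rewrite mul1e (_ : tail_event 0 m A = \bigcap_(i in `I_m) (lam i @^-1` A i)).
      case: iid => _ [h2 h3]; rewrite h3//; apply: eq_bigr => i _; exact: h2.
    by apply: eq_bigcapr => i _; rewrite add0n.
  rewrite (_ : S x 0 @^-1` Z = set0); last by apply/seteqP; split.
  by rewrite set0I measure0 mul0e.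
set C := tail_event n.+1 m A.
have mC : measurable C by exact: measurable_tail_event.
pose phi w := (S x n w, lam n w).
have mphi : measurable_fun setT phi.
  by apply: measurable_fun_pair; [exact: measurable_trajectory|exact: lam_meas].
have c0 : (0 <= \prod_(i < m) nu (A i))%E by apply: prode_ge0 => i _; exact: measure_ge0.
have cfin : (\prod_(i < m) nu (A i))%E \is a fin_num.
  by apply: prode_fin_num => i _; exact: fin_num_measure.
have c0' : 0 <= fine (\prod_(i < m) nu (A i))%E by exact: fine_ge0.
(* [m1] is the joint law of the state and the next variable restricted to the tail event, [m2] the
   joint law times the probability of that event. They agree on rectangles by induction, hence also
   on the set [V] of pairs that [act] sends into [Z]. *)
pose m1 := measure_function_pushforward__canonical__measure_function_Measure
  (mrestr P mC) mphi.
pose m2 := mscale (NngNum c0')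
  (measure_function_pushforward__canonical__measure_function_Measure P mphi).
have rect Z' B' : measurable Z' -> measurable B' -> m1 (Z' `*` B') = m2 (Z' `*` B').
  move=> mZ' mB'.
  have E k A' : P (phi @^-1` (Z' `*` B') `&` tail_event n.+1 k A') =
     P (S x n @^-1` Z' `&` tail_event n k.+1 (fun i => if i is j.+1 then A' j else B')).
    by rewrite tail_eventS setIA.
  have mA' A' : (forall i, measurable (A' i)) ->
      forall i, measurable ((fun i => if i is j.+1 then A' j else B') i).
    by move=> h [|i].
  rewrite /m1 /m2 /mscale /= /pushforward /mrestr fineK// E IH//; last exact: mA'.
  have := E 0%N A; rewrite tail_event0 setIT => ->; rewrite IH//; last exact: mA'.
  by rewrite !big_ord_recl big_ord0 /= mule1 muleA [LHS]muleC.
have key V : measurable V -> m1 V = m2 V.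
  apply: (measure_unique [set A `*` B | A in measurable & B in measurable] (fun=> setT)).
  - exact: measurable_prod_measurableType.
  - move=> _ _ [U1 mU1 [U2 mU2 <-]] [V1 mV1 [V2 mV2 <-]].
    by rewrite -setXI; exists (U1 `&` V1); [exact: measurableI|exists (U2 `&` V2) => //; exact: measurableI].
  - by move=> _; exists setT => //; exists setT => //; rewrite setXTT.
  - by apply: bigcup_const; exists 0%N.
  - by move=> _ [U1 mU1 [U2 mU2 <-]]; exact: rect.
  - move=> _; rewrite /m1 /= /pushforward /mrestr preimage_setT setTI.
    by rewrite -ge0_fin_numE ?measure_ge0// fin_num_measure.
pose V := (fun p : X * R => act p.2 p.1) @^-1` Z.
have mV : measurable V.
  rewrite -[X in measurable X]setTI.
  have msw : measurable_fun setT (fun p : X * R => (p.2, p.1)).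
    by apply: measurable_fun_pair; [exact: measurable_snd|exact: measurable_fst].
  exact: (measurableT_comp act_meas msw).
have := key V mV; rewrite /m1 /m2 /mscale /= /pushforward /mrestr fineK//.
by move=> h; rewrite [LHS]h muleC.
Qed.

(** The pair (state, next variable) has a product law, so Tonelli integrates the variable out and
    leaves [avg F] evaluated at the state. *)
Lemma integral_trajectory x n (F : X -> R) : tame B F -> (forall y, 0 <= F y) ->
  (\int[P]_w (F (S x n w))%:E = (iter n (avg nu act) F x)%:E)%E.
Proof.
elim: n F => [|n IH] F tF F0.
  rewrite /S /= integral_cst//= [X in (_ * X)%E](_ : _ = 1%E) ?mule1//.
  exact: probability_setT.
have mS := measurable_trajectory x n.
pose phi w := (S x n w, lam n w).
have mphi : measurable_fun setT phi by exact: measurable_fun_pair.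
have msw : measurable_fun setT (fun p : X * R => (p.2, p.1)).
  by apply: measurable_fun_pair; [exact: measurable_snd|exact: measurable_fst].
pose G (p : X * R) := (F (act p.2 p.1))%:E.
have mG : measurable_fun setT G.
  by apply/measurable_EFinP; apply: (measurableT_comp tF.1 (measurableT_comp act_meas msw)).
have G0 p : (0 <= G p)%E by rewrite lee_fin.
pose law := distribution P (mfun_Sub (mem_set mS)).
have lawE (H : X -> \bar R) : measurable_fun setT H -> (forall y, 0 <= H y)%E ->
    (\int[law]_y H y = \int[P]_w H (S x n w))%E.
  by move=> mH H0; rewrite ge0_integral_pushforward.
have tTF : tame B (avg nu act F) by exact: (tame_avg nu act_meas B_cover B_step).
have T0 y : 0 <= avg nu act F y by apply: Rintegral_ge0 => l _; exact: F0.
rewrite iterSr -IH// -(lawE (EFin \o avg nu act F)).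
  have -> : (EFin \o avg nu act F) = (fun y => \int[nu]_l G (y, l))%E.
    apply/funext => y /=; rewrite /avg /Rintegral fineK//.
    exact: (integrable_fin_num measurableT (integrable_act nu act_meas B_cover B_step y tF)).
  rewrite -(@fubini_tonelli1 _ _ _ _ R law nu _ mG G0).
  transitivity (\int[pushforward P phi]_p G p)%E.
    by rewrite ge0_integral_pushforward.
  apply: eq_measure_integral => V mV _.
  apply/esym; apply: product_measure_unique => // Z' B' mZ' mB'.
  rewrite /pushforward.
  have := @trajectory_indep x n Z' 1 (fun=> B') mZ' (fun=> mB').
  rewrite tail_eventS tail_event0 setIT big_ord_recl big_ord0 mule1 => <-.
  by [].
- by apply/measurable_EFinP; case: tTF.
- by move=> y; rewrite lee_fin.
Qed.

End IidTrajectory.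

Lemma borel_cantelli_geometric {d : measure_display} {R : realType} {Omega : measurableType d}
    (P : probability Omega R) (F : nat -> set Omega) (D q : R) : 0 <= D -> 0 < q < 1 ->
  (forall n, measurable (F n)) -> (forall n, (P (F n) <= (D * q ^+ n)%:E)%E) ->
  {ae P, forall w, exists N, forall n, (N <= n)%N -> ~ F n w}.
Proof.
move=> D0 /andP[q0 q1] mF PF.
have q1' : 0 < 1 - q by lra.
have sum_fin : (\sum_(n <oo) P (F n) < +oo)%E.
  apply: (@le_lt_trans _ _ (D / (1 - q))%:E); last exact: ltry.
  apply: lime_le; first by apply: is_cvg_nneseries => n _ _; exact: measure_ge0.
  apply: nearW => n; apply: (@le_trans _ _ (D / (1 - q) * (1 - q ^+ n))%:E).
    elim: n => [|n IH]; first by rewrite big_geq// expr0 subrr mulr0.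
    rewrite big_nat_recr//=; apply: le_trans (leeD IH (PF n)) _.
    rewrite -EFinD lee_fin exprS le_eqVlt; apply/orP; left; apply/eqP.
    by field; rewrite gt_eqF.
  rewrite lee_fin; apply: ler_piMr; first by rewrite divr_ge0// ltW.
  by rewrite gerBl exprn_ge0// ltW.
have h := lim_sup_set_cvg0 mF sum_fin.
exists (lim_sup_set F); split => //.
  apply: bigcap_measurableType => n _; apply: bigcup_measurable => k _; exact: mF.
move=> w /= /forallNP hw n _.
have /existsNP[k /not_implyP[nk /contrapT Fk]] := hw n.
by exists k.
Qed.

(** * Transfer matrices on the plane *)

Section Plane.
Context {R : realType}.
Implicit Types (v w x y : R * R) (p : (R * R) * (R * R)).

Definition n2 v : R := v.1 ^+ 2 + v.2 ^+ 2.
Definition wedge v w : R := v.1 * w.2 - v.2 * w.1.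
Definition dot v w : R := v.1 * w.1 + v.2 * w.2.
Definition swapv v : R * R := (v.2, v.1).
Definition lin (c : R * R) p : R * R :=
  (c.1 * p.1.1 + c.2 * p.2.1, c.1 * p.1.2 + c.2 * p.2.2).
Definition e1 : R * R := (1, 0).
Definition e2 : R * R := (0, 1).

(* Multiplication of the column vector [v] by [Mstep f0 f1 l E], and by its inverse. *)
Definition step (f0 f1 E l : R) v : R * R :=
  let u := (E - f0 * l) * v.1 - v.2 in ((E - f1 * l) * u - v.1, u).
Definition stepV (f0 f1 E l : R) v : R * R :=
  let u := (E - f1 * l) * v.2 - v.1 in (u, (E - f0 * l) * u - v.2).

Lemma n2_ge0 v : 0 <= n2 v. Proof. by rewrite addr_ge0 ?sqr_ge0. Qed.

Lemma n2_eq0 v : (n2 v == 0) = (v == (0, 0)).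
Proof. by rewrite paddr_eq0 ?sqr_ge0// !sqrf_eq0; case: v. Qed.

Lemma n2_gt0 v : (0 < n2 v) = (v != (0, 0)).
Proof. by rewrite lt_neqAle n2_ge0 andbT eq_sym n2_eq0. Qed.

Lemma stepK f0 f1 E l : cancel (step f0 f1 E l) (stepV f0 f1 E l).
Proof. by case=> a b; rewrite /stepV /step /=; congr pair; ring. Qed.

Lemma stepVK f0 f1 E l : cancel (stepV f0 f1 E l) (step f0 f1 E l).
Proof. by case=> a b; rewrite /stepV /step /=; congr pair; ring. Qed.

(** Time reversal: conjugation by the swap turns the inverse into a step with [f0] and [f1]
    exchanged, so bounds for steps carry over to inverses. *)
Lemma stepV_swap f0 f1 E l v :
  stepV f0 f1 E l v = swapv (step f1 f0 E l (swapv v)).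
Proof. by []. Qed.

Lemma wedge_step f0 f1 E l v w :
  wedge (step f0 f1 E l v) (step f0 f1 E l w) = wedge v w.
Proof. by rewrite /wedge /step /=; ring. Qed.

Lemma wedge_stepV f0 f1 E l v w :
  wedge (stepV f0 f1 E l v) (stepV f0 f1 E l w) = wedge v w.
Proof. by rewrite /wedge /stepV /=; ring. Qed.

Lemma step_lin f0 f1 E l c p :
  step f0 f1 E l (lin c p) = lin c (step f0 f1 E l p.1, step f0 f1 E l p.2).
Proof. by rewrite /step /lin /=; congr pair; ring. Qed.

Lemma lin_basis v : lin v (e1, e2) = v.
Proof. by case: v => a b; rewrite /lin /=; congr pair; ring. Qed.

Lemma wedge_lin c c' p : wedge (lin c p) (lin c' p) = wedge c c' * wedge p.1 p.2.
Proof. by rewrite /wedge /lin /=; ring. Qed.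

Lemma lagrange v w : n2 v * n2 w = dot v w ^+ 2 + wedge v w ^+ 2.
Proof. by rewrite /n2 /dot /wedge; ring. Qed.

Lemma wedge_sqr_le v w : wedge v w ^+ 2 <= n2 v * n2 w.
Proof. by rewrite lagrange lerDr sqr_ge0. Qed.

(** Cauchy-Schwarz. The sum [n2 p.1 + n2 p.2] is the squared Hilbert-Schmidt norm of the matrix with
    columns [p]; it measures matrices from here on. *)
Lemma n2_lin_le c p : n2 (lin c p) <= n2 c * (n2 p.1 + n2 p.2).
Proof.
case: c p => [a b] [[x y] [z t]]; rewrite /n2 /lin /=.
have := sqr_ge0 (a * z - b * x); have := sqr_ge0 (a * t - b * y); nra.
Qed.

Lemma n2_wedge1_ge p : wedge p.1 p.2 = 1 -> 1 <= n2 p.1 + n2 p.2.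
Proof.
case: p => [[x y] [z t]]; rewrite /wedge /n2 /= => h.
have := sqr_ge0 (x - t); have := sqr_ge0 (y + z); nra.
Qed.

Lemma n2_step_le (f0 f1 E l b : R) v :
  `|E - f0 * l| <= b -> `|E - f1 * l| <= b ->
  n2 (step f0 f1 E l v) <= (2 * b ^+ 2 + 2) ^+ 2 * n2 v.
Proof.
(* A step is a product of two transfer matrices, and each costs the factor [2 * b ^+ 2 + 2]. *)
have transfer (c x y : R) : `|c| <= b ->
    (c * x - y) ^+ 2 + x ^+ 2 <= (2 * b ^+ 2 + 2) * (x ^+ 2 + y ^+ 2).
  move=> cb; have cb2 : c ^+ 2 <= b ^+ 2.
    by rewrite -[c ^+ 2]real_normK ?num_real// ler_sqr ?nnegrE// (le_trans _ cb).
  have := sqr_ge0 (c * x + y); have := sqr_ge0 x; have := sqr_ge0 y.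
  have : c ^+ 2 * x ^+ 2 <= b ^+ 2 * x ^+ 2 by rewrite ler_wpM2r ?sqr_ge0.
  have : 0 <= b ^+ 2 * y ^+ 2 by rewrite mulr_ge0 ?sqr_ge0.
  by move=> ? ? ? ? ?; nra.
move=> h0 h1; rewrite /n2 /step /=; set u := (_ * v.1 - v.2).
apply: le_trans (transfer _ u v.1 h1) _.
rewrite [X in _ <= X](_ : _ = (2 * b ^+ 2 + 2) *
  ((2 * b ^+ 2 + 2) * (v.1 ^+ 2 + v.2 ^+ 2))); last by ring.
rewrite ler_wpM2l//; last exact: transfer.
by have := sqr_ge0 b; lra.
Qed.

Lemma n2_stepV_le (f0 f1 E l b : R) v :
  `|E - f0 * l| <= b -> `|E - f1 * l| <= b ->
  n2 (stepV f0 f1 E l v) <= (2 * b ^+ 2 + 2) ^+ 2 * n2 v.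
Proof.
move=> h0 h1; rewrite stepV_swap.
have nsw w : n2 (swapv w) = n2 w by rewrite /n2 /= addrC.
by rewrite nsw -(nsw v); exact: n2_step_le.
Qed.

Lemma wedge_step_params f0 f1 E l m v :
  wedge (step f0 f1 E l v) (step f0 f1 E m v) =
  - (l - m) * (f1 * (((E - f0 * l) * v.1 - v.2) * ((E - f0 * m) * v.1 - v.2))
               + f0 * v.1 ^+ 2).
Proof. by rewrite /wedge /step /=; ring. Qed.

(** The term [f0 * x ^+ 2] controls [x]. To control [y], the product is bounded below by
    [y^2 / 2 - 3 b^2 x^2]; as it is nonnegative, only its fraction [th] may be kept, with [th] so
    small that half of [f0 * x ^+ 2] absorbs the negative part. *)
Lemma same_sign_lower (f0 f1 b : R) : 0 < f0 -> 0 < f1 -> 0 <= b ->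
  exists2 eta : R, 0 < eta & forall (c c' x y : R), `|c| <= b -> `|c'| <= b ->
    0 <= (c * x - y) * (c' * x - y) ->
    eta * (x ^+ 2 + y ^+ 2) <= f1 * ((c * x - y) * (c' * x - y)) + f0 * x ^+ 2.
Proof.
move=> f00 f10 b0.
pose D := 6 * f1 * b ^+ 2 + f0 + f1.
have b20 := sqr_ge0 b.
have D0 : 0 < D by rewrite /D; nra.
pose th := f0 / D.
have th0 : 0 < th by rewrite divr_gt0.
have thD : th * D = f0 by rewrite /th divfK ?gt_eqF.
have th1 : th <= 1.
  by rewrite /th ler_pdivrMr// mul1r /D; nra.
have thb : 6 * f1 * th * b ^+ 2 <= f0.
  by rewrite -[leRHS]thD /D; nra.
exists (Num.min (f1 * th / 2) (f0 / 2)).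
  by rewrite lt_min !divr_gt0// mulr_gt0.
move=> c c' x y cb c'b; set P := (c * x - y) * (c' * x - y) => P0.
set eta := Num.min _ _.
have h1 : eta <= f1 * th / 2 by rewrite /eta ge_min lexx.
have h2 : eta <= f0 / 2 by rewrite /eta ge_min lexx orbT.
have x0 := sqr_ge0 x; have y0 := sqr_ge0 y.
have PL : y ^+ 2 / 2 - 3 * b ^+ 2 * x ^+ 2 <= P.
  move: cb c'b; rewrite !ler_norml => /andP[c1 c2] /andP[c3 c4].
  have cc : - b ^+ 2 <= c * c' by nra.
  have ss : (c + c') ^+ 2 <= 4 * b ^+ 2 by nra.
  have := sqr_ge0 (y - (c + c') * x).
  have : (c + c') ^+ 2 * x ^+ 2 <= 4 * b ^+ 2 * x ^+ 2 by rewrite ler_wpM2r.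
  have : - b ^+ 2 * x ^+ 2 <= c * c' * x ^+ 2 by rewrite ler_wpM2r.
  by rewrite /P => ? ? ?; nra.
have PT : th * (y ^+ 2 / 2 - 3 * b ^+ 2 * x ^+ 2) <= P.
  apply: le_trans (_ : th * P <= _); first by rewrite ler_wpM2l// ltW.
  by rewrite ler_piMl.
have : f1 * (th * (y ^+ 2 / 2 - 3 * b ^+ 2 * x ^+ 2)) <= f1 * P.
  by rewrite ler_wpM2l// ltW.
have : eta * x ^+ 2 <= f0 / 2 * x ^+ 2 by rewrite ler_wpM2r.
have : eta * y ^+ 2 <= f1 * th / 2 * y ^+ 2 by rewrite ler_wpM2r.
have : 6 * f1 * th * b ^+ 2 * x ^+ 2 <= f0 * x ^+ 2 by rewrite ler_wpM2r.
by move=> ? ? ? ?; nra.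
Qed.

Lemma three_same_sign (u : 'I_5 -> R) : exists i j k : 'I_5,
  [/\ [/\ i != j, j != k & i != k], 0 <= u i * u j, 0 <= u j * u k &
    0 <= u i * u k].
Proof.
pose A : {set 'I_5} := [set i | 0 <= u i]%SET.
have [h|h] := leqP 3 #|A|.
  have /card_gt2P[i [j [k [[]]]]] := h; rewrite !inE => ui uj uk [ij jk ki].
  exists i, j, k; split; [split => //; by rewrite eq_sym|..]; exact: mulr_ge0.
have {}h : (2 < #|~: A|)%N.
  by rewrite -(ltn_add2l #|A|) cardsC card_ord; move: h; lia.
have /card_gt2P[i [j [k [[]]]]] := h; rewrite !inE -!ltNge.
move=> /ltW ui /ltW uj /ltW uk [ij jk ki].
exists i, j, k; split; [split => //; by rewrite eq_sym|..]; exact: mulr_le0.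
Qed.

(* This is where five points of the support are needed: the images of a line
   under two of the matrices coincide only when the second entries of the
   images of a vector have opposite signs, and among five real numbers three
   have the same weak sign. *)
Lemma three_directions (f0 f1 E b delta : R) : 0 < f0 -> 0 < f1 -> 0 <= b ->
  0 < delta ->
  exists2 eta : R, 0 < eta & forall (l : 'I_5 -> R),
    (forall i, `|E - f0 * l i| <= b) ->
    (forall i j, i != j -> delta <= `|l i - l j|) ->
    forall v, exists i j k : 'I_5,
      [/\ [/\ i != j, j != k & i != k],
        eta * n2 v <= `|wedge (step f0 f1 E (l i) v) (step f0 f1 E (l j) v)|,
        eta * n2 v <= `|wedge (step f0 f1 E (l j) v) (step f0 f1 E (l k) v)| &
        eta * n2 v <= `|wedge (step f0 f1 E (l i) v) (step f0 f1 E (l k) v)|].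
Proof.
move=> f00 f10 b0 d0.
have [eta eta0 heta] := same_sign_lower f00 f10 b0.
exists (delta * eta); first exact: mulr_gt0.
move=> l lb lsep v.
have [i [j [k [[ij jk ik] uij ujk uik]]]] :=
  three_same_sign (fun i => (E - f0 * l i) * v.1 - v.2).
have key a c : a != c ->
    0 <= ((E - f0 * l a) * v.1 - v.2) * ((E - f0 * l c) * v.1 - v.2) ->
    delta * eta * n2 v <=
      `|wedge (step f0 f1 E (l a) v) (step f0 f1 E (l c) v)|.
  move=> ac uac; rewrite wedge_step_params normrM normrN -mulrA.
  apply: ler_pM; [exact: ltW|by rewrite mulr_ge0 ?n2_ge0 ?ltW|exact: lsep|].
  by apply: le_trans (ler_norm _); exact: heta.
by exists i, j, k; split => //; exact: key.
Qed.

Lemma three_directionsV (f0 f1 E b delta : R) : 0 < f0 -> 0 < f1 -> 0 <= b ->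
  0 < delta ->
  exists2 eta : R, 0 < eta & forall (l : 'I_5 -> R),
    (forall i, `|E - f1 * l i| <= b) ->
    (forall i j, i != j -> delta <= `|l i - l j|) ->
    forall v, exists i j k : 'I_5,
      [/\ [/\ i != j, j != k & i != k],
        eta * n2 v <= `|wedge (stepV f0 f1 E (l i) v) (stepV f0 f1 E (l j) v)|,
        eta * n2 v <= `|wedge (stepV f0 f1 E (l j) v) (stepV f0 f1 E (l k) v)| &
        eta * n2 v <= `|wedge (stepV f0 f1 E (l i) v) (stepV f0 f1 E (l k) v)|].
Proof.
move=> f00 f10 b0 d0.
have [eta eta0 heta] := three_directions E f10 f00 b0 d0.
exists eta => // l lb lsep v.
have [i [j [k [dist h1 h2 h3]]]] := heta l lb lsep (swapv v).
have nsw : n2 (swapv v) = n2 v by rewrite /n2 /= addrC.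
have wsw x y : `|wedge (swapv x) (swapv y)| = `|wedge x y|.
  by rewrite -normrN /wedge /=; congr `|_|; ring.
exists i, j, k; rewrite !stepV_swap !wsw -nsw.
by split.
Qed.

End Plane.

(** * Operator norm of the cocycle and its two columns *)

Section CocycleNorm.
Context {R : realType}.
Implicit Types (v : R * R) (A : 'M[R]_2).

Definition col v : 'cV[R]_2 := \col_i (if i == 0 :> nat then v.1 else v.2).

Lemma col_surj (x : 'cV[R]_2) : x = col (x 0 0, x 1 0).
Proof.
apply/matrixP => i j; rewrite mxE ord1.
by case: i => -[|[|//]] hi /=; congr (x _ _); exact: val_inj.
Qed.

Lemma vnorm2_col v : vnorm2 (col v) = Num.sqrt (n2 v).
Proof. by rewrite /vnorm2 !big_ord_recl big_ord0 !mxE /= addr0. Qed.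

Lemma Mstep_col (f0 f1 E l : R) v : Mstep f0 f1 l E *m col v = col (step f0 f1 E l v).
Proof.
have T_col f w : Tmat f l E *m col w = col ((E - f * l) * w.1 - w.2, w.1).
  apply/matrixP => i j; rewrite mxE !big_ord_recl big_ord0 !mxE /= addr0.
  by case: i => -[|[|//]] hi /=; ring.
by rewrite /Mstep -mulmxA !T_col.
Qed.

Lemma cocycle_col (f0 f1 E : R) u v n :
  cocycle f0 f1 E n u *m col v = col (trajectory (step f0 f1 E) u v n).
Proof.
elim: n => [|n IH] /=; first by rewrite mul1mx.
by rewrite -mulmxA IH Mstep_col.
Qed.

Lemma opnorm_bounds A (p : (R * R) * (R * R)) :
  A *m col e1 = col p.1 -> A *m col e2 = col p.2 ->
  Num.sqrt (n2 p.1) <= opnorm A <= Num.sqrt (n2 p.1 + n2 p.2).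
Proof.
move=> A1 A2.
have A_col v : A *m col v = col (lin v p).
  have -> : col v = v.1 *: col e1 + v.2 *: col e2.
    apply/matrixP => i j; rewrite !mxE.
    by case: i => -[|[|//]] hi /=; ring.
  rewrite mulmxDr -!scalemxAr A1 A2.
  apply/matrixP => i j; rewrite !mxE.
  by case: i => -[|[|//]] hi /=; rewrite /lin /=; ring.
(* A [sup] is meaningful only on a nonempty set bounded above; [bound] and [mem] supply these two
   properties together with the two inequalities. *)
have bound : ubound [set vnorm2 (A *m v) | v in [set v : 'cV[R]_2 | vnorm2 v = 1]]
    (Num.sqrt (n2 p.1 + n2 p.2)).
  move=> _ [x /= x1 <-]; move: x1; rewrite [x]col_surj; set v := (_, _).
  rewrite vnorm2_col => v1; rewrite A_col vnorm2_col ler_wsqrtr//.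
  apply: le_trans (n2_lin_le _ _) _.
  by rewrite -[n2 v]sqr_sqrtr ?n2_ge0// v1 expr1n mul1r.
have mem : [set vnorm2 (A *m v) | v in [set v : 'cV[R]_2 | vnorm2 v = 1]]
    (Num.sqrt (n2 p.1)).
  exists (col e1); last by rewrite A1 vnorm2_col.
  by rewrite /= vnorm2_col /n2 /= expr1n expr0n /= addr0 sqrtr1.
apply/andP; split.
  by apply: ub_le_sup => //; exists (Num.sqrt (n2 p.1 + n2 p.2)).
by apply: ge_sup => //; exists (Num.sqrt (n2 p.1)).
Qed.

Lemma ln_sqrt (x : R) : 0 < x -> ln (Num.sqrt x) = ln x / 2.
Proof.
move=> x0; rewrite -{2}[x]sqr_sqrtr ?(ltW x0)// lnXn ?sqrtr_gt0// mulr2n.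
by field.
Qed.

(** The norm lies between the length of the first column and the Hilbert-Schmidt norm, which exceeds
    the longer column by a factor at most [sqrt 2]; division by [n.+1] erases it. Lengths instead of
    squared lengths halve the limit. *)
Lemma ln_opnorm_cvg (A : nat -> 'M[R]_2) (p : nat -> (R * R) * (R * R)) (L : R) :
  (forall n, A n *m col e1 = col (p n).1) -> (forall n, A n *m col e2 = col (p n).2) ->
  (forall n, (p n).1 != (0, 0)) -> (forall n, (p n).2 != (0, 0)) ->
  (fun n => n.+1%:R^-1 * ln (n2 (p n).1)) @ \oo --> L ->
  (fun n => n.+1%:R^-1 * ln (n2 (p n).2)) @ \oo --> L ->
  (fun n => n.+1%:R^-1 * ln (opnorm (A n))) @ \oo --> L / 2.
Proof.
move=> A1 A2 p1 p2 /cvgrPdist_le c1 /cvgrPdist_le c2.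
apply/cvgrPdist_le => e e0.
have e_half : 0 < e / 2 by lra.
pose m := Num.bound (ln 2 / e).
have ln20 : 0 <= ln 2 :> R by rewrite ln_ge0//; lra.
near=> n.
have x1 : `|L - n.+1%:R^-1 * ln (n2 (p n).1)| <= e by near: n; exact: c1.
have x2 : `|L - n.+1%:R^-1 * ln (n2 (p n).2)| <= e by near: n; exact: c2.
have x3 : n.+1%:R^-1 * ln 2 <= e.
  rewrite mulrC ler_pdivrMr// mulrC -ler_pdivrMr//.
  have h : ln 2 / e < m%:R by apply: archi_boundP; rewrite divr_ge0// ltW.
  apply: le_trans (ltW h) _; rewrite ler_nat leqW//.
  by near: n; exact: nbhs_infty_ge.
have n0 : 0 < n.+1%:R^-1 :> R by rewrite invr_gt0.
have := p1 n; have := p2 n; rewrite -!n2_gt0; set a := n2 (p n).1; set b := n2 (p n).2 => b0 a0.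
have /andP[q1 q2] := opnorm_bounds (A1 n) (A2 n).
rewrite -/a -/b in x1 x2 q1 q2.
have sa : 0 < Num.sqrt a by rewrite sqrtr_gt0.
have q0 : 0 < opnorm (A n) := lt_le_trans sa q1.
have l1 : ln a / 2 <= ln (opnorm (A n)).
  by rewrite -ln_sqrt// ler_ln ?posrE.
have l2 : ln (opnorm (A n)) <= ln (a + b) / 2.
  have ab : 0 < a + b by lra.
  by rewrite -ln_sqrt// ler_ln ?posrE// sqrtr_gt0.
have l3 (x y : R) : 0 < y -> y <= x -> ln (x + y) <= ln 2 + ln x.
  move=> y0 yx; have x0 : 0 < x by lra.
  by rewrite -lnM ?posrE// ler_ln ?posrE; lra.
set N := n.+1%:R^-1 in x1 x2 x3 n0 *.
set la := ln a in x1 l1 l3 *; set lb := ln b in x2 *.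
have l4 : N * ln (a + b) <= L + e + e.
  move: x1 x2; rewrite !ler_norml => /andP[x1 x1'] /andP[x2 x2'].
  have [ba|ab] := leP b a.
    apply: le_trans (ler_wpM2l (ltW n0) (l3 _ _ b0 ba)) _.
    by rewrite mulrDr -/la; lra.
  rewrite addrC; apply: le_trans (ler_wpM2l (ltW n0) (l3 _ _ a0 (ltW ab))) _.
  by rewrite mulrDr -/lb; lra.
have l5 := ler_wpM2l (ltW n0) l1; have l6 := ler_wpM2l (ltW n0) l2.
move: x1; rewrite !ler_norml => /andP[x1 x1'].
by apply/andP; split; lra.
Unshelve. all: by end_near.
Qed.

End CocycleNorm.

(** * Expansion of vectors and contraction of angles *)

Section PlaneLog.
Context {R : realType}.
Implicit Types (v w x y : R * R) (p : (R * R) * (R * R)).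

(** Cramer's rule recovers the columns of [p] from the images of [c] and [c'], so these images are
    not both small when [p] is large. *)
Lemma n2_lin_pair_ge c c' p (B : R) : n2 c <= B -> n2 c' <= B ->
  wedge c c' ^+ 2 * (n2 p.1 + n2 p.2) <= 2 * B * (n2 (lin c p) + n2 (lin c' p)).
Proof.
move=> cB c'B.
apply: (@le_trans _ _ (2 * (n2 c' * n2 (lin c p) + n2 c * n2 (lin c' p)))).
  case: c c' p {cB c'B} => [a b] [a' b'] [[x1 x2] [y1 y2]].
  rewrite /wedge /n2 /lin /=.
  set u1 := a * x1 + b * y1; set u2 := a * x2 + b * y2.
  set w1 := a' * x1 + b' * y1; set w2 := a' * x2 + b' * y2.
  have -> : (a * b' - b * a') ^+ 2 * (x1 ^+ 2 + x2 ^+ 2 + (y1 ^+ 2 + y2 ^+ 2)) =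
    (b' * u1 - b * w1) ^+ 2 + (b' * u2 - b * w2) ^+ 2 +
    ((a' * u1 - a * w1) ^+ 2 + (a' * u2 - a * w2) ^+ 2).
    by rewrite /u1 /u2 /w1 /w2; ring.
  have := sqr_ge0 (b' * u1 + b * w1); have := sqr_ge0 (b' * u2 + b * w2).
  have := sqr_ge0 (a' * u1 + a * w1); have := sqr_ge0 (a' * u2 + a * w2).
  by move=> ? ? ? ?; lra.
have h1 : n2 c' * n2 (lin c p) <= B * n2 (lin c p).
  by rewrite ler_wpM2r ?n2_ge0.
have h2 : n2 c * n2 (lin c' p) <= B * n2 (lin c' p).
  by rewrite ler_wpM2r ?n2_ge0.
by move: h1 h2 => ? ?; lra.
Qed.

(** The larger of the images of [x] and [y] is comparable to the norm of [p] by [n2_lin_pair_ge].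
    The product of the smaller one with the image of [z] is bounded below because [p] preserves the
    wedge of these two vectors. *)
Lemma n2_three_ge (K N eta : R) p x y z : 0 < K -> 0 < N -> 0 < eta ->
  wedge p.1 p.2 = 1 ->
  n2 x <= K * N -> n2 y <= K * N -> n2 z <= K * N ->
  eta * N <= `|wedge x y| -> eta * N <= `|wedge y z| -> eta * N <= `|wedge x z| ->
  eta ^+ 4 * N ^+ 3 * (n2 p.1 + n2 p.2) <=
    4 * K * (n2 (lin x p) * n2 (lin y p) * n2 (lin z p)).
Proof.
move=> K0 N0 e0 p1 xK yK zK xy yz xz.
have sq c c' : eta * N <= `|wedge c c'| ->
    eta ^+ 2 * N ^+ 2 <= n2 (lin c p) * n2 (lin c' p).
  move=> h; apply: le_trans (wedge_sqr_le _ _).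
  rewrite wedge_lin p1 mulr1 -exprMn -[leRHS]real_normK ?num_real//.
  by rewrite ler_sqr ?nnegrE// mulr_ge0 ?ltW.
have mx : eta ^+ 2 * N * (n2 p.1 + n2 p.2) <=
    2 * K * (n2 (lin x p) + n2 (lin y p)).
  rewrite -(ler_pM2l N0).
  have h := n2_lin_pair_ge p xK yK.
  apply: (@le_trans _ _ (wedge x y ^+ 2 * (n2 p.1 + n2 p.2))).
    rewrite [leLHS](_ : _ = (eta * N) ^+ 2 * (n2 p.1 + n2 p.2)); last by ring.
    rewrite ler_wpM2r ?(addr_ge0 (n2_ge0 _) (n2_ge0 _))//.
    rewrite -[leRHS]real_normK ?num_real//.
    by rewrite ler_sqr ?nnegrE// mulr_ge0 ?ltW.
  by apply: le_trans h _; rewrite le_eqVlt; apply/orP; left; apply/eqP; ring.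
have sxz := sq _ _ xz; have syz := sq _ _ yz.
move: mx sxz syz; move: (n2_ge0 (lin x p)) (n2_ge0 (lin y p)) (n2_ge0 (lin z p)).
set a := n2 (lin x p); set b := n2 (lin y p); set c := n2 (lin z p).
set m := n2 p.1 + n2 p.2 => a0 b0 c0 mx ac bc.
have m0 : 0 <= m := addr_ge0 (n2_ge0 _) (n2_ge0 _).
have K2 : 0 <= 2 * K by rewrite mulr_ge0 ?ltW.
have en : 0 <= eta ^+ 2 * N ^+ 2 by rewrite mulr_ge0 ?sqr_ge0.
have em : 0 <= eta ^+ 2 * N * m by rewrite !mulr_ge0 ?sqr_ge0// ltW.
have [ab|/ltW ba] := leP a b.
  rewrite [leLHS](_ : _ = (eta ^+ 2 * N * m) * (eta ^+ 2 * N ^+ 2)); last by ring.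
  rewrite [leRHS](_ : _ = (4 * K * b) * (a * c)); last by ring.
  apply: ler_pM => //; apply: le_trans mx _.
  rewrite [leRHS](_ : _ = 2 * K * (b + b)); last by ring.
  by apply: ler_wpM2l => //; lra.
rewrite [leLHS](_ : _ = (eta ^+ 2 * N * m) * (eta ^+ 2 * N ^+ 2)); last by ring.
rewrite [leRHS](_ : _ = (4 * K * a) * (b * c)); last by ring.
apply: ler_pM => //; apply: le_trans mx _.
rewrite [leRHS](_ : _ = 2 * K * (a + a)); last by ring.
by apply: ler_wpM2l => //; lra.
Qed.

Lemma lin_neq0 c p : wedge p.1 p.2 = 1 -> c != (0, 0) -> lin c p != (0, 0).
Proof.
move=> p1; apply: contra_neq => h.
have h1 : (lin c p).1 * p.2.2 - (lin c p).2 * p.2.1 = c.1 * wedge p.1 p.2.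
  by rewrite /lin /wedge /=; ring.
have h2 : (lin c p).2 * p.1.1 - (lin c p).1 * p.1.2 = c.2 * wedge p.1 p.2.
  by rewrite /lin /wedge /=; ring.
move: h1 h2; rewrite h p1 /= !mul0r subrr !mulr1.
by case: c {h} => a b /= <- <-.
Qed.

(* A unimodular matrix expands two of three vectors in general position about
   as much as its norm, and contracts the third at most by that factor. *)
Lemma ln_n2_three_ge (K eta : R) : 0 < K -> 0 < eta -> exists C : R,
  forall (N : R) p x y z, 0 < N -> wedge p.1 p.2 = 1 ->
  n2 x <= K * N -> n2 y <= K * N -> n2 z <= K * N ->
  eta * N <= `|wedge x y| -> eta * N <= `|wedge y z| -> eta * N <= `|wedge x z| ->
  ln (n2 p.1 + n2 p.2) + 3 * ln N - C <=
    ln (n2 (lin x p)) + ln (n2 (lin y p)) + ln (n2 (lin z p)).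
Proof.
move=> K0 e0; exists (ln (4 * K) - ln (eta ^+ 4)) => N p x y z N0 p1 xK yK zK xy yz xz.
have := n2_three_ge K0 N0 e0 p1 xK yK zK xy yz xz.
have m0 : 0 < n2 p.1 + n2 p.2 by apply: lt_le_trans (n2_wedge1_ge p1).
have e4 : 0 < eta ^+ 4 by rewrite exprn_gt0.
have N3 : 0 < N ^+ 3 by rewrite exprn_gt0.
have pos c : 0 < n2 c -> 0 < n2 (lin c p) by rewrite !n2_gt0; exact: lin_neq0.
have nz c c' : eta * N <= `|wedge c c'| -> 0 < n2 c /\ 0 < n2 c'.
  move=> h; have cc : wedge c c' != 0.
    by rewrite -normr_gt0; apply: lt_le_trans h; rewrite mulr_gt0.
  rewrite !n2_gt0; split; apply: contra_neq cc => ->; rewrite /wedge /=; ring.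
have [/pos x0 /pos y0] := nz _ _ xy; have [_ /pos z0] := nz _ _ yz.
rewrite -ler_ln ?posrE ?mulr_gt0//.
have K4 : 0 < 4 * K by rewrite mulr_gt0.
have -> : ln (eta ^+ 4 * N ^+ 3 * (n2 p.1 + n2 p.2)) =
    ln (eta ^+ 4) + 3 * ln N + ln (n2 p.1 + n2 p.2).
  by rewrite lnM ?posrE ?(mulr_gt0 e4)// lnM ?posrE// (lnXn 3) // mulr_natl.
have -> : ln (4 * K * (n2 (lin x p) * n2 (lin y p) * n2 (lin z p))) =
    ln (4 * K) + (ln (n2 (lin x p)) + ln (n2 (lin y p)) + ln (n2 (lin z p))).
  have xy0 := mulr_gt0 x0 y0.
  have lnM' (a b : R) : 0 < a -> 0 < b -> ln (a * b) = ln a + ln b.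
    by move=> ? ?; rewrite lnM ?posrE.
  by rewrite (lnM' _ _ K4 (mulr_gt0 xy0 z0)) (lnM' _ _ xy0 z0) (lnM' _ _ x0 y0).
by move=> ?; lra.
Qed.

(** The expansion rate depends only on the direction, so the cross difference
    [A v * n2 w - A w * n2 v] vanishes on parallel vectors and is divisible by [wedge v w]. The last
    factor is the sine of the angle: one-step growth is Lipschitz in the direction. *)
Lemma n2_step_ratio (f0 f1 E l K : R) v w : 0 <= K ->
  (forall v, n2 (step f0 f1 E l v) <= K * n2 v) ->
  (forall v, n2 v <= K * n2 (step f0 f1 E l v)) ->
  v != (0, 0) -> w != (0, 0) ->
  (ln (n2 (step f0 f1 E l v)) - ln (n2 v)) -
  (ln (n2 (step f0 f1 E l w)) - ln (n2 w)) <=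
    3 * K ^+ 2 * (`|wedge v w| / Num.sqrt (n2 v * n2 w)).
Proof.
move=> K0 hK hK' v0 w0.
set A := fun v => n2 (step f0 f1 E l v).
have nv : 0 < n2 v by rewrite n2_gt0.
have nw : 0 < n2 w by rewrite n2_gt0.
have Apos x : 0 < n2 x -> 0 < A x.
  move=> x0; rewrite lt_neqAle n2_ge0 andbT; apply/eqP => h.
  by have := hK' x; rewrite -/(A x) -h mulr0 leNgt x0.
have Av := Apos _ nv; have Aw := Apos _ nw.
set S := Num.sqrt _.
have S0 : 0 < S by rewrite sqrtr_gt0 mulr_gt0.
have S2 : S ^+ 2 = n2 v * n2 w by rewrite sqr_sqrtr// mulr_ge0 ?ltW.
pose q := dot (step f0 f1 E l e1) (step f0 f1 E l e2).
(* The cofactor of [wedge v w], written with the entries [A e1], [A e2] and [q] of the Gram matrix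
   of the step. *)
pose br := (A e1 - A e2) * (v.1 * w.2 + v.2 * w.1) +
  2 * q * (v.2 * w.2 - v.1 * w.1).
have id : A v * n2 w - A w * n2 v = wedge v w * br.
  by rewrite /br /q /A /n2 /dot /wedge /step /=; ring.
have Ke1 : A e1 <= K by apply: le_trans (hK _) _; rewrite /n2 /=; lra.
have Ke2 : A e2 <= K by apply: le_trans (hK _) _; rewrite /n2 /=; lra.
have A1 : 0 <= A e1 := n2_ge0 _; have A2 : 0 <= A e2 := n2_ge0 _.
have qK : `|q| <= K.
  rewrite -ler_sqr ?nnegrE// real_normK ?num_real//.
  apply: (@le_trans _ _ (A e1 * A e2)); first by rewrite lagrange lerDl sqr_ge0.
  by rewrite expr2 ler_pM.
have abS t : t ^+ 2 <= S ^+ 2 -> `|t| <= S.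
  by move=> h; rewrite -ler_sqr ?nnegrE ?(ltW S0)// real_normK ?num_real.
have brS : `|br| <= 3 * K * S.
  apply: le_trans (ler_normD _ _) _; rewrite !normrM.
  have h1 : `|v.1 * w.2 + v.2 * w.1| <= S.
    apply: abS; rewrite S2 /n2.
    by have := sqr_ge0 (v.1 * w.1 - v.2 * w.2); lra.
  have h2 : `|v.2 * w.2 - v.1 * w.1| <= S.
    apply: abS; rewrite S2 /n2.
    by have := sqr_ge0 (v.1 * w.2 + v.2 * w.1); lra.
  have h3 : `|A e1 - A e2| <= K by rewrite ler_norml; apply/andP; split; lra.
  have h4 : `|2 : R| = 2 by rewrite ger0_norm.
  rewrite h4.
  have : `|A e1 - A e2| * `|v.1 * w.2 + v.2 * w.1| <= K * S by exact: ler_pM.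
  have : `|q| * `|v.2 * w.2 - v.1 * w.1| <= K * S by exact: ler_pM.
  by move=> ? ?; lra.
have -> : (ln (A v) - ln (n2 v)) - (ln (A w) - ln (n2 w)) =
    ln (1 + wedge v w * br / (A w * n2 v)).
  have -> : 1 + wedge v w * br / (A w * n2 v) = A v * n2 w / (A w * n2 v).
    by rewrite -id; field; rewrite !gt_eqF.
  by rewrite ln_div ?posrE ?mulr_gt0// !lnM ?posrE//; lra.
apply: le_trans (le_ln1Dx _) _.
  rewrite (_ : _ / _ = A v * n2 w / (A w * n2 v) - 1); last first.
    by rewrite -id; field; rewrite !gt_eqF.
  by rewrite ltrBrDr addNr divr_gt0 ?mulr_gt0.
apply: le_trans (ler_norm _) _; rewrite !normrM normfV [`|A w * _|]gtr0_norm ?mulr_gt0//.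
rewrite ler_pdivrMr ?mulr_gt0//.
apply: (@le_trans _ _ (`|wedge v w| * (3 * K * S))); first by rewrite ler_wpM2l.
have := hK' w; rewrite -/(A w) => hw.
rewrite [leLHS](_ : _ = 3 * K * `|wedge v w| / S * S ^+ 2); last first.
  by field; rewrite gt_eqF.
rewrite S2 [leRHS](_ : _ = 3 * K * `|wedge v w| / S * (n2 v * (K * A w))); last first.
  by field; rewrite gt_eqF.
rewrite ler_wpM2l ?mulr_ge0 ?invr_ge0 ?(ltW S0)// ler_wpM2l// ltW//.
Qed.

(** A sine is at most 1, hence at most its power [2 * s]. The wedge inherited from the initial pair
    [v0], [w0] is at most the product of their lengths, and the arithmetic-geometric mean inequality
    separates the two vectors. *)
Lemma projective_dist_le (s : R) v w v0 w0 : 0 < s -> 2 * s <= 1 ->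
  v != (0, 0) -> w != (0, 0) -> v0 != (0, 0) -> w0 != (0, 0) ->
  wedge v w = wedge v0 w0 ->
  `|wedge v w| / Num.sqrt (n2 v * n2 w) <=
  (expR (2 * s * (ln (n2 v0) - ln (n2 v))) +
   expR (2 * s * (ln (n2 w0) - ln (n2 w)))) / 2.
Proof.
move=> s0 s1; rewrite -!n2_gt0 => vn wn v0n w0n vw.
have [w0'|wn0] := eqVneq (wedge v w) 0.
  by rewrite w0' normr0 mul0r divr_ge0 ?addr_ge0 ?expR_ge0.
have c0 : 0 < `|wedge v w| by rewrite normr_gt0.
have S0 : 0 < Num.sqrt (n2 v * n2 w) by rewrite sqrtr_gt0 mulr_gt0.
have lnsq (t : R) : 0 < t -> ln t = ln (t ^+ 2) / 2.
  by move=> t0; rewrite lnXn// mulr2n; lra.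
have lnS : ln (Num.sqrt (n2 v * n2 w)) = (ln (n2 v) + ln (n2 w)) / 2.
  by rewrite lnsq// sqr_sqrtr ?lnM ?posrE// mulr_ge0 ?ltW.
have lc t u : 0 < n2 t -> 0 < n2 u -> wedge v w = wedge t u ->
    ln `|wedge v w| <= (ln (n2 t) + ln (n2 u)) / 2.
  move=> t0 u0 e; rewrite lnsq// real_normK ?num_real//.
  rewrite ler_pM2r// -lnM ?posrE// ler_ln ?posrE ?exprn_even_gt0 ?mulr_gt0//.
  by rewrite e wedge_sqr_le.
have l1 := lc _ _ vn wn erefl; have l2 := lc _ _ v0n w0n vw.
rewrite -(@lnK _ (_ / Num.sqrt _)) ?posrE ?divr_gt0// ln_div ?posrE// lnS.
set a := s * (ln (n2 v0) - ln (n2 v)); set b := s * (ln (n2 w0) - ln (n2 w)).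
apply: (@le_trans _ _ (expR (a + b))).
  rewrite ler_expR /a /b.
  set d := ln `|_| - _.
  have d0 : d <= 0 by rewrite subr_le0.
  have h1 : 0 <= (1 - 2 * s) * (- d) by rewrite mulr_ge0 ?subr_ge0// oppr_ge0.
  have h2 : 0 <= s * ((ln (n2 v0) - ln (n2 v)) + (ln (n2 w0) - ln (n2 w)) - 2 * d).
    by rewrite mulr_ge0 ?(ltW s0)// /d; lra.
  by move: h1 h2 => ? ?; lra.
have ex2 (t : R) : expR (2 * s * t) = expR (s * t) ^+ 2.
  by rewrite -expRM_natl; congr expR; ring.
rewrite !ex2 -/a -/b expRD.
by have := sqr_ge0 (expR a - expR b); lra.
Qed.

End PlaneLog.

(** * Hyperbolic matrices *)

Section Hyperbolic.
Context {R : realType}.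
Implicit Types (v w x y z : R * R) (A B H : (R * R) * (R * R)).

(* A pair of vectors stands for the matrix with these columns, acting on
   vectors by [fun v => lin v A]; its determinant is [wedge A.1 A.2]. *)
Definition trace A : R := A.1.1 + A.2.2.
Definition comp A B := (lin B.1 A, lin B.2 A).
Definition adj A : (R * R) * (R * R) :=
  ((A.2.2, - A.1.2), (- A.2.1, A.1.1)).
Definition commutator A B := comp A (comp B (comp (adj A) (adj B))).

Lemma lin_comp v A B : lin v (comp A B) = lin (lin v B) A.
Proof. by rewrite /lin /comp /=; congr pair; ring. Qed.

Lemma det_comp A B :
  wedge (comp A B).1 (comp A B).2 = wedge A.1 A.2 * wedge B.1 B.2.
Proof. by rewrite /wedge /comp /lin /=; ring. Qed.

Lemma det_adj A : wedge (adj A).1 (adj A).2 = wedge A.1 A.2.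
Proof. by rewrite /wedge /adj /=; ring. Qed.

Lemma det_commutator A B : wedge A.1 A.2 = 1 -> wedge B.1 B.2 = 1 ->
  wedge (commutator A B).1 (commutator A B).2 = 1.
Proof. by move=> hA hB; rewrite /commutator !det_comp !det_adj hA hB !mulr1. Qed.

(* Fricke's identity *)
Lemma trace_commutator A B : wedge A.1 A.2 = 1 -> wedge B.1 B.2 = 1 ->
  trace (commutator A B) = trace A ^+ 2 + trace B ^+ 2 +
    trace (comp A B) ^+ 2 - trace A * trace B * trace (comp A B) - 2.
Proof.
move=> hA hB.
(* Inserting the determinants makes both sides homogeneous, so that the identity is purely
   polynomial. *)
transitivity (trace A ^+ 2 * wedge B.1 B.2 + trace B ^+ 2 * wedge A.1 A.2 +
    trace (comp A B) ^+ 2 - trace A * trace B * trace (comp A B)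
    - 2 * wedge A.1 A.2 * wedge B.1 B.2); last by rewrite hA hB; ring.
case: A B {hA hB} => [[a b] [c d]] [[a' b'] [c' d']].
by rewrite /trace /commutator /comp /adj /lin /wedge /=; ring.
Qed.

(** This quadratic form vanishes exactly on the eigenlines of [H]. For determinant 1,
    Cayley-Hamilton says that the traceless part [shifted] squares to [disc H]; by the parallelogram
    law [hden] is then, for [disc H > 0], [2 * disc H] times the sum of the squared lengths of the
    two eigencomponents. *)
Definition qform H v : R := wedge v (lin v H).
Definition shifted H v : R * R :=
  ((lin v H).1 - trace H / 2 * v.1, (lin v H).2 - trace H / 2 * v.2).
Definition disc H : R := (trace H / 2) ^+ 2 - 1.
Definition hden H v : R := disc H * n2 v + n2 (shifted H v).
(* The cosine of the angle between the two components of [v] along the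
   eigenlines, for the inner product that makes these orthogonal; a matrix
   [H] of trace > 2 increases it. *)
Definition tilt H v : R := dot v (shifted H v) / hden H v.

(** With [w = shifted H v], [s] half the trace and [D] the discriminant, [H] sends [v] to [s v + w]
    and [w] to [D v + s w]. The cross difference then becomes a sum of squares, one of which
    measures how far [v] is from the eigenlines. *)
Lemma tilt_diff H v : wedge H.1 H.2 = 1 -> 0 < disc H -> v != (0, 0) ->
  tilt H (lin v H) - tilt H v = trace H / 2 *
    ((disc H * n2 v - n2 (shifted H v)) ^+ 2 + 4 * disc H * qform H v ^+ 2) /
    (hden H (lin v H) * hden H v).
Proof.
move=> H1 D0 v0.
have den0 w : w != (0, 0) -> hden H w != 0.
  rewrite -n2_gt0 => w0; rewrite gt_eqF// ltr_wpDr ?n2_ge0//.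
  exact: mulr_gt0.
have l0 : lin v H != (0, 0) := lin_neq0 H1 v0.
set s := trace H / 2; set D := disc H; set w := shifted H v.
have hv : lin v H = (s * v.1 + w.1, s * v.2 + w.2).
  by rewrite /w /shifted -/s; case: (lin v H) => x y /=; congr pair; ring.
have hw : shifted H (lin v H) = (D * v.1 + s * w.1, D * v.2 + s * w.2).
  rewrite /D /disc -/s -[1 as X in _ - X]H1 /w /shifted /s /trace /lin /wedge /=.
  by congr pair; field.
rewrite /tilt -/w.
have e : dot (lin v H) (shifted H (lin v H)) * hden H v -
    dot v w * hden H (lin v H) =
    s * ((D * n2 v - n2 w) ^+ 2 + 4 * D * qform H v ^+ 2).
  rewrite /hden -/D -/w hw /qform hv /dot /n2 /wedge /= /D /disc -/s.
  by ring.
rewrite -e; field.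
by rewrite !den0.
Qed.

(** A form vanishing on two lines only cannot be small in three separated directions. Evaluating it
    at [W z = U x + V y] gives [id1], which bounds the polar term [m] by the three values; [id2] is
    the discriminant in the basis [x], [y], which would then be small as well. *)
Lemma qform_three_ge H (K eta N d : R) x y z : wedge H.1 H.2 = 1 ->
  0 < K -> 0 < eta -> 0 < N -> 0 <= d -> d <= disc H ->
  n2 x <= K * N -> n2 y <= K * N -> n2 z <= K * N ->
  eta * N <= `|wedge x y| -> eta * N <= `|wedge y z| -> eta * N <= `|wedge x z| ->
  4 * d * eta ^+ 6 * N ^+ 2 <=
  3 * (K ^+ 4 + eta ^+ 4) *
    (qform H x ^+ 2 + qform H y ^+ 2 + qform H z ^+ 2).
Proof.
move=> H1 K0 e0 N0 d0 dH xK yK zK xy yz xz.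
set a := qform H x; set b := qform H y; set c := qform H z.
set W := wedge x y; set U := wedge z y; set V := wedge x z.
set m := wedge x (lin y H) + wedge y (lin x H).
have id1 : U * V * m = W ^+ 2 * c - U ^+ 2 * a - V ^+ 2 * b.
  rewrite /U /V /W /m /a /b /c /qform /wedge /lin /=; ring.
have id2 : m ^+ 2 - 4 * a * b = 4 * disc H * W ^+ 2.
  rewrite /disc -[1 as X in _ - X]H1.
  by rewrite /m /a /b /W /qform /trace /wedge /lin /=; field.
have up t u : n2 t <= K * N -> n2 u <= K * N -> wedge t u ^+ 2 <= (K * N) ^+ 2.
  move=> h1 h2; apply: le_trans (wedge_sqr_le _ _) _.
  by rewrite expr2; apply: ler_pM; rewrite ?n2_ge0.
have lo (t : R) : eta * N <= `|t| -> (eta * N) ^+ 2 <= t ^+ 2.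
  move=> h; rewrite -[leRHS]real_normK ?num_real//.
  by rewrite ler_sqr ?nnegrE// mulr_ge0 ?ltW.
have W1 := up _ _ xK yK; have U1 := up _ _ zK yK; have V1 := up _ _ xK zK.
have W0 := lo _ xy; have V0 := lo _ xz.
have U0 : (eta * N) ^+ 2 <= U ^+ 2.
  by apply: lo; rewrite /U -normrN (_ : - _ = wedge y z)// /wedge; ring.
rewrite -/W -/U -/V in W1 U1 V1 W0 V0 U0.
set S := `|a| + `|b| + `|c|.
have S0 : 0 <= S by rewrite !addr_ge0.
have S3 : S ^+ 2 <= 3 * (a ^+ 2 + b ^+ 2 + c ^+ 2).
  have -> : a ^+ 2 + b ^+ 2 + c ^+ 2 = `|a| ^+ 2 + `|b| ^+ 2 + `|c| ^+ 2.
    by rewrite !real_normK ?num_real.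
  have := sqr_ge0 (`|a| - `|b|); have := sqr_ge0 (`|b| - `|c|).
  by have := sqr_ge0 (`|a| - `|c|); rewrite /S; lra.
have UVm : `|U * V * m| <= (K * N) ^+ 2 * S.
  rewrite id1; set k := (K * N) ^+ 2 in W1 U1 V1 *.
  have tri (p q r : R) : `|p - q - r| <= `|p| + `|q| + `|r|.
    by rewrite (le_trans (ler_normB _ _))// lerD2r ler_normB.
  have nsq (t u : R) : `|t ^+ 2 * u| = t ^+ 2 * `|u|.
    by rewrite normrM ger0_norm ?sqr_ge0.
  apply: le_trans (tri _ _ _) _; rewrite !nsq.
  have h1 : W ^+ 2 * `|c| <= k * `|c| by rewrite ler_wpM2r.
  have h2 : U ^+ 2 * `|a| <= k * `|a| by rewrite ler_wpM2r.
  have h3 : V ^+ 2 * `|b| <= k * `|b| by rewrite ler_wpM2r.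
  by rewrite /S; lra.
have N4 : 0 < N ^+ 4 by rewrite exprn_gt0.
have m2 : eta ^+ 4 * m ^+ 2 <= K ^+ 4 * S ^+ 2.
  rewrite -(ler_pM2l N4).
  apply: (@le_trans _ _ (U ^+ 2 * V ^+ 2 * m ^+ 2)).
    rewrite [leLHS](_ : _ = (eta * N) ^+ 2 * (eta * N) ^+ 2 * m ^+ 2); last by ring.
    by rewrite ler_wpM2r ?sqr_ge0// ler_pM ?sqr_ge0.
  rewrite [leLHS](_ : _ = (U * V * m) ^+ 2); last by ring.
  rewrite [leRHS](_ : _ = ((K * N) ^+ 2 * S) ^+ 2); last by ring.
  rewrite -[leLHS]real_normK ?num_real// ler_sqr ?nnegrE//.
  by rewrite mulr_ge0 ?sqr_ge0.
have ab : - (4 * a * b) <= S ^+ 2.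
  have h1 : - (a * b) <= `|a| * `|b| by rewrite -normrM -normrN ler_norm.
  have h2 : 0 <= `|c| * (2 * `|a| + 2 * `|b| + `|c|).
    by rewrite mulr_ge0// !addr_ge0// mulr_ge0.
  by have := sqr_ge0 (`|a| - `|b|); rewrite /S; lra.
have DW : 4 * d * (eta * N) ^+ 2 <= 4 * disc H * W ^+ 2.
  apply: ler_pM; rewrite ?sqr_ge0 ?mulr_ge0//.
  by rewrite ler_wpM2l.
have e4 : 0 <= eta ^+ 4 by rewrite exprn_ge0 ?ltW.
have K4 : 0 <= K ^+ 4 by rewrite exprn_ge0 ?ltW.
apply: (@le_trans _ _ ((K ^+ 4 + eta ^+ 4) * S ^+ 2)); last first.
  rewrite [leRHS](_ : _ = (K ^+ 4 + eta ^+ 4) * (3 * (a ^+ 2 + b ^+ 2 + c ^+ 2)));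
    last by ring.
  by rewrite ler_wpM2l ?addr_ge0.
have : eta ^+ 4 * (4 * d * (eta * N) ^+ 2) <= eta ^+ 4 * (m ^+ 2 + S ^+ 2).
  rewrite ler_wpM2l//; apply: le_trans DW _; rewrite -id2.
  by move: ab => ?; lra.
by move: m2 => ? ?; lra.
Qed.

End Hyperbolic.

Lemma measurable_fun_inv {d} {T : measurableType d} {R : realType} (f : T -> R) :
  measurable_fun setT f -> measurable_fun setT (fun x => (f x)^-1).
Proof.
move=> mf.
(* The power is taken of a nonnegative base. At zeros of [f] both sides are 0, the default
   inverse. *)
have -> : (fun x => (f x)^-1) = (fun x => f x * (f x ^+ 2) `^ (-1)).
  apply/funext => x; rewrite powR_inv1 ?sqr_ge0//.
  have [->|fx0] := eqVneq (f x) 0; first by rewrite invr0 mul0r.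
  by field.
apply: measurable_funM => //.
apply: (measurableT_comp (measurable_powR _)).
exact: measurable_funX.
Qed.

(** * Bounded observables of a hyperbolic matrix, and increments *)

Section AlmostInvariance.
Context {R : realType}.
Implicit Types (v w x y z : R * R) (A B H : (R * R) * (R * R)).

Lemma measurable_lin A : measurable_fun setT (fun v => lin v A).
Proof.
apply: measurable_fun_pair => /=; apply: measurable_funD;
  by apply: measurable_funM => //; exact: measurable_cst.
Qed.

Lemma measurable_n2 : measurable_fun setT (@n2 R).
Proof.
by apply: measurable_funD; apply: measurable_funX.
Qed.

(** Homogeneous of degree 0, hence bounded, and small only near the eigenlines: a test function for
    the mass away from them. *)
Definition qratio H v : R := qform H v ^+ 2 / n2 v ^+ 2.

Lemma measurable_qratio H : measurable_fun setT (qratio H).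
Proof.
have mfst := measurableT_comp measurable_fst (measurable_lin H).
have msnd := measurableT_comp measurable_snd (measurable_lin H).
apply: measurable_funM.
  apply: measurable_funX; apply: measurable_funB;
    by apply: measurable_funM.
apply: measurable_fun_inv; apply: measurable_funX; exact: measurable_n2.
Qed.

Lemma measurable_tilt H : measurable_fun setT (tilt H).
Proof.
have mfst := measurableT_comp measurable_fst (measurable_lin H).
have msnd := measurableT_comp measurable_snd (measurable_lin H).
have m1 : measurable_fun setT (fun v => (shifted H v).1).
  by apply: measurable_funB => //; apply: measurable_funM => //; exact: measurable_cst.
have m2 : measurable_fun setT (fun v => (shifted H v).2).
  by apply: measurable_funB => //; apply: measurable_funM => //; exact: measurable_cst.
apply: measurable_funM.
  by apply: measurable_funD; apply: measurable_funM.
apply: measurable_fun_inv; apply: measurable_funD.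
  by apply: measurable_funM; [exact: measurable_cst|exact: measurable_n2].
by apply: measurable_funD; apply: measurable_funX.
Qed.

Lemma qratio_ge0 H v : 0 <= qratio H v.
Proof. by rewrite divr_ge0 ?sqr_ge0. Qed.

Lemma qratio_le H K v : 0 <= K -> (forall v, n2 (lin v H) <= K * n2 v) -> qratio H v <= K.
Proof.
move=> K0 hK; rewrite /qratio.
have [v0|v0] := eqVneq v (0, 0).
  by rewrite v0 /n2 /= !expr0n /= addr0 expr0n /= invr0 mulr0.
have nv : 0 < n2 v by rewrite n2_gt0.
rewrite ler_pdivrMr ?exprn_gt0//; apply: le_trans (wedge_sqr_le _ _) _.
by rewrite expr2 mulrA [K * _]mulrC -mulrA ler_wpM2l// n2_ge0.
Qed.

Lemma tilt_le H (d : R) v : 0 < d -> d <= disc H -> `|tilt H v| <= 1 + d^-1.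
Proof.
move=> d0 dH; rewrite /tilt; set w := shifted H v.
have c0 : 0 <= 1 + d^-1 by rewrite addr_ge0 ?invr_ge0 ?ltW.
have nv := n2_ge0 v; have nw := n2_ge0 w.
have den : d * n2 v + n2 w <= hden H v by rewrite lerD2r ler_wpM2r.
have den0 : 0 <= hden H v.
  by apply: le_trans den; rewrite addr_ge0// mulr_ge0// ltW.
have [->|dn] := eqVneq (hden H v) 0; first by rewrite invr0 mulr0 normr0.
have {}den0 : 0 < hden H v by rewrite lt_neqAle eq_sym dn.
rewrite normrM normfV (gtr0_norm den0) ler_pdivrMr//.
apply: (@le_trans _ _ (n2 v + n2 w)).
  rewrite ler_norml /n2 /dot; apply/andP; split.
    have := sqr_ge0 (v.1 + w.1); have := sqr_ge0 (v.2 + w.2).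
    by have := n2_ge0 v; have := n2_ge0 w; rewrite /n2; lra.
  have := sqr_ge0 (v.1 - w.1); have := sqr_ge0 (v.2 - w.2).
  by have := n2_ge0 v; have := n2_ge0 w; rewrite /n2; lra.
apply: (@le_trans _ _ ((1 + d^-1) * (d * n2 v + n2 w))); last by rewrite ler_wpM2l.
rewrite [leRHS](_ : _ = d * n2 v + n2 w + (n2 v + d^-1 * n2 w)); last first.
  by field; rewrite gt_eqF.
have : 0 <= d * n2 v by rewrite mulr_ge0// ltW.
have : 0 <= d^-1 * n2 w by rewrite mulr_ge0// invr_ge0 ltW.
by move=> ? ?; lra.
Qed.

(** In [tilt_diff] only the square of [qform] is kept and half the trace is at least 1. Since
    [hden H w <= 5 * K * n2 w], and [H] itself costs one more [K], the denominator is at most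
    [25 * K ^+ 3 * n2 v ^+ 2]. *)
Lemma tilt_diff_ge H (K d : R) v : wedge H.1 H.2 = 1 -> 0 < d -> d <= disc H ->
  2 <= trace H -> 1 <= K -> (forall v, n2 (lin v H) <= K * n2 v) ->
  v != (0, 0) ->
  4 * d / (25 * K ^+ 3) * qratio H v <= tilt H (lin v H) - tilt H v.
Proof.
move=> H1 d0 dH tr2 K1 hK v0.
have D0 : 0 < disc H by exact: lt_le_trans dH.
have K0 : 0 < K by exact: lt_le_trans K1.
rewrite tilt_diff//; set s := trace H / 2.
have s1 : 1 <= s by rewrite /s; lra.
have sK : s ^+ 2 <= K.
  have h1 : H.1.1 ^+ 2 <= K.
    apply: le_trans (_ : n2 (lin e1 H) <= _).
      by rewrite /n2 /lin /e1 /= !mul1r !mul0r !addr0 lerDl sqr_ge0.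
    by apply: le_trans (hK _) _; rewrite /n2 /e1 /=; lra.
  have h2 : H.2.2 ^+ 2 <= K.
    apply: le_trans (_ : n2 (lin e2 H) <= _).
      by rewrite /n2 /lin /e2 /= !mul1r !mul0r !add0r lerDr sqr_ge0.
    by apply: le_trans (hK _) _; rewrite /n2 /e2 /=; lra.
  have := sqr_ge0 (H.1.1 - H.2.2); rewrite /s /trace; lra.
have DK : disc H <= K by rewrite /disc -/s; lra.
have shK w : n2 (shifted H w) <= 4 * K * n2 w.
  apply: (@le_trans _ _ (2 * n2 (lin w H) + 2 * (s ^+ 2 * n2 w))).
    rewrite /shifted -/s; case: (lin w H) => p q; rewrite /n2 /=.
    have := sqr_ge0 (p + s * w.1); have := sqr_ge0 (q + s * w.2); lra.
  have := hK w; have : s ^+ 2 * n2 w <= K * n2 w by rewrite ler_wpM2r ?n2_ge0.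
  by move=> ? ?; lra.
have denK w : hden H w <= 5 * K * n2 w.
  rewrite /hden; have := shK w.
  have : disc H * n2 w <= K * n2 w by rewrite ler_wpM2r ?n2_ge0.
  by move=> ? ?; lra.
have nv : 0 < n2 v by rewrite n2_gt0.
have dpos w : 0 < n2 w -> 0 < hden H w.
  by move=> w0; rewrite ltr_wpDr ?n2_ge0// mulr_gt0.
have lpos : 0 < n2 (lin v H) by rewrite n2_gt0; exact: lin_neq0.
have dd : hden H (lin v H) * hden H v <= 25 * K ^+ 3 * n2 v ^+ 2.
  apply: (@le_trans _ _ ((5 * K * (K * n2 v)) * (5 * K * n2 v))); last first.
    by rewrite le_eqVlt; apply/orP; left; apply/eqP; ring.
  apply: ler_pM => //; [exact/ltW/dpos|exact/ltW/dpos|].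
  by apply: le_trans (denK _) _; rewrite ler_wpM2l// mulr_ge0// ltW.
have K3 : 0 < 25 * K ^+ 3 * n2 v ^+ 2 by rewrite !mulr_gt0// exprn_gt0.
have q0 := sqr_ge0 (qform H v).
apply: (@le_trans _ _ (4 * d * qform H v ^+ 2 / (hden H (lin v H) * hden H v))).
  rewrite /qratio [leLHS](_ : _ = 4 * d * qform H v ^+ 2 / (25 * K ^+ 3 * n2 v ^+ 2));
    last by field; rewrite !gt_eqF.
  apply: ler_wpM2l; first by rewrite mulr_ge0// mulr_ge0// ltW.
  by rewrite lef_pV2 ?posrE// mulr_gt0 ?dpos.
apply: ler_wpM2r; first by rewrite invr_ge0 mulr_ge0 ?ltW ?dpos.
apply: (@le_trans _ _ (1 * (4 * disc H * qform H v ^+ 2))).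
  rewrite mul1r; apply: ler_wpM2r => //; lra.
apply: ler_pM => //; first by apply: mulr_ge0 => //; apply: mulr_ge0 => //; exact: ltW.
by rewrite lerDr sqr_ge0.
Qed.

Section Increments.
Context (f0 f1 E : R).

Definition increment (l m : R) : (R * R) * (R * R) :=
  (stepV f0 f1 E l (step f0 f1 E m e1), stepV f0 f1 E l (step f0 f1 E m e2)).

Lemma lin_increment l m v :
  lin v (increment l m) = stepV f0 f1 E l (step f0 f1 E m v).
Proof. by rewrite /lin /increment /stepV /step /=; congr pair; ring. Qed.

Lemma det_increment l m : wedge (increment l m).1 (increment l m).2 = 1.
Proof. by rewrite /increment /= wedge_stepV wedge_step /wedge /=; ring. Qed.

Lemma adj_increment l m : adj (increment l m) = increment m l.
Proof.
rewrite /adj /increment /stepV /step /=.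
by congr (pair (pair _ _) (pair _ _)); ring.
Qed.

Lemma trace_increment l m : trace (increment l m) = 2 - f0 * f1 * (l - m) ^+ 2.
Proof. by rewrite /trace /increment /stepV /step /=; ring. Qed.

Lemma trace_comp_increment l l' m :
  trace (comp (increment l m) (increment l' m)) =
  2 - f0 * f1 * ((l - m) + (l' - m)) ^+ 2
    + (f0 * f1) ^+ 2 * (l - m) ^+ 2 * (l' - m) ^+ 2.
Proof. by rewrite /trace /comp /lin /increment /stepV /step /=; ring. Qed.

(** The energy has cancelled: three distinct parameters give a hyperbolic commutator at every [E],
    with a bound depending only on their distances. *)
Lemma trace_commutator_increment l l' m :
  trace (commutator (increment l m) (increment l' m)) =
  2 + (f0 * f1) ^+ 3 * ((l - m) * (l' - m) * (l - l')) ^+ 2.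
Proof.
rewrite trace_commutator ?det_increment// !trace_increment trace_comp_increment.
by ring.
Qed.

End Increments.

End AlmostInvariance.

(** * Almost invariant functionals *)

Ltac pos :=
  repeat first
    [ done | apply: exprn_gt0 | apply: addr_gt0 | rewrite invr_gt0
    | apply: mulr_gt0 ].

Lemma sum3_le {R : numDomainType} n (F : 'I_n -> R) (i j k : 'I_n) :
  (forall a, 0 <= F a) -> i != j -> j != k -> i != k ->
  F i + F j + F k <= \sum_a F a.
Proof.
move=> F0 ij jk ik.
have ji : j != i by rewrite eq_sym.
have kij : (k != i) && (k != j) by rewrite ![k == _]eq_sym ik jk.
rewrite (bigD1 i)//= (bigD1 j ji)/= (bigD1 k kij)/= !addrA.
by rewrite lerDl sumr_ge0.
Qed.

Section NoInvariantFunctional.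
Context {R : realType}.
Implicit Types (v w x y z : R * R) (g h : R * R -> R).

Lemma measurable_step (f0 f1 E l : R) : measurable_fun setT (step f0 f1 E l).
Proof.
have -> : step f0 f1 E l = (fun v => lin v (step f0 f1 E l e1, step f0 f1 E l e2)).
  by apply/funext => v; rewrite /lin /step /=; congr pair; ring.
exact: measurable_lin.
Qed.

Lemma measurable_stepV (f0 f1 E l : R) : measurable_fun setT (stepV f0 f1 E l).
Proof.
have -> : stepV f0 f1 E l = (fun v => lin v (stepV f0 f1 E l e1, stepV f0 f1 E l e2)).
  by apply/funext => v; rewrite /lin /stepV /=; congr pair; ring.
exact: measurable_lin.
Qed.

Lemma step_eq0 (f0 f1 E l : R) v : (step f0 f1 E l v == (0, 0)) = (v == (0, 0)).
Proof.
rewrite -(inj_eq (can_inj (stepK f0 f1 E l)) v).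
by congr (_ == _); rewrite /step /= !mulr0 !subr0 mulr0.
Qed.

Lemma stepV_eq0 (f0 f1 E l : R) v : (stepV f0 f1 E l v == (0, 0)) = (v == (0, 0)).
Proof. by rewrite -(step_eq0 f0 f1 E l) stepVK. Qed.

(* A functional that is almost invariant under the increments is almost
   invariant under their commutator, which is hyperbolic; by [tilt_diff_ge] its
   mass lies near the two eigenlines. Transported by the five increments this
   contradicts [three_directionsV] and [qform_three_ge]. *)
Lemma almost_invariant_functional_le0 (f0 f1 E b delta : R) :
  0 < f0 -> 0 < f1 -> 0 <= b -> 0 < delta ->
  exists2 om : R, 0 < om & forall (l : 'I_5 -> R) (Th : (R * R -> R) -> R) (J : R),
    (forall i, `|E - f0 * l i| <= b) -> (forall i, `|E - f1 * l i| <= b) ->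
    (forall i j, i != j -> delta <= `|l i - l j|) ->
    (forall g h (C : R), measurable_fun setT g -> measurable_fun setT h ->
      (forall v, `|g v| <= C) -> (forall v, `|h v| <= C) ->
      Th (fun v => g v + h v) = Th g + Th h) ->
    (forall c g (C : R), measurable_fun setT g -> (forall v, `|g v| <= C) ->
      Th (fun v => c * g v) = c * Th g) ->
    (forall g h (C : R), measurable_fun setT g -> measurable_fun setT h ->
      (forall v, `|g v| <= C) -> (forall v, `|h v| <= C) ->
      (forall v, v != (0, 0) -> g v <= h v) -> Th g <= Th h) ->
    Th (fun=> 1) = J -> 0 <= J ->
    (forall i g (C : R), measurable_fun setT g -> (forall v, `|g v| <= C) ->
      `|Th (fun v => g (stepV f0 f1 E (l i) (step f0 f1 E (l ord0) v))) - Th g|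
        <= om * J * C) ->
    J <= 0.
Proof.
move=> f00 f10 b0 d0.
have [eta eta0 heta] := three_directionsV E f00 f10 b0 d0.
pose K := (2 * b ^+ 2 + 2) ^+ 2.
have K1 : 1 <= K.
  by rewrite /K exprn_ege1//; have := sqr_ge0 b; lra.
have K0 : 0 < K by exact: lt_le_trans K1.
(* The commutator is a word of eight steps and inverse steps. *)
pose KH := K ^+ 8.
have KH1 : 1 <= KH by rewrite exprn_ege1.
have KH0 : 0 < KH by exact: lt_le_trans KH1.
pose d := (f0 * f1) ^+ 3 * delta ^+ 6.
have d_gt0 : 0 < d by rewrite mulr_gt0 ?exprn_gt0 ?mulr_gt0.
pose c1 := 4 * d * eta ^+ 6 / (3 * (K ^+ 4 + eta ^+ 4)) / K ^+ 2.
have c1_gt0 : 0 < c1.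
  by rewrite /c1; pos.
pose c' := 4 * d / (25 * KH ^+ 3).
have c'_gt0 : 0 < c' by rewrite /c'; pos.
pose c2 := 1 + d^-1.
have c2_gt0 : 0 < c2 by rewrite /c2; pos.
pose c3 := 5 * (4 * c2 / c' + KH).
have c3_gt0 : 0 < c3 by rewrite /c3; pos.
(* Each almost invariance costs [om * J] times a sup norm. Bounding five transported copies of
   [qratio H] costs [c3 * om * J] in all, against the lower bound [c1 * J]; this choice makes the
   cost [c1 * J / 2]. *)
exists (c1 / (2 * c3)); first by pos.
set om := c1 / _.
move=> l Th J lb0 lb1 lsep ThD ThZ Thle Th1 J0 inv.
pose A := increment f0 f1 E (l 1) (l ord0).
pose B := increment f0 f1 E (l 2) (l ord0).
pose H := commutator A B.
have detH : wedge H.1 H.2 = 1 by rewrite det_commutator ?det_increment.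
have sK i v : n2 (step f0 f1 E (l i) v) <= K * n2 v by exact: n2_step_le.
have sVK i v : n2 (stepV f0 f1 E (l i) v) <= K * n2 v by exact: n2_stepV_le.
have linH v : lin v H = stepV f0 f1 E (l 1) (step f0 f1 E (l ord0)
    (stepV f0 f1 E (l 2) (step f0 f1 E (l ord0)
    (stepV f0 f1 E (l ord0) (step f0 f1 E (l 1)
    (stepV f0 f1 E (l ord0) (step f0 f1 E (l 2) v))))))).
  by rewrite /H /commutator !lin_comp !adj_increment !lin_increment.
have HK v : n2 (lin v H) <= KH * n2 v.
  have st i w t k : n2 w <= K ^+ k * t -> n2 (step f0 f1 E (l i) w) <= K ^+ k.+1 * t.
    by move=> h; rewrite exprS -mulrA (le_trans (sK _ _))// ler_wpM2l// ltW.
  have sv i w t k : n2 w <= K ^+ k * t -> n2 (stepV f0 f1 E (l i) w) <= K ^+ k.+1 * t.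
    by move=> h; rewrite exprS -mulrA (le_trans (sVK _ _))// ler_wpM2l// ltW.
  rewrite linH /KH; apply: (sv _ _ _ 7%N); apply: (st _ _ _ 6%N).
  apply: (sv _ _ _ 5%N); apply: (st _ _ _ 4%N); apply: (sv _ _ _ 3%N).
  apply: (st _ _ _ 2%N); apply: (sv _ _ _ 1%N); apply: (st _ _ _ 0%N).
  by rewrite expr0 mul1r.
have trH : trace H = 2 + (f0 * f1) ^+ 3 *
    ((l 1 - l ord0) * (l 2 - l ord0) * (l 1 - l 2)) ^+ 2.
  exact: trace_commutator_increment.
have dtr : d <= trace H - 2.
  rewrite trH addrAC subrr add0r /d.
  apply: ler_wpM2l; first by rewrite exprn_ge0// mulr_ge0// ltW.
  have d30 : 0 <= delta ^+ 3 by rewrite exprn_ge0// ltW.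
  rewrite (_ : delta ^+ 6 = (delta ^+ 3) ^+ 2); last by ring.
  rewrite -[leRHS]real_normK ?num_real// ler_sqr ?nnegrE//.
  have s1 := lsep 1 ord0 isT; have s2 := lsep 2 ord0 isT; have s3 := lsep 1 2 isT.
  rewrite !normrM exprS expr2 mulrA; have d1 := ltW d0.
  by apply: ler_pM; rewrite ?mulr_ge0//; apply: ler_pM.
have ddisc : d <= disc H.
  have := sqr_ge0 (trace H - 2); rewrite /disc => ?; lra.
have tr2 : 2 <= trace H by lra.
have mt := measurable_tilt H.
have bt v : `|tilt H v| <= c2 by exact: tilt_le.
have mq := measurable_qratio H.
have bq v : `|qratio H v| <= KH by rewrite ger0_norm ?qratio_ge0// qratio_le// ltW.
(* The commutator also contains inverse increments; substituting the transported function into [inv]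
   handles them. *)
have invm i g C : measurable_fun setT g -> (forall v, `|g v| <= C) ->
  `|Th (fun v => g (stepV f0 f1 E (l ord0) (step f0 f1 E (l i) v))) - Th g|
        <= om * J * C.
  move=> mg bg.
  pose g' v := g (stepV f0 f1 E (l ord0) (step f0 f1 E (l i) v)).
  have mg' : measurable_fun setT g'.
    apply: (measurableT_comp mg).
    exact: (measurableT_comp (measurable_stepV _ _ _ _) (measurable_step _ _ _ _)).
  have := inv i g' C mg' (fun v => bg _).
  have -> : (fun v => g' (stepV f0 f1 E (l i) (step f0 f1 E (l ord0) v))) = g.
    by apply/funext => v; rewrite /g' stepVK stepK.
  by rewrite distrC.
have mcomp i j g : measurable_fun setT g ->
    measurable_fun setT (fun v => g (stepV f0 f1 E (l i) (step f0 f1 E (l j) v))).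
  move=> mg; apply: (measurableT_comp mg).
  exact: (measurableT_comp (measurable_stepV _ _ _ _) (measurable_step _ _ _ _)).
have Thtilt : Th (fun v => tilt H (lin v H)) - Th (tilt H) <= 4 * (om * J * c2).
  pose g1 v := tilt H (stepV f0 f1 E (l 1) (step f0 f1 E (l ord0) v)).
  pose g2 v := g1 (stepV f0 f1 E (l 2) (step f0 f1 E (l ord0) v)).
  pose g3 v := g2 (stepV f0 f1 E (l ord0) (step f0 f1 E (l 1) v)).
  have m1 : measurable_fun setT g1 by exact: mcomp.
  have m2 : measurable_fun setT g2 by exact: mcomp.
  have m3 : measurable_fun setT g3 by exact: mcomp.
  have h1 := inv 1 _ c2 mt bt.
  have h2 := inv 2 g1 c2 m1 (fun v => bt _).
  have h3 := invm 1 g2 c2 m2 (fun v => bt _).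
  have h4 := invm 2 g3 c2 m3 (fun v => bt _).
  have -> : (fun v => tilt H (lin v H)) =
      (fun v => g3 (stepV f0 f1 E (l ord0) (step f0 f1 E (l 2) v))).
    by apply/funext => v; rewrite linH.
  move: h1 h2 h3 h4; rewrite -/g1 -/g2 -/g3 !ler_norml.
  by move=> /andP[_ ?] /andP[_ ?] /andP[_ ?] /andP[_ ?]; lra.
have mtH : measurable_fun setT (fun v => tilt H (lin v H)).
  exact: (measurableT_comp mt (measurable_lin H)).
(* [tilt] increases along [H] while [Th] hardly sees the change, so [Th] gives little mass to
   vectors away from the eigenlines. *)
have Thq : c' * Th (qratio H) <= 4 * (om * J * c2).
  apply: le_trans Thtilt.
  rewrite -(ThZ c' _ KH)// -[X in _ - X]mul1r -mulNr -(ThZ (-1) _ c2)//.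
  rewrite -(ThD _ _ c2)//; last 2 first.
  - by apply: measurable_funM => //; exact: measurable_cst.
  - by move=> v; rewrite mulN1r normrN.
  apply: (Thle _ _ (c' * KH + (c2 + c2))).
  - by apply: measurable_funM => //; exact: measurable_cst.
  - apply: measurable_funD => //.
    by apply: measurable_funM => //; exact: measurable_cst.
  - move=> v; rewrite normrM gtr0_norm//.
    have : c' * `|qratio H v| <= c' * KH by rewrite ler_wpM2l// ltW.
    by have := c2_gt0; lra.
  - move=> v; have h : 0 <= c' * KH by rewrite mulr_ge0// ltW.
    apply: le_trans (ler_normD _ _) _; rewrite mulN1r normrN.
    by have := bt v; have := bt (lin v H); lra.
  by move=> v v0; rewrite mulN1r; exact: tilt_diff_ge.
have Thqi i : Th (fun v => qratio H (stepV f0 f1 E (l i) (step f0 f1 E (l ord0) v)))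
    <= Th (qratio H) + om * J * KH.
  by have := inv i _ KH mq bq; rewrite ler_norml => /andP[_ ?]; lra.
pose Q i v := qratio H (stepV f0 f1 E (l i) (step f0 f1 E (l ord0) v)).
have mQ i : measurable_fun setT (Q i) by exact: mcomp.
have bQ i v : `|Q i v| <= KH by exact: bq.
(* Three of the five transported vectors are well separated, so they are not all near the two
   eigenlines. *)
have lower v : v != (0, 0) -> c1 <= \sum_i Q i v.
  move=> v0; set x := step f0 f1 E (l ord0) v.
  have x0 : 0 < n2 x.
    by rewrite n2_gt0 /x step_eq0.
  have [i [j [k [[ij jk ik] hij hjk hik]]]] := heta l lb1 lsep x.
  have three : \sum_i Q i v >= Q i v + Q j v + Q k v.
    by apply: sum3_le => // a; exact: qratio_ge0.
  apply: le_trans three.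
  have den0 : 0 < K ^+ 4 + eta ^+ 4 by pos.
  have den1 : 0 < 3 * (K ^+ 4 + eta ^+ 4) by rewrite mulr_gt0.
  set yi := stepV f0 f1 E (l i) x; set yj := stepV f0 f1 E (l j) x.
  set yk := stepV f0 f1 E (l k) x.
  have qK a : n2 (stepV f0 f1 E (l a) x) != 0 ->
    qform H (stepV f0 f1 E (l a) x) ^+ 2 / (K * n2 x) ^+ 2 <= Q a v.
    move=> a0; rewrite /Q /qratio -/x ler_wpM2l ?sqr_ge0// lef_pV2 ?posrE; last 2 first.
    - by rewrite exprn_gt0// mulr_gt0.
    - by rewrite exprn_gt0// lt_neqAle eq_sym a0 n2_ge0.
    have Kx : 0 <= K * n2 x by rewrite mulr_ge0// ltW.
    by rewrite ler_sqr ?nnegrE//; exact: n2_ge0.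
  have ya a : n2 (stepV f0 f1 E (l a) x) != 0.
    by rewrite n2_eq0 stepV_eq0 -n2_gt0.
  have key := qform_three_ge detH K0 eta0 x0 (ltW d_gt0) ddisc (sVK i x) (sVK j x)
    (sVK k x) hij hjk hik.
  apply: le_trans (lerD (lerD (qK i (ya i)) (qK j (ya j))) (qK k (ya k))).
  rewrite -!mulrDl ler_pdivlMr; last by pos.
  rewrite [leLHS](_ : _ = 4 * d * eta ^+ 6 * n2 x ^+ 2 / (3 * (K ^+ 4 + eta ^+ 4))).
    rewrite ler_pdivrMr//; apply: (le_trans key).
    by rewrite le_eqVlt; apply/orP; left; apply/eqP; ring.
  by rewrite /c1; field; rewrite (gt_eqF den0) (gt_eqF K0).
(* Additivity of [Th] concerns two bounded functions at a time, hence the partial sums with their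
   own bounds. *)
pose s01 v := Q ord0 v + Q 1 v; pose s012 v := s01 v + Q 2 v.
pose s0123 v := s012 v + Q 3 v; pose s01234 v := s0123 v + Q 4 v.
have KH2 : forall k : nat, 0 <= KH *+ k by move=> k; rewrite mulrn_wge0// ltW.
have Thsum : Th s01234 = Th (Q ord0) + Th (Q 1) + Th (Q 2) + Th (Q 3) + Th (Q 4).
  have m01 : measurable_fun setT s01 by exact: measurable_funD.
  have m012 : measurable_fun setT s012 by exact: measurable_funD.
  have m0123 : measurable_fun setT s0123 by exact: measurable_funD.
  have b01 v : `|s01 v| <= 2 * KH.
    by apply: le_trans (ler_normD _ _) _; have := bQ ord0 v; have := bQ 1 v; lra.
  have b012 v : `|s012 v| <= 3 * KH.
    by apply: le_trans (ler_normD _ _) _; have := b01 v; have := bQ 2 v; lra.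
  have b0123 v : `|s0123 v| <= 4 * KH.
    by apply: le_trans (ler_normD _ _) _; have := b012 v; have := bQ 3 v; lra.
  have bQ' (c : R) i v : 1 <= c -> `|Q i v| <= c * KH.
    by move=> c1'; apply: le_trans (bQ i v) _; rewrite ler_peMl// ltW.
  rewrite /s01234 (ThD _ _ (4 * KH))//; last by move=> v; apply: bQ'; lra.
  rewrite /s0123 (ThD _ _ (3 * KH))//; last by move=> v; apply: bQ'; lra.
  rewrite /s012 (ThD _ _ (2 * KH))//; last by move=> v; apply: bQ'; lra.
  by rewrite /s01 (ThD _ _ KH).
have JQ : c1 * J <= Th s01234.
  rewrite -Th1 -(ThZ c1 _ 1)//; last by move=> v; rewrite normr1.
  apply: (Thle _ _ (c1 + 5 * KH)).
  - exact: measurable_cst.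
  - by do !apply: measurable_funD.
  - by move=> v; rewrite mulr1 gtr0_norm// lerDl mulr_ge0// ltW.
  - move=> v; rewrite ger0_norm ?addr_ge0 ?qratio_ge0//.
    have := c1_gt0.
    have := bQ ord0 v; have := bQ 1 v; have := bQ 2 v; have := bQ 3 v.
    have := bQ 4 v; rewrite !ger0_norm ?qratio_ge0// /s01234 /s0123 /s012 /s01.
    by move=> *; lra.
  move=> v v0; rewrite mulr1; apply: le_trans (lower v v0) _.
  rewrite !big_ord_recl big_ord0 addr0 /s01234 /s0123 /s012 /s01 -!addrA.
  by rewrite le_eqVlt; apply/orP; left; apply/eqP; do !congr (_ + _);
    congr (Q _ v); apply: val_inj.
have qi := (Thqi ord0, Thqi 1, Thqi 2, Thqi 3, Thqi 4).
have Thq' : Th (qratio H) <= 4 * (om * J * c2) / c'.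
  by rewrite ler_pdivlMr// mulrC.
have up : c1 * J <= c3 * om * J.
  apply: le_trans JQ _; rewrite Thsum.
  have := qi.1.1.1.1; have := qi.1.1.1.2; have := qi.1.1.2; have := qi.1.2.
  have := qi.2; rewrite -/(Q _) => h4 h3 h2 h1 h0.
  rewrite [leRHS](_ : _ = 5 * (4 * (om * J * c2) / c' + om * J * KH)); last first.
    by rewrite /c3; field; rewrite gt_eqF.
  by lra.
move: up; rewrite (_ : c3 * om = c1 / 2); last first.
  by rewrite /om; field; rewrite gt_eqF.
move=> up; have : c1 * J <= 0 by lra.
by rewrite pmulr_rle0.
Qed.

End NoInvariantFunctional.

(** * Lebesgue measure on the plane *)

(* Lebesgue measure on the type [R] with its default measurable structure,
   whose display differs from the one of [measurableTypeR R]. *)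
Definition leb1 {R : realType} : set R -> \bar R := @lebesgue_measure R.

Section Leb1.
Context {R : realType}.

Let leb10 : @leb1 R set0 = 0%E. Proof. exact: measure0. Qed.
Let leb1_ge0 A : (0 <= @leb1 R A)%E. Proof. exact: measure_ge0. Qed.
Let leb1_sigma_additive : semi_sigma_additive (@leb1 R).
Proof. exact: (@measure_semi_sigma_additive _ _ _ (@lebesgue_measure R)). Qed.

HB.instance Definition _ := isMeasure.Build _ R R (@leb1 R)
  leb10 leb1_ge0 leb1_sigma_additive.

Let leb1_sigma_finite : sigma_finite setT (@leb1 R).
Proof. exact: (@sigma_finiteT _ _ _ (@lebesgue_measure R)). Qed.

HB.instance Definition _ := @Measure_isSigmaFinite.Build _ R R (@leb1 R) leb1_sigma_finite.

End Leb1.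

Definition leb2 {R : realType} : set (R * R)%type -> \bar R := (leb1 \x leb1)%E.
HB.instance Definition _ (R : realType) := Measure.on (@leb2 R).

Section Leb2.
Context {R : realType}.

Let leb2_sigma_finite : sigma_finite setT (@leb2 R).
Proof.
have /sigma_finiteP[F [TF ndF Foo]] := sigma_finiteT (@leb1 R).
exists (fun n => F n `*` F n).
  rewrite -setXTT TF predeqE => -[x y]; split.
    move=> [/= [n _ Fnx] [k _ Fky]]; exists (maxn n k) => //; split.
    - by move: x Fnx; exact/subsetPset/ndF/leq_maxl.
    - by move: y Fky; exact/subsetPset/ndF/leq_maxr.
  by move=> [n _ []/= ? ?]; split; exists n.
move=> k; have [mk fk] := Foo k; split; first exact: measurableX.
rewrite /leb2 product_measure1E// lte_mul_pinfty//.
by rewrite ge0_fin_numE.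
Qed.

HB.instance Definition _ := @Measure_isSigmaFinite.Build _ _ R (@leb2 R) leb2_sigma_finite.

End Leb2.

Section PlaneLebesgue.
Context {R : realType}.
Local Open Scope ereal_scope.

Notation leb := (@leb1 R).
Notation image_measure :=
  measure_function_pushforward__canonical__measure_function_Measure.

Lemma leb1_reflect (a : R) (A : set R) : measurable A ->
  leb ((fun y => (a - y)%R) @^-1` A) = leb A.
Proof.
have mr : measurable_fun [set: measurableTypeR R]
  (fun y : measurableTypeR R => (a - y)%R : measurableTypeR R).
  by apply: measurable_funB; [exact: measurable_cst|exact: measurable_id].
move=> mA; rewrite /leb1.
symmetry; apply: (@lebesgue_measure_unique R (image_measure lebesgue_measure mr) _ A mA).
move=> X [[p q] _ <-]/=.
rewrite /pushforward.
have -> : (fun y : R => (a - y)%R) @^-1` [set` `]p, q]] = [set` `[a - q, a - p[]%R.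
  by apply/seteqP; split => y /=; rewrite !in_itv/= => /andP[? ?]; apply/andP; split; lra.
rewrite !lebesgue_measure_itv/= !lte_fin.
have -> : ((a - q < a - p) = (p < q))%R by apply/idP/idP => ?; lra.
by case: ifP => // _; rewrite -!EFinD; congr EFin; lra.
Qed.

Lemma integral_reflect (a : R) (f : R -> \bar R) : measurable_fun setT f ->
  (forall x, 0 <= f x) -> \int[leb]_y f (a - y)%R = \int[leb]_y f y.
Proof.
move=> mf f0.
have mr : measurable_fun setT (fun y : R => (a - y)%R).
  by apply: measurable_funB; [exact: measurable_cst|exact: measurable_id].
have := @ge0_integral_pushforward _ _ _ _ R _ mr leb setT f measurableT mf
  (fun y _ => f0 y).
rewrite preimage_setT => <-.
apply: eq_measure_integral => A mA _.
exact: leb1_reflect.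
Qed.

Definition transfer (c : R) (v : R * R) : R * R := ((c * v.1 - v.2)%R, v.1).

Lemma measurable_transfer c : measurable_fun setT (transfer c).
Proof.
apply: measurable_fun_pair; last exact: measurable_fst.
apply: measurable_funB; last exact: measurable_snd.
by apply: measurable_funM; [exact: measurable_cst|exact: measurable_fst].
Qed.

(** For fixed first coordinate [x] the map is the reflection [y |-> c x - y] followed by an exchange
    of coordinates; Tonelli in both orders reduces invariance to reflections of the line. *)
Lemma ge0_integral_transfer (c : R) (F : R * R -> \bar R) :
  measurable_fun setT F -> (forall v, 0 <= F v) ->
  \int[leb2]_v F (transfer c v) = \int[leb2]_v F v.
Proof.
move=> mF F0.
have mFc : measurable_fun setT (F \o transfer c).
  exact: (measurableT_comp mF (measurable_transfer c)).
have Fc0 v : 0 <= (F \o transfer c) v by exact: F0.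
rewrite (@fubini_tonelli1 _ _ _ _ R leb leb _ mFc Fc0).
rewrite (@fubini_tonelli1 _ _ _ _ R leb leb F mF F0).
rewrite (@fubini_tonelli _ _ _ _ R leb leb F mF F0).
apply: eq_integral => x _; rewrite /fubini_F /fubini_G /= /transfer /=.
apply: (integral_reflect (c * x) (f := fun y => F (y, x))) => //.
exact: (measurableT_comp mF (pair2_measurable x)).
Qed.

Lemma integral_step (f0 f1 E l : R) (F : R * R -> \bar R) :
  measurable_fun setT F ->
  \int[leb2]_v F (step f0 f1 E l v) = \int[leb2]_v F v.
Proof.
move=> mF; rewrite integralE [RHS]integralE.
have key (G : R * R -> \bar R) : measurable_fun setT G -> (forall v, 0 <= G v) ->
    \int[leb2]_v G (step f0 f1 E l v) = \int[leb2]_v G v.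
  move=> mG G0.
  have mGc : measurable_fun setT (G \o transfer (E - f1 * l)%R).
    exact: (measurableT_comp mG (measurable_transfer _)).
  rewrite -(ge0_integral_transfer (E - f1 * l) mG G0).
  by rewrite -(ge0_integral_transfer (E - f0 * l) mGc (fun v => G0 _)).
congr (_ - _).
  rewrite -(key F^\+ (measurable_funepos mF) (funepos_ge0 F)).
  by apply: eq_integral => v _; rewrite !funeposE.
rewrite -(key F^\- (measurable_funeneg mF) (funeneg_ge0 F)).
by apply: eq_integral => v _; rewrite !funenegE.
Qed.

Lemma Rintegral_step (f0 f1 E l : R) (F : R * R -> R) :
  measurable_fun setT F ->
  (\int[leb2]_v F (step f0 f1 E l v) = \int[leb2]_v F v)%R.
Proof.
move=> mF; congr fine; apply: (@integral_step _ _ _ _ (EFin \o F)).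
exact/measurable_EFinP.
Qed.

Lemma integrable_step (f0 f1 E l : R) (F : R * R -> R) :
  measurable_fun setT F -> leb2.-integrable setT (EFin \o F) ->
  leb2.-integrable setT (EFin \o (F \o step f0 f1 E l)).
Proof.
move=> mF /integrableP[_ iF]; apply/integrableP; split.
  apply/measurable_EFinP; exact: (measurableT_comp mF (measurable_step _ _ _ _)).
have mn : measurable_fun setT (fun v => `|(F v)%:E|).
  by apply: measurableT_comp => //; exact/measurable_EFinP.
have := @integral_step f0 f1 E l _ mn; rewrite /comp /= => ->.
exact: iF.
Qed.

End PlaneLebesgue.

(** * The averaging operator of the model *)

Lemma ler_wln {R : realType} (x y : R) : 0 < x -> x <= y -> ln x <= ln y.
Proof. by move=> x0 xy; rewrite ler_ln ?posrE//; exact: lt_le_trans xy. Qed.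

Section Model.
Context {R : realType} (nu : probability R R) (f0 f1 E M : R).
Hypothesis M_ge0 : 0 <= M.
Implicit Types (v w x y z : R * R) (p : (R * R) * (R * R)).

(** Averages run over all real parameters. Clamping makes every bound hold for all of them and
    leaves [[-M, M]], which will carry [nu], untouched. *)
Definition clamp (l : R) : R := Num.max (- M) (Num.min M l).
Definition act (l : R) v := step f0 f1 E (clamp l) v.
(** One random parameter moves both vectors: either the columns of a matrix product, or two vectors
    whose angle is followed. *)
Definition act2 (l : R) p := (act l p.1, act l p.2).

Definition coef_bound : R := `|E| + (`|f0| + `|f1|) * M.
Definition expansion : R := (2 * coef_bound ^+ 2 + 2) ^+ 2.
Definition kappa : R := ln expansion.

Lemma clamp_id l : `|l| <= M -> clamp l = l.
Proof.
rewrite ler_norml /clamp => /andP[h1 h2].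
by rewrite (min_idPr h2) (max_idPr h1).
Qed.

Lemma clamp_le l : `|clamp l| <= M.
Proof.
rewrite ler_norml /clamp le_max lexx /= ge_max ge_min lexx /= andbT.
by rewrite (le_trans _ M_ge0)// oppr_le0.
Qed.

Lemma coef_bound_ge0 : 0 <= coef_bound.
Proof. by rewrite addr_ge0// mulr_ge0// addr_ge0. Qed.

Lemma coef_le l : `|l| <= M -> `|E - f0 * l| <= coef_bound /\ `|E - f1 * l| <= coef_bound.
Proof.
move=> lM.
have h0 : `|f0| * `|l| <= `|f0| * M by rewrite ler_wpM2l.
have h1 : `|f1| * `|l| <= `|f1| * M by rewrite ler_wpM2l.
have p0 : 0 <= `|f0| * M by rewrite mulr_ge0.
have p1 : 0 <= `|f1| * M by rewrite mulr_ge0.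
by split; apply: le_trans (ler_normB _ _) _; rewrite normrM /coef_bound; lra.
Qed.

Lemma expansion_ge4 : 4 <= expansion.
Proof.
rewrite /expansion (_ : 4 = 2 ^+ 2); last by ring.
have h := sqr_ge0 coef_bound.
by rewrite ler_sqr ?nnegrE; lra.
Qed.

Lemma expansion_gt0 : 0 < expansion.
Proof. by have := expansion_ge4; lra. Qed.

Lemma kappa_gt0 : 0 < kappa.
Proof. by rewrite ln_gt0//; have := expansion_ge4; lra. Qed.

Lemma n2_act_le l v : n2 (act l v) <= expansion * n2 v.
Proof. by have [h0 h1] := coef_le (clamp_le l); exact: n2_step_le. Qed.

Lemma n2_act_ge l v : n2 v <= expansion * n2 (act l v).
Proof.
have [h0 h1] := coef_le (clamp_le l).
by rewrite -{1}(stepK f0 f1 E (clamp l) v); exact: n2_stepV_le.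
Qed.

Lemma act_eq0 l v : (act l v == (0, 0)) = (v == (0, 0)).
Proof. exact: step_eq0. Qed.

Lemma wedge_act l v w : wedge (act l v) (act l w) = wedge v w.
Proof. exact: wedge_step. Qed.

Lemma act_lin l c p : act l (lin c p) = lin c (act2 l p).
Proof. exact: step_lin. Qed.

Lemma ln_n2_act l v : `|ln (n2 (act l v)) - ln (n2 v)| <= kappa.
Proof.
have [v0|v0] := eqVneq v (0, 0).
  have /eqP -> : act l v == (0, 0) by rewrite act_eq0 v0.
  by rewrite v0 subrr normr0 ltW// kappa_gt0.
have nv : 0 < n2 v by rewrite n2_gt0.
have na : 0 < n2 (act l v) by rewrite n2_gt0 act_eq0.
rewrite ler_norml; apply/andP; split.
  rewrite lerBrDr addrC -lerBrDr opprK addrC /kappa -lnM ?posrE ?expansion_gt0//.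
  by apply: ler_wln => //; exact: n2_act_ge.
rewrite lerBlDr /kappa -lnM ?posrE ?expansion_gt0//.
by apply: ler_wln => //; exact: n2_act_le.
Qed.

Lemma measurable_clamp : measurable_fun setT clamp.
Proof.
apply: measurable_maxr; first exact: measurable_cst.
by apply: measurable_minr => //; exact: measurable_cst.
Qed.

Lemma measurable_act : measurable_fun setT (fun q : R * (R * R) => act q.1 q.2).
Proof.
have mc : measurable_fun setT (fun q : R * (R * R) => clamp q.1).
  exact: (measurableT_comp measurable_clamp measurable_fst).
have m1 : measurable_fun setT (fun q : R * (R * R) => q.2.1).
  exact: (measurableT_comp measurable_fst measurable_snd).
have m2 : measurable_fun setT (fun q : R * (R * R) => q.2.2).
  exact: (measurableT_comp measurable_snd measurable_snd).
have mu0 : measurable_fun setT (fun q : R * (R * R) => (E - f0 * clamp q.1) * q.2.1 - q.2.2).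
  apply: measurable_funB => //; apply: measurable_funM => //.
  apply: measurable_funB; first exact: measurable_cst.
  by apply: measurable_funM => //; exact: measurable_cst.
apply: measurable_fun_pair => //.
apply: measurable_funB => //; apply: measurable_funM => //.
apply: measurable_funB; first exact: measurable_cst.
by apply: measurable_funM => //; exact: measurable_cst.
Qed.

Lemma measurable_act2 :
  measurable_fun setT (fun q : R * ((R * R) * (R * R)) => act2 q.1 q.2).
Proof.
have ma (g : R * ((R * R) * (R * R)) -> R * R) : measurable_fun setT g ->
    measurable_fun setT (fun q => act q.1 (g q)).
  move=> mg; have mp : measurable_fun setT
    (fun q : R * ((R * R) * (R * R)) => (q.1, g q)).
    by apply: measurable_fun_pair => //; exact: measurable_fst.
  exact: (measurableT_comp measurable_act mp).
apply: measurable_fun_pair; apply: ma.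
  exact: (measurableT_comp measurable_fst measurable_snd).
exact: (measurableT_comp measurable_snd measurable_snd).
Qed.

(* The zero vector lies in every annulus, [ln] having the junk value 0 there. *)
Definition annulus (r : nat) v : Prop := `|ln (n2 v)| <= r%:R * kappa.
Definition annulus2 (r : nat) p : Prop := annulus r p.1 /\ annulus r p.2.

Lemma annulus_cover v : exists r, annulus r v.
Proof.
pose r := Num.bound (`|ln (n2 v)| / kappa); exists r; rewrite /annulus.
rewrite -ler_pdivrMr ?kappa_gt0// ltW// /r.
by apply: archi_boundP; rewrite divr_ge0// ltW// kappa_gt0.
Qed.

Lemma annulus_mono r s v : (r <= s)%N -> annulus r v -> annulus s v.
Proof.
move=> rs h; apply: le_trans h _.
by rewrite ler_wpM2r ?ler_nat// ltW// kappa_gt0.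
Qed.

Lemma annulus2_cover p : exists r, annulus2 r p.
Proof.
have [r hr] := annulus_cover p.1; have [s hs] := annulus_cover p.2.
exists (maxn r s); split.
  by apply: annulus_mono hr; rewrite leq_maxl.
by apply: annulus_mono hs; rewrite leq_maxr.
Qed.

Lemma annulus_step r l v : annulus r v -> annulus r.+1 (act l v).
Proof.
rewrite /annulus => h; have h' := ln_n2_act l v.
rewrite -(subrK (ln (n2 v)) (ln (n2 (act l v)))).
apply: le_trans (ler_normD _ _) _.
by rewrite -natr1 mulrDl mul1r addrC; exact: lerD.
Qed.

Lemma annulus2_step r l p : annulus2 r p -> annulus2 r.+1 (act2 l p).
Proof. by move=> [h1 h2]; split; exact: annulus_step. Qed.

Local Notation T := (avg nu act).
Local Notation T2 := (avg nu act2).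

Let tame1_iter := tame_iter nu measurable_act annulus_cover (@annulus_step).
Let T_iterD := iter_avgD nu measurable_act annulus_cover (@annulus_step).
Let T_iterZ := iter_avgZ nu measurable_act annulus_cover (@annulus_step).
Let T_le := iter_avg_le nu measurable_act annulus_cover (@annulus_step).
Let T_le_reach := iter_avg_le_reach nu measurable_act annulus_cover (@annulus_step).
Let integrable_T := integrable_act nu measurable_act annulus_cover (@annulus_step).
Let T2_iterD := iter_avgD nu measurable_act2 annulus2_cover (@annulus2_step).
Let T2_iterZ := iter_avgZ nu measurable_act2 annulus2_cover (@annulus2_step).
Let T2_le := iter_avg_le nu measurable_act2 annulus2_cover (@annulus2_step).

Lemma T2_fst n (F : R * R -> R) p : iter n T2 (F \o fst) p = iter n T F p.1.
Proof. exact: iter_avg_equivariant. Qed.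

(** Taken at [p = (e1, e2)], this expresses the walks from all vectors [c] through one random
    matrix, so that they can be compared. *)
Lemma T2_lin n (F : R * R -> R) c p :
  iter n T2 (F \o lin c) p = iter n T F (lin c p).
Proof. by apply: iter_avg_equivariant => l q; rewrite act_lin. Qed.

Lemma measurable_ln_n2 : measurable_fun setT (fun v => ln (n2 v)).
Proof. exact: (measurableT_comp (@measurable_ln R) measurable_n2). Qed.

Lemma tame_ln_n2 : tame annulus (fun v => ln (n2 v)).
Proof.
split; first exact: measurable_ln_n2.
by move=> r; exists (r%:R * kappa).
Qed.

Lemma tame_expR_ln_n2 (s : R) : tame annulus (fun v => expR (s * ln (n2 v))).
Proof.
split.
  apply: (measurableT_comp (@measurable_expR R)).
  by apply: measurable_funM; [exact: measurable_cst|exact: measurable_ln_n2].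
move=> r; exists (expR (`|s| * (r%:R * kappa))) => v hv.
rewrite ger0_norm ?expR_ge0// ler_expR (le_trans (ler_norm _))// normrM.
by rewrite ler_wpM2l.
Qed.

(** * Variance of one averaging step *)

Section Variance.
Context (f : R * R -> R).
Hypothesis f_meas : measurable_fun setT f.
Hypothesis f_01 : forall v, 0 <= f v <= 1.
Hypothesis f_int : leb2.-integrable setT (EFin \o (fun v => f v ^+ 2)).

Let J : R := \int[leb2]_v (f v ^+ 2).

Let JE : (\int[leb2]_v (f v ^+ 2)%:E = J%:E)%E.
Proof. by rewrite /J /Rintegral fineK//; exact: integrable_fin_num. Qed.

Let f_tame : tame annulus f.
Proof.
apply: (tame_bounded annulus (C := 1)) => // v.
by have /andP[h0 h1] := f_01 v; rewrite ger0_norm.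
Qed.

Let T_meas : measurable_fun setT (T f).
Proof. by have [] := tame1_iter 1 f_tame. Qed.

Definition deviation (l : R) v : R := (f (act l v) - T f v) ^+ 2.

Let pair_meas : measurable_fun setT (fun q : (R * R) * R => f (act q.2 q.1)).
Proof.
apply: (measurableT_comp f_meas).
have ms : measurable_fun setT (fun q : (R * R) * R => (q.2, q.1)).
  by apply: measurable_fun_pair; [exact: measurable_snd|exact: measurable_fst].
exact: (measurableT_comp measurable_act ms).
Qed.

Let dev_meas : measurable_fun setT (fun q : (R * R) * R => (deviation q.2 q.1)%:E).
Proof.
apply/measurable_EFinP; apply: measurable_funX; apply: measurable_funB; first exact: pair_meas.
exact: (measurableT_comp T_meas measurable_fst).
Qed.

Lemma mean_deviation v :
  (\int[nu]_l (deviation l v)%:E = (T (fun y => f y ^+ 2) v - T f v ^+ 2)%:E)%E.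
Proof.
pose c := T f v.
pose g y := f y ^+ 2 + (- (2 * c) * f y + c ^+ 2).
have t2 : tame annulus (fun y => f y ^+ 2) by exact: tameM.
have t1 : tame annulus (fun y => - (2 * c) * f y) by exact: tameZ.
have tc : tame annulus (fun=> c ^+ 2) by exact: tame_cst.
have tg : tame annulus g by apply: tameD => //; exact: tameD.
have -> : (\int[nu]_l (deviation l v)%:E = \int[nu]_l (g (act l v))%:E)%E.
  by apply: eq_integral => l _; congr EFin; rewrite /deviation /g -/c; ring.
have := integrable_fin_num measurableT (integrable_T v tg).
rewrite /comp => /fineK <-; congr EFin.
have -> : fine (\int[nu]_l (g (act l v))%:E) = iter 1 T g v by [].
rewrite (T_iterD 1 v t2 (tameD t1 tc)) (T_iterD 1 v t1 tc) (T_iterZ 1 (- (2 * c)) v f_tame).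
by rewrite iter_avg_cst /= -/c; ring.
Qed.

(** Steps preserve Lebesgue measure, so [T] of [f^2] has the same integral as [f^2], and what is
    lost in squared norm is the variance. The identity is stated in the extended reals because
    integrability of the square of [T f] is deduced from it. *)
Lemma variance_identity :
  (\int[leb2]_v (T f v ^+ 2)%:E + \int[nu]_l \int[leb2]_v (deviation l v)%:E
   = J%:E)%E.
Proof.
have dev0 (q : (R * R) * R) : (0 <= (deviation q.2 q.1)%:E)%E.
  by rewrite lee_fin sqr_ge0.
have -> : (\int[nu]_l \int[leb2]_v (deviation l v)%:E =
    \int[leb2]_v \int[nu]_l (deviation l v)%:E)%E.
  by rewrite (@fubini_tonelli _ _ _ _ R leb2 nu _ dev_meas dev0).
rewrite -ge0_integralD//; last 4 first.
- by move=> v _; rewrite lee_fin sqr_ge0.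
- by apply/measurable_EFinP; exact: measurable_funX.
- by move=> v _; apply: integral_ge0 => l _; rewrite lee_fin sqr_ge0.
- exact: (@measurable_fun_fubini_tonelli_F _ _ _ _ R nu _ dev_meas dev0).
have sq_meas : measurable_fun setT (fun q : (R * R) * R => (f (act q.2 q.1) ^+ 2)%:E).
  by apply/measurable_EFinP; exact: measurable_funX.
have sq0 (q : (R * R) * R) : (0 <= (f (act q.2 q.1) ^+ 2)%:E)%E.
  by rewrite lee_fin sqr_ge0.
have -> : (\int[leb2]_v ((T f v ^+ 2)%:E + \int[nu]_l (deviation l v)%:E) =
    \int[leb2]_v \int[nu]_l (f (act l v) ^+ 2)%:E)%E.
  apply: eq_integral => v _; rewrite mean_deviation -EFinD addrC subrK.
  rewrite /avg /Rintegral fineK//; apply: integrable_fin_num => //.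
  by apply: (integrable_T v (F := fun y => f y ^+ 2)); exact: tameM.
rewrite (@fubini_tonelli _ _ _ _ R leb2 nu _ sq_meas sq0) /fubini_G /=.
have m2 : measurable_fun setT (fun v => (f v ^+ 2)%:E).
  by apply/measurable_EFinP; exact: measurable_funX.
have inner l : (\int[leb2]_v (f (act l v) ^+ 2)%:E = J%:E)%E.
  by rewrite -JE; exact: (integral_step f0 f1 E (clamp l) m2).
under eq_integral do rewrite inner.
rewrite integral_cst// [X in (_ * X)%E](_ : _ = 1%E) ?mule1//.
exact: probability_setT.
Qed.

Lemma integrable_T_sqr : leb2.-integrable setT (EFin \o (fun v => T f v ^+ 2)).
Proof.
apply/integrableP; split; first by apply/measurable_EFinP; exact: measurable_funX.
have h := variance_identity; apply: (@le_lt_trans _ _ J%:E); last exact: ltry.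
rewrite -h; under eq_integral do rewrite /= ger0_norm ?sqr_ge0//.
rewrite leeDl//; apply: integral_ge0 => l _; apply: integral_ge0 => v _.
by rewrite lee_fin sqr_ge0.
Qed.

Let act_int l : leb2.-integrable setT (EFin \o (fun v => f (act l v) ^+ 2)).
Proof.
apply: (@integrable_step R f0 f1 E (clamp l) (fun v => f v ^+ 2)) => //.
exact: measurable_funX.
Qed.

Let dom_int l : leb2.-integrable setT
  (EFin \o (fun v => 2 * f (act l v) ^+ 2 + 2 * T f v ^+ 2)).
Proof.
exact: (integrableD measurableT (integrableZl measurableT 2 (act_int l))
    (integrableZl measurableT 2 integrable_T_sqr)).
Qed.

Let dev_le l v : deviation l v <= 2 * f (act l v) ^+ 2 + 2 * T f v ^+ 2.
Proof. by rewrite /deviation; have := sqr_ge0 (f (act l v) + T f v); lra. Qed.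

Lemma integrable_deviation l : leb2.-integrable setT (EFin \o deviation l).
Proof.
apply: le_integrable (dom_int l) => //.
  exact: (measurableT_comp dev_meas (pair2_measurable l)).
move=> v _; rewrite /= lee_fin ger0_norm ?sqr_ge0//.
by rewrite (le_trans (dev_le l v))// ler_norm.
Qed.

Lemma variance_identityR :
  \int[leb2]_v (T f v ^+ 2) + \int[nu]_l (\int[leb2]_v deviation l v) = J.
Proof.
have := variance_identity.
have e1 : (\int[leb2]_v (T f v ^+ 2)%:E = (\int[leb2]_v (T f v ^+ 2))%:E)%E.
  by rewrite /Rintegral fineK//; exact: (integrable_fin_num measurableT integrable_T_sqr).
have e2 l : (\int[leb2]_v (deviation l v)%:E = (\int[leb2]_v (deviation l v))%:E)%E.
  rewrite /Rintegral fineK//; apply: integrable_fin_num => //.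
  exact: integrable_deviation.
rewrite e1; under eq_integral do rewrite e2.
move=> h.
have fin : (\int[nu]_l (\int[leb2]_v deviation l v)%:E)%E \is a fin_num.
  rewrite ge0_fin_numE; last first.
    by apply: integral_ge0 => l _; rewrite lee_fin Rintegral_ge0// => v _; exact: sqr_ge0.
  apply: (@le_lt_trans _ _ J%:E); last exact: ltry.
  by rewrite -h leeDr// lee_fin Rintegral_ge0// => v _; exact: sqr_ge0.
by move: h; rewrite -(fineK fin) -EFinD => -[].
Qed.

Lemma T_sqr_le : \int[leb2]_v (T f v ^+ 2) <= J.
Proof.
rewrite -variance_identityR lerDl; apply: Rintegral_ge0 => l _.
by apply: Rintegral_ge0 => v _; exact: sqr_ge0.
Qed.

Lemma deviation_le4 l : \int[leb2]_v deviation l v <= 4 * J.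
Proof.
have i1 : leb2.-integrable setT (EFin \o (fun v => 2 * f (act l v) ^+ 2)).
  exact: (integrableZl measurableT 2 (act_int l)).
have i2 : leb2.-integrable setT (EFin \o (fun v => 2 * T f v ^+ 2)).
  exact: (integrableZl measurableT 2 integrable_T_sqr).
apply: (@le_trans _ _ (\int[leb2]_v (2 * f (act l v) ^+ 2 + 2 * T f v ^+ 2))).
  apply: le_Rintegral => //; exact: integrable_deviation.
have iT := integrable_T_sqr; rewrite RintegralD// !RintegralZl//.
have -> : \int[leb2]_v (f (act l v) ^+ 2) = J.
  by apply: (@Rintegral_step R f0 f1 E (clamp l) (fun v => f v ^+ 2)); exact: measurable_funX.
by have := T_sqr_le; lra.
Qed.

Lemma measurable_deviation :
  measurable_fun setT (fun l => \int[leb2]_v deviation l v).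
Proof.
have dev0 (q : (R * R) * R) : (0 <= (deviation q.2 q.1)%:E)%E.
  by rewrite lee_fin sqr_ge0.
apply: (measurableT_comp (fine_measurable measurableT)).
exact: (@measurable_fun_fubini_tonelli_G _ _ _ _ R leb2 _ dev_meas dev0).
Qed.

End Variance.

(** Young's inequality for [(x - b) * (x + b)]; the weight [t] balances a small variance against the
    total mass. *)
Lemma sqr_diff_le (t x b : R) : 0 < t ->
  `|x ^+ 2 - b ^+ 2| <= (x - b) ^+ 2 / (2 * t) + t * (x ^+ 2 + b ^+ 2).
Proof.
move=> t0; pose s := (x - b) / t.
have xb : x - b = t * s by rewrite /s mulrC divfK// gt_eqF.
have -> : (x - b) ^+ 2 / (2 * t) = t * (s ^+ 2 / 2).
  by rewrite xb; field; rewrite gt_eqF.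
have -> : x ^+ 2 - b ^+ 2 = t * (s * (x + b)) by rewrite mulrA -xb; ring.
rewrite -mulrDr normrM gtr0_norm// ler_wpM2l ?(ltW t0)// ler_norml.
have h1 := sqr_ge0 (s - (x + b)); have h2 := sqr_ge0 (s + (x + b)).
have h3 := sqr_ge0 (x - b).
by apply/andP; split; lra.
Qed.

(** * Spectral gap from five separated sets of parameters *)

Section FivePoints.
Hypotheses (f0_gt0 : 0 < f0) (f1_gt0 : 0 < f1).
Context (A : 'I_5 -> set R) (p0 delta : R).
Hypotheses (A_meas : forall i, measurable (A i)) (p0_gt0 : 0 < p0)
  (A_prob : forall i, (p0%:E <= nu (A i))%E) (delta_gt0 : 0 < delta)
  (A_bound : forall i l, A i l -> `|l| <= M)
  (A_sep : forall i j l m, i != j -> A i l -> A j m -> delta <= `|l - m|).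

(** It suffices to bound the mean variance below. By [avg_pigeon5], otherwise some five parameters
    have small variance together; the functions [v |-> f (M_l v)] are then nearly equal in L^2 for
    these [l], and integration against the square of one of them is an almost invariant
    functional. *)
Lemma spectral_gap : exists z : R, [/\ 0 < z, z < 1 & forall f : R * R -> R,
  measurable_fun setT f -> (forall v, 0 <= f v <= 1) -> f (0, 0) = 0 ->
  leb2.-integrable setT (EFin \o (fun v => f v ^+ 2)) ->
  \int[leb2]_v (T f v ^+ 2) <= (1 - z) * \int[leb2]_v (f v ^+ 2)].
Proof.
have [om om0 hom] :=
  almost_invariant_functional_le0 E f0_gt0 f1_gt0 coef_bound_ge0 delta_gt0.
(* With the weight [t = om / 8] of Young's inequality below, the two error terms are [ze / t] and
   [4 * t], both equal to [om / 2]. *)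
pose ze := om ^+ 2 / 16.
have ze0 : 0 < ze by rewrite divr_gt0// exprn_gt0.
pose z := Num.min (p0 * ze / 5) (1 / 2).
have z0 : 0 < z by rewrite lt_min !divr_gt0// mulr_gt0.
have z1 : z <= 1 / 2 by rewrite ge_min lexx orbT.
exists z; split => //; first lra.
move=> f mf f01 f00 f_int.
set J := \int[leb2]_v (f v ^+ 2).
have J0 : 0 <= J by apply: Rintegral_ge0 => v _; exact: sqr_ge0.
have mf2 : measurable_fun setT (fun v => f v ^+ 2) by exact: measurable_funX.
pose e l := \int[leb2]_v deviation f l v.
have e0 l : 0 <= e l by apply: Rintegral_ge0 => v _; exact: sqr_ge0.
suff key : p0 * (ze * J) / 5 <= \int[nu]_l e l.
  have zJ : z * J <= p0 * (ze * J) / 5.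
    rewrite [leRHS](_ : _ = p0 * ze / 5 * J); last by ring.
    by rewrite ler_wpM2r// ge_min lexx.
  by have := variance_identityR mf f01 f_int; rewrite -/J -/e; lra.
apply: (avg_pigeon5 (A := A)) => //.
- exact: measurable_deviation.
- by exists (4 * J) => l; exact: deviation_le4.
- exact: ltW.
move=> l Al; rewrite leNgt; apply/negP => small.
have lM i : `|l i| <= M by exact: A_bound.
have cl i : clamp (l i) = l i by exact: clamp_id.
have ei i : e (l i) < ze * J.
  apply: le_lt_trans small; rewrite (bigD1 i)//= lerDl.
  by apply: sumr_ge0 => j _.
have J_gt0 : 0 < J.
  rewrite lt_neqAle J0 andbT; apply/eqP => J00.
  by have := ei ord0; rewrite -J00 mulr0 ltNge e0.
pose fi i v := f (step f0 f1 E (l i) v).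
have mfi i : measurable_fun setT (fi i) by exact: (measurableT_comp mf (measurable_step _ _ _ _)).
have fi_int i : leb2.-integrable setT (EFin \o (fun v => fi i v ^+ 2)).
  exact: (@integrable_step R f0 f1 E (l i) (fun v => f v ^+ 2)).
have fiJ i : \int[leb2]_v (fi i v ^+ 2) = J.
  exact: (@Rintegral_step R f0 f1 E (l i) (fun v => f v ^+ 2)).
have bd_int i (g : R * R -> R) (C : R) : measurable_fun setT g -> (forall v, `|g v| <= C) ->
    leb2.-integrable setT (EFin \o (fun v => g v * fi i v ^+ 2)).
  move=> mg gC.
  have C0 : 0 <= C by exact: le_trans (gC (0, 0)).
  apply: (le_integrable measurableT _ _ (integrableZl measurableT C (fi_int i))).
    by apply/measurable_EFinP; apply: measurable_funM => //; exact: measurable_funX.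
  move=> v _; rewrite /= lee_fin !normrM (ger0_norm C0).
  by rewrite ler_wpM2r// mulr_ge0.
pose Th g : R := \int[leb2]_v (g v * fi ord0 v ^+ 2).
apply/negP: J_gt0; rewrite -leNgt.
apply: (hom l Th J) => //.
- by move=> i; have [] := coef_le (lM i).
- by move=> i; have [] := coef_le (lM i).
- by move=> i j ij; exact: A_sep ij (Al i) (Al j).
- move=> g h C mg mh gC hC; rewrite /Th -RintegralD//; [|exact: bd_int gC|exact: bd_int hC].
  by apply: eq_Rintegral => v _; rewrite mulrDl.
- move=> c g C mg gC; rewrite /Th -RintegralZl//; last exact: bd_int gC.
  by apply: eq_Rintegral => v _; rewrite mulrA.
- move=> g h C mg mh gC hC gh; apply: le_Rintegral => //; [exact: bd_int gC|exact: bd_int hC|].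
  (* The functions are compared off the origin only; at the origin the weight vanishes, since
     [f (0, 0) = 0]. *)
  move=> v _; have [v0|v0] := eqVneq v (0, 0); last by rewrite ler_wpM2r ?sqr_ge0// gh.
  have -> : fi ord0 v = 0.
    rewrite /fi; have /eqP -> : step f0 f1 E (l ord0) v == (0, 0) by rewrite step_eq0 v0.
    by [].
  by rewrite expr0n /= !mulr0.
- by rewrite /Th -(fiJ ord0); apply: eq_Rintegral => v _; rewrite mul1r.
move=> i g C mg gC.
have C0 : 0 <= C by exact: le_trans (gC (0, 0)).
(* Two measure preserving substitutions move the increment from [g] to the weight, replacing
   parameter [l ord0] by [l i]. *)
have -> : Th (fun v => g (stepV f0 f1 E (l i) (step f0 f1 E (l ord0) v))) =
    \int[leb2]_v (g v * fi i v ^+ 2).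
  pose F u := g (stepV f0 f1 E (l i) u) * f u ^+ 2.
  have mF : measurable_fun setT F.
    apply: measurable_funM => //.
    exact: (measurableT_comp mg (measurable_stepV _ _ _ _)).
  rewrite /Th (_ : (\int[leb2]_v _) = \int[leb2]_v F (step f0 f1 E (l ord0) v))//.
  rewrite (Rintegral_step _ _ _ _ mF) -(Rintegral_step f0 f1 E (l i) mF).
  by apply: eq_Rintegral => v _; rewrite /F stepK.
rewrite /Th -RintegralB//; [|exact: bd_int gC|exact: bd_int gC].
pose t := om / 8.
have t0 : 0 < t by rewrite divr_gt0.
pose fb := T f.
have fb_int : leb2.-integrable setT (EFin \o (fun v => fb v ^+ 2)).
  exact: integrable_T_sqr.
pose d i v := deviation f (l i) v.
have d_int i' : leb2.-integrable setT (EFin \o d i') by exact: integrable_deviation.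
have dE i' v : d i' v = (fi i' v - fb v) ^+ 2 by rewrite /d /deviation /act cl.
pose g1 v := d i v + d ord0 v.
pose g2 v := fi i v ^+ 2 + fi ord0 v ^+ 2 + 2 * fb v ^+ 2.
have g1_int : leb2.-integrable setT (EFin \o g1) := integrableD measurableT (d_int i) (d_int ord0).
have g2_int : leb2.-integrable setT (EFin \o g2) :=
  integrableD measurableT (integrableD measurableT (fi_int i) (fi_int ord0))
    (integrableZl measurableT 2 fb_int).
have g12_int : leb2.-integrable setT (EFin \o (fun v => C / (2 * t) * g1 v + C * t * g2 v)) :=
  integrableD measurableT (integrableZl measurableT (C / (2 * t)) g1_int)
    (integrableZl measurableT (C * t) g2_int).
have gi_int : leb2.-integrable setT
    (EFin \o (fun v => g v * fi i v ^+ 2 - g v * fi ord0 v ^+ 2)) :=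
  integrableB measurableT (bd_int i g C mg gC) (bd_int ord0 g C mg gC).
apply: le_trans (le_normr_Rintegral measurableT gi_int) _.
apply: (@le_trans _ _ (\int[leb2]_v (C / (2 * t) * g1 v + C * t * g2 v))).
  apply: le_Rintegral => //; first exact: integrable_norm gi_int.
  move=> v _; rewrite -mulrBr normrM.
  apply: (@le_trans _ _ (C * (`|fi i v ^+ 2 - fb v ^+ 2| + `|fi ord0 v ^+ 2 - fb v ^+ 2|))).
    apply: ler_pM => //.
    rewrite [X in `|X|](_ : _ = (fi i v ^+ 2 - fb v ^+ 2) - (fi ord0 v ^+ 2 - fb v ^+ 2)).
      exact: ler_normB.
    by ring.
  rewrite [leRHS](_ : _ = C * (((fi i v - fb v) ^+ 2 / (2 * t) + t * (fi i v ^+ 2 + fb v ^+ 2))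
    + ((fi ord0 v - fb v) ^+ 2 / (2 * t) + t * (fi ord0 v ^+ 2 + fb v ^+ 2)))).
    by rewrite ler_wpM2l// lerD// sqr_diff_le.
  by rewrite /g1 /g2 !dE; ring.
have -> : \int[leb2]_v (C / (2 * t) * g1 v + C * t * g2 v) =
    C / (2 * t) * (e (l i) + e (l ord0)) + C * t * (J + J + 2 * \int[leb2]_v (fb v ^+ 2)).
  rewrite RintegralD//; [|exact: (integrableZl measurableT _ g1_int)|
    exact: (integrableZl measurableT _ g2_int)].
  rewrite !RintegralZl//; congr (_ * _ + _ * _); first exact: RintegralD.
  rewrite RintegralD//; [|exact: (integrableD measurableT (fi_int i) (fi_int ord0))|
    exact: (integrableZl measurableT 2 fb_int)].
  by rewrite RintegralD// RintegralZl// !fiJ.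
have fbJ : \int[leb2]_v (fb v ^+ 2) <= J by exact: T_sqr_le.
have ee : C / (2 * t) * (e (l i) + e (l ord0)) <= C / (2 * t) * (2 * (ze * J)).
  apply: ler_wpM2l; first by rewrite divr_ge0// mulr_ge0// ltW.
  by have := ei i; have := ei ord0; lra.
have ff : C * t * (J + J + 2 * \int[leb2]_v (fb v ^+ 2)) <= C * t * (4 * J).
  by apply: ler_wpM2l; [rewrite mulr_ge0// ltW|lra].
apply: le_trans (lerD ee ff) _.
rewrite le_eqVlt; apply/orP; left; apply/eqP.
by rewrite /ze /t; field; rewrite gt_eqF.
Qed.


(** * Growth of norms and of vectors *)

Lemma expr_small (q e : R) : 0 <= q -> q < 1 -> 0 < e ->
  exists n0, forall n, (n0 <= n)%N -> q ^+ n <= e.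
Proof.
move=> q0 q1 e0; have qn : `|q| < 1 by rewrite ger0_norm.
have /cvgrPdist_le/(_ _ e0)[n0 _ h] := cvg_expr qn.
exists n0 => n n0n; have := h n n0n.
by rewrite sub0r normrN ger0_norm// exprn_ge0.
Qed.

Lemma measurable_lin2 c : measurable_fun setT (fun p => lin c p).
Proof.
have m11 : measurable_fun setT (fun p : (R * R) * (R * R) => p.1.1).
  exact: (measurableT_comp measurable_fst measurable_fst).
have m12 : measurable_fun setT (fun p : (R * R) * (R * R) => p.1.2).
  exact: (measurableT_comp measurable_snd measurable_fst).
have m21 : measurable_fun setT (fun p : (R * R) * (R * R) => p.2.1).
  exact: (measurableT_comp measurable_fst measurable_snd).
have m22 : measurable_fun setT (fun p : (R * R) * (R * R) => p.2.2).
  exact: (measurableT_comp measurable_snd measurable_snd).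
apply: measurable_fun_pair => /=; apply: measurable_funD;
  by apply: measurable_funM => //; exact: measurable_cst.
Qed.

Definition unimodular : set ((R * R) * (R * R)) := [set p | wedge p.1 p.2 = 1].
Definition size2 p : R := n2 p.1 + n2 p.2.

Lemma unimodular_act2 l p : unimodular p -> unimodular (act2 l p).
Proof. by rewrite /unimodular /= wedge_act. Qed.

Lemma unimodular_basis : unimodular (e1, e2).
Proof. by rewrite /unimodular /wedge /=; ring. Qed.

Lemma measurable_size2 : measurable_fun setT size2.
Proof.
apply: measurable_funD.
  exact: (measurableT_comp measurable_n2 measurable_fst).
exact: (measurableT_comp measurable_n2 measurable_snd).
Qed.

Lemma annulus_expR r v : annulus r v ->
  n2 v <= expR (r%:R * kappa) /\ (n2 v = 0 \/ expR (- (r%:R * kappa)) <= n2 v).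
Proof.
rewrite /annulus ler_norml => /andP[h1 h2].
have [v0|v0] := eqVneq (n2 v) 0.
  by rewrite v0 expR_ge0; split => //; left.
have nv : 0 < n2 v by rewrite lt_neqAle eq_sym v0 n2_ge0.
by rewrite -(lnK (x := n2 v)) ?posrE// !ler_expR; split => //; right.
Qed.

Lemma tame_ln_size2 : tame annulus2 (fun p => ln (size2 p)).
Proof.
split; first exact: (measurableT_comp (@measurable_ln R) measurable_size2).
move=> r; exists (ln 2 + r%:R * kappa) => p [h1 h2].
have [u1 u2] := annulus_expR h1; have [w1 w2] := annulus_expR h2.
have rk : 0 <= r%:R * kappa by rewrite mulr_ge0// ltW// kappa_gt0.
have l2 : 0 <= ln 2 :> R by rewrite ln_ge0// ler1n.
have [s0|s0] := leP (size2 p) 0; first by rewrite ln0// normr0 addr_ge0.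
rewrite ler_norml; apply/andP; split.
  apply: (@le_trans _ _ (- (r%:R * kappa))); first by lra.
  rewrite -[leLHS]expRK; apply: ler_wln; first exact: expR_gt0.
  have n1 := n2_ge0 p.1; have n2' := n2_ge0 p.2.
  case: u2 => [u2|u2]; last by rewrite /size2; lra.
  case: w2 => [w2|w2]; last by rewrite /size2; lra.
  by move: s0; rewrite /size2 u2 w2 addr0 ltxx.
rewrite -[X in _ + X]expRK -lnM ?posrE ?expR_gt0//.
apply: ler_wln => //; rewrite /size2; lra.
Qed.

Definition small_set (s : R) : set ((R * R) * (R * R)) := [set p | size2 p <= s].

Lemma measurable_small_set s : measurable (small_set s).
Proof.
rewrite (_ : small_set s = size2 @^-1` [set` `]-oo, s]]).
  by rewrite -[X in measurable X]setTI; exact: measurable_size2.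
by apply/seteqP; split => p /=; rewrite in_itv.
Qed.

(** Without the origin, the indicator and all its averages vanish at 0, as [spectral_gap]
    demands. *)
Definition punctured_disk : set (R * R) := [set v | 0 < n2 v <= 1].

Lemma measurable_punctured_disk : measurable punctured_disk.
Proof.
rewrite (_ : punctured_disk = @n2 R @^-1` [set` `]0, 1]]).
  by rewrite -[X in measurable X]setTI; exact: measurable_n2.
by apply/seteqP; split => p /=; rewrite in_itv.
Qed.

Lemma leb2_box (a b : R) : a <= b ->
  leb2 ([set` `]a, b]] `*` [set` `]a, b]]) = ((b - a) ^+ 2)%:E.
Proof.
move=> ab; have mI : measurable ([set` `]a, b]] : set R) by exact: measurable_itv.
have l1 : leb1 ([set` `]a, b]] : set R) = (b - a)%:E.
  rewrite /leb1 lebesgue_measure_itv/= lte_fin.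
  case: ltP => [_|ba]; first by rewrite -EFinD.
  by rewrite (@le_anti _ _ a b) ?ab// subrr.
rewrite /leb2 product_measure1E//; transitivity ((b - a)%:E * (b - a)%:E)%E => //.
by congr (_ * _)%E; exact: l1.
Qed.

Lemma leb2_punctured_disk : (leb2 punctured_disk < +oo)%E.
Proof.
have mI : measurable ([set` `](-2), 2]] : set R) by exact: measurable_itv.
apply: (@le_lt_trans _ _ (leb2 ([set` `]-2, 2]] `*` [set` `]-2, 2]]))).
  apply: le_measure; rewrite ?inE; [exact: measurable_punctured_disk|exact: measurableX|].
  move=> [x y] /= /andP[_]; rewrite /n2 /= !in_itv/= => h.
  have := sqr_ge0 x; have := sqr_ge0 y => ? ?.
  have hx : `|x| <= 1 by rewrite -(@ler_sqr _ _ 1) ?nnegrE// real_normK ?num_real// expr1n; lra.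
  have hy : `|y| <= 1 by rewrite -(@ler_sqr _ _ 1) ?nnegrE// real_normK ?num_real// expr1n; lra.
  move: hx hy; rewrite !ler_norml => /andP[? ?] /andP[? ?].
  by split; apply/andP; split; lra.
by rewrite leb2_box ?ltry//; lra.
Qed.

Lemma integrable_indic_leb2 (S : set (R * R)) : measurable S -> (leb2 S < +oo)%E ->
  leb2.-integrable setT (EFin \o (\1_S : R * R -> R)).
Proof.
move=> mS Sfin; apply/integrableP; split.
  by apply/measurable_EFinP; exact: measurable_indic.
have -> : (\int[leb2]_v `|(EFin \o (\1_S : R * R -> R)) v| =
    \int[leb2]_v (\1_S v)%:E)%E.
  by apply: eq_integral => v _; rewrite /= indicE ger0_norm.
by rewrite integral_indic// setIT.
Qed.

Let f_ n := iter n T (\1_punctured_disk : R * R -> R).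

Let f_tame : tame annulus (\1_punctured_disk : R * R -> R).
Proof.
apply: (tame_bounded annulus (C := 1)).
  exact: measurable_indic measurable_punctured_disk.
by move=> v; rewrite indicE ger0_norm// lern1 leq_b1.
Qed.

Let f_01 n v : 0 <= f_ n v <= 1.
Proof.
have t0 : tame annulus (fun=> 0 : R) by exact: tame_cst.
have t1 : tame annulus (fun=> 1 : R) by exact: tame_cst.
apply/andP; split.
  rewrite -(iter_avg_cst nu act n 0 v).
  by apply: (T_le n t0 f_tame (Y := setT)) => // x _; rewrite indicE.
rewrite -(iter_avg_cst nu act n 1 v).
by apply: (T_le n f_tame t1 (Y := setT)) => // x _; rewrite indicE lern1 leq_b1.
Qed.

Let f_meas n : measurable_fun setT (f_ n).
Proof. by have [] := tame1_iter n f_tame. Qed.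

Let f_0 n : f_ n (0, 0) = 0.
Proof.
elim: n => [|n IH].
  rewrite /f_ /= indicE memNset// /punctured_disk /=.
  have /eqP -> : n2 (0 : R, 0 : R) == 0 by rewrite n2_eq0.
  by rewrite ltxx.
rewrite /f_ /= -[RHS](iter_avg_cst nu act 1 0 (0, 0)) /= /avg.
congr fine; apply: eq_integral => l _.
have /eqP -> : act l (0, 0) == (0, 0) by rewrite act_eq0.
by rewrite -/(f_ n) IH.
Qed.

Let f_int n : leb2.-integrable setT (EFin \o (fun v => f_ n v ^+ 2)).
Proof.
elim: n => [|n IH]; last exact: (integrable_T_sqr (f_meas n) (f_01 n) IH).
have i1 : leb2.-integrable setT (EFin \o (\1_punctured_disk : R * R -> R)).
  exact: integrable_indic_leb2 measurable_punctured_disk leb2_punctured_disk.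
apply: eq_integrable i1 => // v _; rewrite /f_ /= indicE.
by case: (v \in _); rewrite ?expr1n ?expr0n.
Qed.

(** [pi_ n s] is the probability that the product of [n] matrices has squared norm at most [s]. It
    bounds [f_ n] below on a box of area [1 / (2 s)], so its square is at most [2 s] times the
    decaying integral of [f_ n ^+ 2]. *)
Lemma norm_growth : exists c C : R, 0 < c /\ 0 <= C /\
  forall n, c * n%:R - C <= iter n T2 (fun p => ln (size2 p)) (e1, e2).
Proof.
have [z [z0 z1 gap]] := spectral_gap.
pose J0 := \int[leb2]_v (f_ 0 v ^+ 2).
have J0_ge0 : 0 <= J0 by apply: Rintegral_ge0 => v _; exact: sqr_ge0.
have Jn n : \int[leb2]_v (f_ n v ^+ 2) <= (1 - z) ^+ n * J0.
  elim: n => [|n IH]; first by rewrite expr0 mul1r.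
  apply: le_trans (gap _ (f_meas n) (f_01 n) (f_0 n) (f_int n)) _.
  by rewrite exprS -mulrA ler_wpM2l// subr_ge0 ltW.
pose pi_ n s := iter n T2 (\1_(small_set s) : _ -> R) (e1, e2).
have s_tame s : tame annulus2 (\1_(small_set s) : _ -> R).
  apply: (tame_bounded annulus2 (C := 1)).
    exact: measurable_indic (measurable_small_set s).
  by move=> p; rewrite indicE ger0_norm// lern1 leq_b1.
have pi_ge0 n s : 0 <= pi_ n s.
  have t0 : tame annulus2 (fun=> 0 : R) by exact: tame_cst.
  rewrite -(iter_avg_cst nu act2 n 0 (e1, e2)).
  by apply: (T2_le n t0 (s_tame s) (Y := setT)) => // x _; rewrite indicE.
have f_pi n s v : 0 < n2 v -> n2 v * s <= 1 -> pi_ n s <= f_ n v.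
  move=> v0 vs.
  rewrite /f_ -[X in iter _ _ _ X]lin_basis -T2_lin.
  have t : tame annulus2 ((\1_punctured_disk : R * R -> R) \o lin v).
    apply: (tame_bounded annulus2 (C := 1)).
      apply: (measurableT_comp (measurable_indic _)); first exact: measurable_punctured_disk.
      exact: measurable_lin2.
    by move=> p; rewrite /= indicE ger0_norm// lern1 leq_b1.
  apply: (T2_le n (s_tame s) t (Y := unimodular) (@unimodular_act2)); last exact: unimodular_basis.
  move=> p p1 /=; rewrite !indicE.
  have [ps|ps] := boolP (p \in small_set s); last by [].
  rewrite mem_set//= /punctured_disk /=.
  rewrite n2_gt0 (lin_neq0 p1) -?n2_gt0//=.
  apply: le_trans (n2_lin_le _ _) _; apply: le_trans vs.
  by rewrite ler_wpM2l ?n2_ge0//; move/set_mem : ps.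
have pi_sq n s : 0 < s -> pi_ n s ^+ 2 <= 2 * s * ((1 - z) ^+ n * J0).
  move=> s0.
  (* The square of side [r] lies in the disk of squared radius [1 / s]; its lower and left edges are
     excluded to avoid the origin. *)
  pose r := Num.sqrt ((2 * s)^-1).
  have r2 : r ^+ 2 = (2 * s)^-1 by rewrite sqr_sqrtr// invr_ge0 mulr_ge0// ltW.
  have r0 : 0 <= r by exact: sqrtr_ge0.
  pose box : set (R * R) := [set` `]0, r]] `*` [set` `]0, r]].
  have mI : measurable ([set` `]0, r]] : set R) by exact: measurable_itv.
  have mbox : measurable box by exact: measurableX.
  have bE : leb2 box = ((2 * s)^-1)%:E by rewrite /box leb2_box// subr0 r2.
  have ib : leb2.-integrable setT (EFin \o (\1_box : R * R -> R)).
    by apply: integrable_indic_leb2 => //; rewrite bE ltry.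
  have : \int[leb2]_v (pi_ n s ^+ 2 * \1_box v) <= \int[leb2]_v (f_ n v ^+ 2).
    apply: le_Rintegral => //.
      exact: (integrableZl measurableT _ ib).
    move=> v _; rewrite indicE; have [vb|vb] := boolP (v \in box); last first.
      by rewrite mulr0 sqr_ge0.
    rewrite mulr1 ler_sqr ?nnegrE//; last by have /andP[] := f_01 n v.
    case: v vb => x y; rewrite inE => -[/=]; rewrite !in_itv/= => /andP[x0 xr] /andP[y0 yr].
    have xs : x ^+ 2 <= r ^+ 2 by rewrite ler_sqr ?nnegrE// ltW.
    have ys : y ^+ 2 <= r ^+ 2 by rewrite ler_sqr ?nnegrE// ltW.
    apply: f_pi; first by rewrite /n2 /= addr_gt0// exprn_gt0.
    rewrite -ler_pdivlMr// div1r /n2 /=.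
    apply: le_trans (lerD xs ys) _; rewrite r2 le_eqVlt; apply/orP; left; apply/eqP.
    by field; rewrite gt_eqF.
  have bI : \int[leb2]_v (\1_box v) = (2 * s)^-1.
    by rewrite /Rintegral integral_indic// setIT; exact: (congr1 fine bE).
  rewrite RintegralZl// bI => h.
  have := le_trans h (Jn n); rewrite ler_pdivrMr ?mulr_gt0//.
  by rewrite [_ * (2 * s)]mulrC.
pose q := Num.sqrt (1 - z).
have q2 : q ^+ 2 = 1 - z by rewrite sqr_sqrtr// subr_ge0 ltW.
have q0 : 0 < q by rewrite sqrtr_gt0 subr_gt0.
have q1 : q < 1.
  by rewrite -(@ltr_pXn2r _ 2)// ?nnegrE ?(ltW q0)// q2 expr1n; lra.
(* Chosen so that [2 * J0 * q ^+ n <= 1 / 4] from [n0] on, which gives [pi_half]. *)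
have e0 : 0 < (8 * (J0 + 1))^-1 by rewrite invr_gt0 mulr_gt0// ltr_wpDl.
have [n0 hn0] := expr_small (ltW q0) q1 e0.
pose c := - ln q / 2.
have lnq : ln q < 0 by rewrite ln_lt0// q0.
have c0 : 0 < c by rewrite /c; lra.
exists c, (c * n0%:R); split => //; split; first by rewrite mulr_ge0// ltW.
have t0 : tame annulus2 (fun=> 0 : R) by exact: tame_cst.
move=> n; have [nn0|n0n] := leqP n n0.
  apply: (@le_trans _ _ 0).
    by rewrite -mulrBr pmulr_rle0// subr_le0 ler_nat.
  rewrite -(iter_avg_cst nu act2 n 0 (e1, e2)).
  apply: (T2_le n t0 tame_ln_size2 (Y := unimodular) (@unimodular_act2)); last exact: unimodular_basis.
  by move=> p p1; rewrite ln_ge0//; exact: n2_wedge1_ge.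
(* The integral decays like [q ^+ (2 * n)]: half of this rate pays for the factor [s], half remains
   to make [pi_ n s] small. *)
pose s := q ^- n.
have qn : 0 < q ^+ n by rewrite exprn_gt0.
have s0 : 0 < s by rewrite invr_gt0.
have lns : ln s = n%:R * (- ln q).
  by rewrite /s lnV ?posrE// lnXn// mulrN mulr_natl.
have pi_half : pi_ n s <= 1 / 2.
  have h0 : 0 <= 1 / 2 :> R by lra.
  rewrite -(@ler_pXn2r _ 2)// ?nnegrE//.
  apply: le_trans (pi_sq n s s0) _.
  rewrite (_ : 2 * s * ((1 - z) ^+ n * J0) = 2 * J0 * q ^+ n); last first.
    by rewrite /s -q2 -exprM mulnC exprM expr2; field; rewrite gt_eqF.
  apply: (@le_trans _ _ (2 * (J0 + 1) * (8 * (J0 + 1))^-1)).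
    apply: ler_pM; rewrite ?(ltW qn) ?mulr_ge0//; last exact/hn0/ltnW.
    by rewrite ler_wpM2l//; lra.
  rewrite le_eqVlt; apply/orP; left; apply/eqP; field.
  by rewrite gt_eqF// ltr_wpDl.
(* The logarithm is nonnegative on unimodular matrices and at least [ln s] off the small set. *)
apply: (@le_trans _ _ (ln s * (1 - pi_ n s))).
  rewrite lns; have n_ge0 : 0 <= n%:R :> R by [].
  have : n%:R * (- ln q) * (1 / 2) <= n%:R * (- ln q) * (1 - pi_ n s).
    by rewrite ler_wpM2l// ?mulr_ge0//; lra.
  have : 0 <= c * n0%:R by rewrite mulr_ge0// ltW.
  by rewrite /c; lra.
have -> : ln s * (1 - pi_ n s) =
    iter n T2 (fun p => ln s + (- ln s) * \1_(small_set s) p) (e1, e2).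
  rewrite (T2_iterD n _ (tame_cst annulus2 (ln s)) (tameZ (- ln s) (s_tame s))).
  by rewrite (T2_iterZ n _ _ (s_tame s)) iter_avg_cst -/(pi_ n s); ring.
apply: (T2_le n _ tame_ln_size2 (Y := unimodular) (@unimodular_act2)); last exact: unimodular_basis.
  by apply: tameD; [exact: tame_cst|exact: tameZ].
move=> p p1; rewrite indicE; have [ps|ps] := boolP (p \in small_set s).
  by rewrite mulr1 subrr ln_ge0//; exact: n2_wedge1_ge.
rewrite mulr0 addr0; apply: ler_wln => //.
by move: ps; rewrite notin_setE /small_set /= => /negP; rewrite -ltNge => /ltW.
Qed.

Definition ell v : R := ln (n2 v).
Definition log_growth k v : R := iter k T ell v - ell v.

Let tame_ell : tame annulus ell. Proof. exact: tame_ln_n2. Qed.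

(** Columns in an annulus may nearly cancel in [lin c p], making its logarithm unbounded below;
    determinant 1 excludes this, and the cutoff makes the function tame. *)
Definition ell_lin c p : R := if wedge p.1 p.2 == 1 then ell (lin c p) else 0.

Lemma ell_lin_le c p : c != (0, 0) -> unimodular p ->
  `|ell (lin c p)| <= `|ell c| + `|ln (size2 p)|.
Proof.
move=> c0 p1.
have nc : 0 < n2 c by rewrite n2_gt0.
have nl : 0 < n2 (lin c p) by rewrite n2_gt0; exact: lin_neq0.
have s1 : 1 <= size2 p by exact: n2_wedge1_ge.
have s0 : 0 < size2 p by exact: lt_le_trans s1.
have up : ell (lin c p) <= ell c + ln (size2 p).
  by rewrite /ell -lnM ?posrE//; apply: ler_wln => //; exact: n2_lin_le.
have lo : ell c <= ell (lin c p) + ln (size2 p).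
  rewrite /ell -lnM ?posrE//; apply: ler_wln => //.
  (* A quarter turn of [c]: the preserved wedge equals [n2 c], which keeps the image of [c] away
     from 0. *)
  pose c' : R * R := (- c.2, c.1).
  have nc' : n2 c' = n2 c by rewrite /n2 /c' /= sqrrN addrC.
  have h1 := wedge_sqr_le (lin c p) (lin c' p).
  rewrite wedge_lin p1 mulr1 (_ : wedge c c' = n2 c) in h1; last first.
    by rewrite /wedge /n2 /c' /=; ring.
  have h2 := n2_lin_le c' p; rewrite nc' in h2.
  rewrite -(ler_pM2l nc) -expr2; apply: le_trans h1 _.
  rewrite [leRHS](_ : _ = n2 (lin c p) * (n2 c * size2 p)); last by ring.
  by rewrite ler_wpM2l// ltW.
have := ler_norm (ell c); have := ler_norm (- ell c); rewrite normrN.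
have := ler_norm (ln (size2 p)).
by move=> ? ? ?; rewrite ler_norml; apply/andP; split; lra.
Qed.

Lemma tame_ell_lin c : c != (0, 0) -> tame annulus2 (ell_lin c).
Proof.
move=> c0; split.
  apply: measurable_fun_ifT; last exact: measurable_cst.
    apply: measurable_fun_eqr; last exact: measurable_cst.
    have m11 : measurable_fun setT (fun p : (R * R) * (R * R) => p.1.1).
      exact: (measurableT_comp measurable_fst measurable_fst).
    have m12 : measurable_fun setT (fun p : (R * R) * (R * R) => p.1.2).
      exact: (measurableT_comp measurable_snd measurable_fst).
    have m21 : measurable_fun setT (fun p : (R * R) * (R * R) => p.2.1).
      exact: (measurableT_comp measurable_fst measurable_snd).
    have m22 : measurable_fun setT (fun p : (R * R) * (R * R) => p.2.2).
      exact: (measurableT_comp measurable_snd measurable_snd).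
    by apply: measurable_funB; apply: measurable_funM.
  exact: (measurableT_comp measurable_ln_n2 (measurable_lin2 c)).
move=> r; have [_ /(_ r)[C hC]] := tame_ln_size2; exists (`|ell c| + `|C|) => p Bp.
rewrite /ell_lin; case: eqP => [p1|_]; last by rewrite normr0 addr_ge0.
apply: le_trans (ell_lin_le c0 p1) _; rewrite lerD2l.
by rewrite (le_trans (hC p Bp))// ler_norm.
Qed.

Lemma T_ell_lin k c : iter k T ell c = iter k T2 (ell_lin c) (e1, e2).
Proof.
rewrite -{1}(lin_basis c) -T2_lin.
apply: (iter_avg_eq_on nu k (Y := unimodular) (@unimodular_act2)); last exact: unimodular_basis.
by move=> p p1; rewrite /ell_lin p1 eqxx.
Qed.

(** Induction on [k], splitting off the first step. [G] is the surplus over the worst case, namely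
    the induction bound after a one-step loss of [kappa]. Three well separated images together
    inherit the growth of the norm, hence [g = c / 3]. *)
Lemma pointwise_growth : exists g C : R, 0 < g /\
  forall k v, v != (0, 0) -> g * k%:R - C <= log_growth k v.
Proof.
have [c [C0 [c0 [C00 growth]]]] := norm_growth.
have [eta eta0 heta] := three_directions E f0_gt0 f1_gt0 coef_bound_ge0 delta_gt0.
have [C1 hC1] := ln_n2_three_ge expansion_gt0 eta0.
pose g := c / 3.
have g0 : 0 < g by rewrite divr_gt0.
have k0 := kappa_gt0.
(* Large enough that the mean surplus [p0 * (3 * C - C0 - C1) / 5] repays the loss [kappa] and the
   increment [g]. *)
pose C := ((g + kappa) * 5 / p0 + C0 + `|C1|) / 3.
have X0 : 0 < (g + kappa) * 5 / p0 by rewrite divr_gt0// mulr_gt0// addr_gt0.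
have C_ge0 : 0 <= C by rewrite divr_ge0// !addr_ge0// ltW.
exists g, C; split => //; elim=> [|k IH] v v0.
  by rewrite /log_growth /= mulr0 subrr sub0r oppr_le0.
have nv : 0 < n2 v by rewrite n2_gt0.
pose c1 := - ell v - (g * k%:R - C) + kappa.
pose G l := iter k T ell (act l v) + c1.
have tk : tame annulus (iter k T ell) by exact: tame1_iter.
have tc : tame annulus (fun=> c1) by exact: tame_cst.
have ellact l : ell v - kappa <= ell (act l v).
  by have := ln_n2_act l v; rewrite ler_norml -/(ell _) -/(ell _) => /andP[? _]; lra.
have G0 l : 0 <= G l.
  have a0 : act l v != (0, 0) by rewrite act_eq0.
  have := IH _ a0; rewrite /log_growth => h; have := ellact l.
  by rewrite /G /c1; lra.
have mG : measurable_fun setT G.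
  exact: (tame_act measurable_act v (tameD tk tc)).
have bG : exists D, forall l, G l <= D.
  have [D hD] := tame_actP annulus_cover (@annulus_step) v (tameD tk tc).
  by exists D => l; exact: le_trans (ler_norm _) (hD l).
have key : p0 * (3 * C - C0 - C1) / 5 <= \int[nu]_l G l.
  apply: (avg_pigeon5 (A := A)) => //; first exact: ltW.
  move=> l Al.
  have cl i : clamp (l i) = l i by apply: clamp_id; exact: A_bound.
  have lb i : `|E - f0 * l i| <= coef_bound by have [] := coef_le (A_bound (Al i)).
  have lsep i j : i != j -> delta <= `|l i - l j| by move=> ij; exact: A_sep ij (Al i) (Al j).
  have [i [j [m [[ij jm im] hij hjm him]]]] := heta l lb lsep v.
  have yE a : step f0 f1 E (l a) v = act (l a) v by rewrite /act cl.
  rewrite !yE in hij hjm him.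
  have y0 a : act (l a) v != (0, 0) by rewrite act_eq0.
  apply: le_trans (sum3_le (F := fun a => G (l a)) (fun a => G0 _) ij jm im).
  have t1 := tame_ell_lin (y0 i); have t2 := tame_ell_lin (y0 j).
  have t3 := tame_ell_lin (y0 m).
  have ts := tame_ln_size2.
  have tcc : tame annulus2 (fun=> 3 * ell v - C1) by exact: tame_cst.
  have : iter k T2 (fun p => ln (size2 p) + (3 * ell v - C1)) (e1, e2) <=
      iter k T2 (fun p => ell_lin (act (l i) v) p + ell_lin (act (l j) v) p
        + ell_lin (act (l m) v) p) (e1, e2).
    apply: (T2_le k (tameD ts tcc) (tameD (tameD t1 t2) t3)
      (Y := unimodular) (@unimodular_act2)); last exact: unimodular_basis.
    move=> p p1; rewrite /ell_lin p1 eqxx.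
    have := hC1 (n2 v) p (act (l i) v) (act (l j) v) (act (l m) v) nv p1
      (n2_act_le _ _) (n2_act_le _ _) (n2_act_le _ _) hij hjm him.
    by rewrite /size2 /ell; lra.
  rewrite (T2_iterD k _ ts tcc) (T2_iterD k _ (tameD t1 t2) t3) (T2_iterD k _ t1 t2).
  rewrite iter_avg_cst -!T_ell_lin => h.
  by have := growth k; rewrite /G /c1 /g => ?; lra.
have Gint : \int[nu]_l G l = iter k.+1 T ell v + c1.
  rewrite -[c1 in RHS](iter_avg_cst nu act 1 c1 v) -(T_iterD 1 v tk tc) //.
have Cp : g + kappa <= p0 * (3 * C - C0 - C1) / 5.
  have : p0 * ((g + kappa) * 5 / p0) <= p0 * (3 * C - C0 - C1).
    by apply: ler_wpM2l; [exact: ltW|rewrite /C; have := ler_norm C1; lra].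
  rewrite (_ : p0 * ((g + kappa) * 5 / p0) = (g + kappa) * 5); last first.
    by field; rewrite gt_eqF.
  by move=> ?; lra.
move: key; rewrite Gint /log_growth /c1 -natr1 => ?; lra.
Qed.

(** * Moments and uniform growth *)

(** Squaring [exp (x / 2) <= 1 / (1 - x / 2)] leaves a polynomial inequality whose remainder has the
    factor [1 - 3 x + x^2]; hence [1 / 3]. *)
Lemma expR_le_quadratic (x : R) : `|x| <= 1 / 3 -> expR x <= 1 + x + x ^+ 2.
Proof.
rewrite ler_norml => /andP[h1 h2].
have h3 : 0 < 1 - x / 2 by lra.
have e1 : expR (x / 2) <= (1 - x / 2)^-1.
  rewrite -[x / 2]opprK expRN opprK lef_pV2 ?posrE ?expR_gt0//.
  by rewrite expR_ge1Dx.
have -> : expR x = expR (x / 2) ^+ 2.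
  by rewrite -expRM_natl; congr expR; field.
apply: (@le_trans _ _ ((1 - x / 2)^-1 ^+ 2)).
  by rewrite ler_sqr ?nnegrE ?expR_ge0// invr_ge0 ltW.
rewrite exprVn -[leLHS]mul1r ler_pdivrMr ?exprn_gt0//.
have hx : 0 <= x ^+ 2 * (1 - 3 * x + x ^+ 2).
  by rewrite mulr_ge0 ?sqr_ge0//; have := sqr_ge0 x; lra.
have -> : (1 + x + x ^+ 2) * (1 - x / 2) ^+ 2 =
  1 + x ^+ 2 * (1 - 3 * x + x ^+ 2) / 4 by field.
by lra.
Qed.

Definition moment (s : R) v : R := expR (s * ell v).

Let tame_moment s : tame annulus (moment s). Proof. exact: tame_expR_ln_n2. Qed.

Lemma moment_step s l v : moment s (act l v) <= expR (`|s| * kappa) * moment s v.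
Proof.
rewrite /moment -expRD ler_expR -lerBlDr -mulrBr.
apply: le_trans (ler_norm _) _; rewrite normrM ler_wpM2l//.
exact: ln_n2_act.
Qed.

Lemma T_moment_le s n v : iter n T (moment s) v <= expR (`|s| * kappa) ^+ n * moment s v.
Proof.
elim: n v => [|n IH] v; first by rewrite expr0 mul1r.
have tm := tame_moment s.
apply: (@le_trans _ _ (iter 1 T (fun y => expR (`|s| * kappa) ^+ n * moment s y) v)).
  by apply: (T_le 1 (tame1_iter n tm) (tameZ _ tm) (Y := setT)).
rewrite (T_iterZ 1 _ v tm) exprSr -mulrA ler_wpM2l ?exprn_ge0 ?expR_ge0//.
rewrite -(iter_avg_cst nu act 1 (expR (`|s| * kappa) * moment s v) v).
apply: (avg_le nu measurable_act annulus_cover (@annulus_step) tm (tame_cst _ _)).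
by move=> l; exact: moment_step.
Qed.

(** In [k] steps the logarithm moves by at most [k * kappa], so the exponential is linear up to a
    quadratic error, and the mean of the linear part is [log_growth]. The sign [sg] treats lower and
    upper deviations at once. *)
Lemma moment_block (sg be s : R) (k : nat) : `|sg| = 1 ->
  (forall v, v != (0, 0) -> be <= sg * log_growth k v) ->
  0 < s -> s * (k%:R * kappa) <= 1 / 3 ->
  forall v, v != (0, 0) ->
  iter k T (moment (- (s * sg))) v <=
    expR (- (s * be) + (s * (k%:R * kappa)) ^+ 2) * moment (- (s * sg)) v.
Proof.
move=> sg1 hbe s0 sk v v0.
set e := s * (k%:R * kappa) in sk *.
have tm := tame_moment (- (s * sg)).
pose m := moment (- (s * sg)) v.
have m0 : 0 <= m by exact: expR_ge0.
pose c1 := m * (1 + e ^+ 2 + s * sg * ell v).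
have tq : tame annulus (fun w => c1 + - (m * (s * sg)) * ell w).
  by apply: tameD; [exact: tame_cst|exact: tameZ].
pose Y j := [set w | `|ell w - ell v| <= j%:R * kappa].
have hY j l w : Y j w -> Y j.+1 (act l w).
  rewrite /Y /= => h.
  have -> : ell (act l w) - ell v = (ell w - ell v) + (ell (act l w) - ell w) by ring.
  apply: le_trans (ler_normD _ _) _; rewrite -natr1 mulrDl mul1r.
  by apply: lerD => //; exact: ln_n2_act.
have hP w : Y (0 + k)%N w ->
    moment (- (s * sg)) w <= c1 + - (m * (s * sg)) * ell w.
  rewrite /Y /= add0n => h.
  set x := - (s * sg) * (ell w - ell v).
  have xe : `|x| <= e.
    rewrite /x normrM normrN normrM sg1 mulr1 (gtr0_norm s0) /e.
    by apply: ler_wpM2l; first exact: ltW.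
  have -> : moment (- (s * sg)) w = m * expR x.
    by rewrite /m /moment -expRD; congr expR; rewrite /x; ring.
  rewrite [leRHS](_ : _ = m * (1 + x + e ^+ 2)); last by rewrite /c1 /x; ring.
  rewrite ler_wpM2l//; apply: le_trans (expR_le_quadratic (le_trans xe sk)) _.
  rewrite lerD2l -[leLHS]real_normK ?num_real// ler_sqr ?nnegrE//.
  by rewrite (le_trans _ xe).
have hv : Y 0%N v by rewrite /Y /= subrr normr0 mul0r.
apply: le_trans (T_le_reach tm tq hY hP hv) _.
rewrite (T_iterD k v (tame_cst annulus c1) (tameZ _ tame_ell)) iter_avg_cst.
rewrite (T_iterZ k _ v tame_ell) -/m [leRHS]mulrC.
have -> : c1 + - (m * (s * sg)) * iter k T ell v =
    m * (1 + (- (s * (sg * log_growth k v)) + e ^+ 2)).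
  by rewrite /c1 /log_growth; ring.
rewrite ler_wpM2l//; apply: le_trans (expR_ge1Dx _) _.
rewrite ler_expR lerD2r lerN2 ler_wpM2l ?(ltW s0)//; exact: hbe.
Qed.

(** Blocks of length [k] are iterated. Half of [eps] absorbs [C / k] for long blocks, the other half
    the quadratic error for small [s]; [D] pays for the incomplete block. *)
Lemma moment_decay (sg al C eps : R) : `|sg| = 1 ->
  (forall k v, v != (0, 0) -> k%:R * al - C <= sg * log_growth k v) -> 0 < eps ->
  exists2 s0 : R, 0 < s0 & forall s, 0 < s -> s <= s0 ->
  exists2 D : R, 0 <= D & forall n v, v != (0, 0) ->
  iter n T (moment (- (s * sg))) v <=
    D * expR (- (s * (al - eps))) ^+ n * moment (- (s * sg)) v.
Proof.
move=> sg1 hal eps0.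
have kp := kappa_gt0.
pose k := (Num.bound (`|C| / (eps / 2))).+1.
have k0 : 0 < k%:R :> R by rewrite ltr0n.
have Ck : C <= k%:R * (eps / 2).
  rewrite -ler_pdivrMr ?divr_gt0//.
  apply: (@le_trans _ _ (`|C| / (eps / 2))).
    by rewrite ler_wpM2r ?ler_norm// invr_ge0 ltW// divr_gt0.
  have h : `|C| / (eps / 2) < (Num.bound (`|C| / (eps / 2)))%:R.
    by apply: archi_boundP; rewrite divr_ge0// ltW// divr_gt0.
  by rewrite ltW// (lt_le_trans h)// ler_nat.
have kk0 : 0 < k%:R * kappa by rewrite mulr_gt0.
pose s0 := Num.min (1 / (3 * (k%:R * kappa))) (eps / (2 * k%:R * kappa ^+ 2)).
exists s0.
  by rewrite lt_min !divr_gt0 ?mulr_gt0// exprn_gt0.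
move=> s s_gt0; rewrite le_min => /andP[s1 s2].
have sk : s * (k%:R * kappa) <= 1 / 3.
  apply: (@le_trans _ _ (1 / (3 * (k%:R * kappa)) * (k%:R * kappa))).
    by apply: ler_wpM2r => //; exact: ltW.
  by rewrite le_eqVlt; apply/orP; left; apply/eqP; field; rewrite !gt_eqF.
have s_eps : (s * (k%:R * kappa)) ^+ 2 <= s * (k%:R * (eps / 2)).
  have kk2 : 0 < k%:R * kappa ^+ 2 by rewrite mulr_gt0// exprn_gt0.
  have h : s * (k%:R * kappa ^+ 2) <= eps / 2.
    rewrite -ler_pdivlMr//; apply: le_trans s2 _.
    by rewrite le_eqVlt; apply/orP; left; apply/eqP; field; rewrite !gt_eqF.
  rewrite [leLHS](_ : _ = s * k%:R * (s * (k%:R * kappa ^+ 2))); last by ring.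
  rewrite [leRHS]mulrA; apply: ler_wpM2l => //; exact/ltW/mulr_gt0.
pose rho := expR (- (s * (al - eps))).
pose m := moment (- (s * sg)).
have tm : tame annulus m by exact: tame_moment.
have block v : v != (0, 0) -> iter k T m v <= rho ^+ k * m v.
  move=> v0; apply: le_trans (moment_block sg1 (hal k) s_gt0 sk v0) _.
  rewrite ler_wpM2r ?expR_ge0// /rho -expRM_natl ler_expR.
  have : s * C <= s * (k%:R * (eps / 2)) by apply: ler_wpM2l => //; exact: ltW.
  by move: s_eps; lra.
have nz l v : v != (0, 0) -> act l v != (0, 0) by rewrite act_eq0.
have rho0 : 0 < rho by exact: expR_gt0.
have blocks q v : v != (0, 0) -> iter (q * k) T m v <= rho ^+ (q * k) * m v.
  elim: q v => [|q IH] v v0; first by rewrite mul0n expr0 mul1r.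
  rewrite mulSn iterD.
  apply: (@le_trans _ _ (iter k T (fun y => rho ^+ (q * k) * m y) v)).
    exact: (T_le k (tame1_iter _ tm) (tameZ _ tm) (Y := [set y | y != (0, 0)]) nz IH).
  rewrite (T_iterZ k _ v tm) exprD [rho ^+ k * _]mulrC -mulrA.
  apply: ler_wpM2l; last exact: block.
  exact/exprn_ge0/ltW.
pose D := expR ((s * kappa + s * `|al - eps|) * k%:R).
exists D; first exact: expR_ge0.
move=> n v v0; rewrite (divn_eq n k) addnC iterD.
apply: (@le_trans _ _ (iter (n %% k) T (fun y => rho ^+ (n %/ k * k) * m y) v)).
  exact: (T_le _ (tame1_iter _ tm) (tameZ _ tm) (Y := [set y | y != (0, 0)]) nz (blocks _)).
rewrite (T_iterZ _ _ v tm) -/rho -/m addnC exprD.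
apply: (@le_trans _ _ (rho ^+ (n %/ k * k) * (expR (s * kappa) ^+ (n %% k) * m v))).
  rewrite ler_wpM2l ?exprn_ge0 ?(ltW rho0)//.
  have := T_moment_le (- (s * sg)) (n %% k) v.
  by rewrite normrN normrM sg1 mulr1 (gtr0_norm s_gt0).
rewrite mulrA; apply: ler_wpM2r; first exact: expR_ge0.
rewrite [leRHS](_ : _ = rho ^+ (n %/ k * k) * (D * rho ^+ (n %% k))); last by ring.
rewrite ler_wpM2l ?exprn_ge0 ?(ltW rho0)// /D /rho -!expRM_natl -expRD ler_expR.
have rk : (n %% k)%:R <= k%:R :> R by rewrite ler_nat ltnW// ltn_pmod.
have h1 : (n %% k)%:R * (s * kappa) <= k%:R * (s * kappa).
  by apply: ler_wpM2r => //; exact/ltW/mulr_gt0.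
have h2 : (n %% k)%:R * (s * (al - eps)) <= k%:R * (s * `|al - eps|).
  apply: (@le_trans _ _ ((n %% k)%:R * (s * `|al - eps|))).
    by rewrite ler_wpM2l// ler_wpM2l ?ler_norm// ltW.
  by apply: ler_wpM2r => //; apply: mulr_ge0 => //; exact: ltW.
by lra.
Qed.

(** Expanding [b] at the product of two lengths in both ways shows that every [(b n - C) / n] is
    below every [(b m + C) / m]; the supremum of the former separates them. *)
Lemma almost_additive_linear (b : nat -> R) (C : R) :
  (forall k l, `|b (k + l)%N - b k - b l| <= C) ->
  exists L : R, forall k, `|b k - k%:R * L| <= C.
Proof.
move=> h.
have h1 k l : b (k + l)%N <= b k + b l + C.
  by have := h k l; rewrite ler_norml => /andP[_]; lra.
have h2 k l : b k + b l - C <= b (k + l)%N.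
  by have := h k l; rewrite ler_norml => /andP[+ _]; lra.
have up n m : b (n * m.+1)%N <= m.+1%:R * (b n + C) - C.
  elim: m => [|m IH]; first by rewrite muln1; lra.
  rewrite mulnS; apply: le_trans (h1 _ _) _.
  by rewrite -(natr1 m.+1); lra.
have lo n m : m.+1%:R * (b n - C) + C <= b (n * m.+1)%N.
  elim: m => [|m IH]; first by rewrite muln1; lra.
  rewrite mulnS; apply: le_trans (h2 _ _).
  by rewrite -(natr1 m.+1); lra.
have C0 : 0 <= C by exact: le_trans (h 0%N 0%N).
pose S := [set x : R | exists n, x = (b n.+1 - C) / n.+1%:R].
have Sub m : ubound S ((b m.+1 + C) / m.+1%:R).
  move=> _ [n ->]; rewrite ler_pdivlMr// mulrAC ler_pdivrMr//.
  have := lo n.+1 m; have := up m.+1 n; rewrite mulnC; lra.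
have S0 : S ((b 1%N - C) / 1%:R) by exists 0%N.
have hS : has_sup S by split; [exists ((b 1%N - C) / 1%:R)|exists ((b 1%N + C) / 1%:R); exact: (Sub 0%N)].
exists (sup S) => -[|m].
  have := h 0%N 0%N; rewrite addn0 mul0r subr0.
  by rewrite (_ : _ - _ - _ = - b 0%N) ?normrN//; ring.
have l1 : b m.+1 - C <= m.+1%:R * sup S.
  rewrite mulrC -ler_pdivrMr//; apply: ub_le_sup; first by case: hS.
  by exists m.
have l2 : m.+1%:R * sup S <= b m.+1 + C.
  rewrite mulrC -ler_pdivlMr//; apply: ge_sup; [by case: hS|exact: Sub].
by rewrite ler_norml; apply/andP; split; lra.
Qed.

Lemma tame_fst (F : R * R -> R) : tame annulus F -> tame annulus2 (F \o fst).
Proof.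
move=> [mF bF]; split; first exact: (measurableT_comp mF measurable_fst).
by move=> r; have [C hC] := bF r; exists C => p [p1 _]; exact: hC.
Qed.

Lemma tame_snd (F : R * R -> R) : tame annulus F -> tame annulus2 (F \o snd).
Proof.
move=> [mF bF]; split; first exact: (measurableT_comp mF measurable_snd).
by move=> r; have [C hC] := bF r; exists C => p [_ p2]; exact: hC.
Qed.

Lemma T2_snd n (F : R * R -> R) p : iter n T2 (F \o snd) p = iter n T F p.2.
Proof. exact: iter_avg_equivariant. Qed.

Lemma tame_log_growth k : tame annulus (log_growth k).
Proof. by apply: tameB => //; exact: tame1_iter. Qed.

Lemma log_growthD k l v :
  log_growth (k + l) v = log_growth k v + iter k T (log_growth l) v.
Proof.
rewrite [log_growth (k + l) v]/log_growth iterD.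
have -> : iter l T ell = (fun y => log_growth l y + ell y).
  by apply/funext => y; rewrite /log_growth subrK.
rewrite (T_iterD k v (tame_log_growth l) tame_ell).
by rewrite [log_growth k v]/log_growth; ring.
Qed.

Lemma log_growth1_diff v w : v != (0, 0) -> w != (0, 0) ->
  log_growth 1 v - log_growth 1 w <=
  3 * expansion ^+ 2 * (`|wedge v w| / Num.sqrt (n2 v * n2 w)).
Proof.
move=> v0 w0; set c := (leRHS).
have tf := tame_fst tame_ell; have ts := tame_snd tame_ell.
have -> : log_growth 1 v - log_growth 1 w =
    avg nu act2 (fun p => (ell \o fst) p + (- 1) * (ell \o snd) p) (v, w) - (ell v - ell w).
  have := T2_iterD 1 (v, w) tf (tameZ (-1) ts) => /= ->.
  have := T2_iterZ 1 (-1) (v, w) ts => /= ->.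
  have := T2_fst 1 ell (v, w) => /= ->.
  have := T2_snd 1 ell (v, w) => /= ->.
  by rewrite /log_growth /=; ring.
rewrite lerBlDr.
rewrite -(iter_avg_cst nu act2 1 (c + (ell v - ell w)) (v, w)).
apply: (avg_le nu measurable_act2 annulus2_cover (@annulus2_step)).
- by apply: tameD => //; exact: tameZ.
- exact: tame_cst.
move=> l /=.
have := n2_step_ratio (ltW expansion_gt0) (n2_act_le l) (n2_act_ge l) v0 w0.
by rewrite -/c /ell; lra.
Qed.

(** One-step growth is Lipschitz in the angle, and the mean angle after [j] steps is bounded by
    negative moments, which decay by [pointwise_growth]. *)
Lemma iter_log_growth1_diff : exists2 C : R, 0 <= C & exists2 q : R, 0 < q < 1 &
  forall j v w, v != (0, 0) -> w != (0, 0) ->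
  iter j T (log_growth 1) v - iter j T (log_growth 1) w <= C * q ^+ j.
Proof.
have [g [C [g0 growth]]] := pointwise_growth.
have hg k v : v != (0, 0) -> k%:R * g - C <= 1 * log_growth k v.
  by move=> v0; rewrite mul1r mulrC; exact: growth.
have g2 : 0 < g / 2 by lra.
have [s0 s0_gt0 hs0] := moment_decay (normr1 R) hg g2.
pose s := Num.min s0 1.
have s_gt0 : 0 < s by rewrite lt_min s0_gt0 ltr01.
have s_le : s <= s0 by rewrite ge_min lexx.
have s1 : s <= 1 by rewrite ge_min lexx orbT.
have [D D0 decay] := hs0 s s_gt0 s_le.
pose q := expR (- (s * (g - g / 2))).
pose K := 3 * expansion ^+ 2.
have K0 : 0 <= K by rewrite mulr_ge0// exprn_ge0// ltW// expansion_gt0.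
exists (K * D); first exact: mulr_ge0.
exists q.
  rewrite expR_gt0 /= expR_lt1 oppr_lt0 mulr_gt0//; lra.
move=> j v w v0 w0.
pose m := moment (- (s * 1)).
have tm : tame annulus m by exact: tame_moment.
pose F p := (log_growth 1 \o fst) p + (- 1) * (log_growth 1 \o snd) p.
pose G p := K / 2 * expR (s * ell v) * (m \o fst) p + K / 2 * expR (s * ell w) * (m \o snd) p.
have tl1 := tame_fst (tame_log_growth 1); have tl2 := tame_snd (tame_log_growth 1).
have tm1 := tame_fst tm; have tm2 := tame_snd tm.
have tF : tame annulus2 F by apply: tameD => //; exact: tameZ.
have tG : tame annulus2 G by apply: tameD; exact: tameZ.
pose Y := [set p : (R * R) * (R * R) |
  [/\ p.1 != (0, 0), p.2 != (0, 0) & wedge p.1 p.2 = wedge v w]].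
have hY l p : Y p -> Y (act2 l p).
  by move=> [p1 p2 p3]; split; rewrite /= ?act_eq0 ?wedge_act.
have FG p : Y p -> F p <= G p.
  move=> [p1 p2 p3]; rewrite /F /= mulN1r; apply: le_trans (log_growth1_diff p1 p2) _.
  rewrite -/K /G.
  have s2 : 0 < s / 2 by lra.
  have s3 : 2 * (s / 2) <= 1 by lra.
  have := projective_dist_le s2 s3 p1 p2 v0 w0 p3.
  have -> : 2 * (s / 2) = s by field.
  move=> /(ler_wpM2l K0) => h; apply: le_trans h _.
  rewrite le_eqVlt; apply/orP; left; apply/eqP.
  rewrite /m /moment /ell /= mulr1 !mulrBr !expRD -!mulNr; ring.
have := T2_le j tF tG hY FG (x := (v, w)) (And3 v0 w0 erefl).
rewrite /F /G.
rewrite (T2_iterD j (v, w) tl1 (tameZ (-1) tl2)) (T2_iterZ j (-1) (v, w) tl2).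
rewrite (T2_iterD j (v, w) (tameZ _ tm1) (tameZ _ tm2)) !T2_iterZ//.
rewrite !T2_fst !T2_snd /= mulN1r => h; apply: le_trans h _.
have half x : x != (0, 0) -> K / 2 * expR (s * ell x) * iter j T m x <= K * D * q ^+ j / 2.
  move=> x0; have := decay j x x0; rewrite -/m -/q => h.
  have e0 : 0 <= K / 2 * expR (s * ell x) by rewrite mulr_ge0 ?expR_ge0// divr_ge0.
  apply: le_trans (ler_wpM2l e0 h) _.
  rewrite le_eqVlt; apply/orP; left; apply/eqP.
  have e1 : expR (s * ell x) * m x = 1.
    by rewrite /m /moment -expRD mulr1 mulNr subrr expR0.
  rewrite [LHS](_ : _ = K / 2 * D * q ^+ j * (expR (s * ell x) * m x)); last by ring.
  by rewrite e1; field.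
by have := half v v0; have := half w w0; lra.
Qed.

(** Growth over [k] steps is a sum of averaged one-step growths, so the differences form a geometric
    series; the induction carries its exact partial sums. *)
Lemma log_growth_diff : exists2 C : R, 0 <= C & forall k v w,
  v != (0, 0) -> w != (0, 0) -> `|log_growth k v - log_growth k w| <= C.
Proof.
have [C C0 [q /andP[q0 q1] hj]] := iter_log_growth1_diff.
have q1' : 0 < 1 - q by lra.
exists (C / (1 - q)); first by rewrite divr_ge0// ltW.
suff h k v w : v != (0, 0) -> w != (0, 0) ->
    log_growth k v - log_growth k w <= C / (1 - q) * (1 - q ^+ k).
  have hk k v w : v != (0, 0) -> w != (0, 0) ->
      log_growth k v - log_growth k w <= C / (1 - q).
    move=> v0 w0; apply: le_trans (h k v w v0 w0) _.
    apply: ler_piMr; first by rewrite divr_ge0// ltW.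
    by rewrite gerBl exprn_ge0// ltW.
  move=> k v w v0 w0; rewrite ler_norml; apply/andP; split; last exact: hk.
  by have := hk k w v w0 v0; lra.
move=> v0 w0; elim: k => [|k IH]; first by rewrite expr0 subrr mulr0 /log_growth /= !subrr.
rewrite -addn1 !log_growthD.
have -> : C / (1 - q) * (1 - q ^+ (k + 1)) = C / (1 - q) * (1 - q ^+ k) + C * q ^+ k.
  by rewrite exprD expr1; field; rewrite gt_eqF.
by have := hj k v w v0 w0; lra.
Qed.

Lemma uniform_growth : exists L C : R, 0 < L /\
  forall k v, v != (0, 0) -> `|log_growth k v - k%:R * L| <= C.
Proof.
have [C C0 hC] := log_growth_diff.
have [g [C1 [g0 growth]]] := pointwise_growth.
have e1_neq0 : (e1 : R * R) != (0, 0) by rewrite -n2_gt0 /n2 /=; lra.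
(* The defect of additivity compares [log_growth l] averaged over positions after [k] steps with its
   value at [e1]. *)
have [|L hL] := @almost_additive_linear (log_growth^~ e1) C.
  move=> k l; rewrite log_growthD.
  have -> : log_growth k e1 + iter k T (log_growth l) e1 - log_growth k e1 - log_growth l e1
    = iter k T (log_growth l) e1 - log_growth l e1 by ring.
  have nz l' v : v != (0, 0) -> act l' v != (0, 0) by rewrite act_eq0.
  have tl := tame_log_growth l.
  have hlo w : w != (0, 0) -> log_growth l e1 - C <= log_growth l w.
    by move=> w0; have := hC l w e1 w0 e1_neq0; rewrite ler_norml => /andP[? ?]; lra.
  have hup w : w != (0, 0) -> log_growth l w <= log_growth l e1 + C.
    by move=> w0; have := hC l w e1 w0 e1_neq0; rewrite ler_norml => /andP[? ?]; lra.
  have := T_le k (tame_cst annulus (log_growth l e1 - C)) tl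
    (Y := [set v | v != (0, 0)]) nz hlo e1_neq0.
  have := T_le k tl (tame_cst annulus (log_growth l e1 + C))
    (Y := [set v | v != (0, 0)]) nz hup e1_neq0.
  by rewrite !iter_avg_cst => ? ?; rewrite ler_norml; apply/andP; split; lra.
exists L, (C + C); split.
  rewrite ltNge; apply/negP => L0.
  pose k := Num.bound ((`|C1| + C) / g).
  have hk : (`|C1| + C) / g < k%:R.
    by apply: archi_boundP; rewrite divr_ge0 ?addr_ge0// ltW.
  have kL : k%:R * L <= 0 by rewrite mulr_ge0_le0.
  move: hk; rewrite ltr_pdivrMr// => hk.
  have := growth k e1 e1_neq0; have := hL k; rewrite ler_norml => /andP[_].
  by have := ler_norm C1; lra.
move=> k v v0; have -> : log_growth k v - k%:R * L =
  (log_growth k v - log_growth k e1) + (log_growth k e1 - k%:R * L) by ring.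
by apply: le_trans (ler_normD _ _) _; apply: lerD; [exact: hC|exact: hL].
Qed.

(** * Almost sure convergence *)

Section AlmostSure.
Context {d : measure_display} {Omega : measurableType d}
  (P : probability Omega R) (lam : nat -> Omega -> R).
Hypothesis iid : iid_law P lam nu.
Context (L C : R).
Hypothesis L_growth : forall k v, v != (0, 0) -> `|log_growth k v - k%:R * L| <= C.

Let S v n o := trajectory act (fun k => lam k o) v n.

(** Too little growth for [sg = 1], too much for [sg = -1]. *)
Definition deviating (sg eps : R) v n : set Omega :=
  [set o | sg * (ell (S v n o) - n%:R * L) <= - (n%:R * eps)].

Lemma measurable_deviating sg eps v n : measurable (deviating sg eps v n).
Proof.
pose g o := sg * (ell (S v n o) - n%:R * L).
have mg : measurable_fun setT g.
  apply: measurable_funM; first exact: measurable_cst.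
  apply: measurable_funB; last exact: measurable_cst.
  exact: (measurableT_comp measurable_ln_n2 (measurable_trajectory iid measurable_act v n)).
rewrite (_ : deviating _ _ _ _ = g @^-1` [set` `]-oo, - (n%:R * eps)]]).
  by rewrite -[X in measurable X]setTI; apply: mg => //; exact: measurable_itv.
by apply/seteqP; split => o /=; rewrite in_itv.
Qed.

Lemma deviating_le (sg eps : R) v : `|sg| = 1 -> 0 < eps -> v != (0, 0) ->
  exists D q : R, [/\ 0 <= D, 0 < q < 1 &
    forall n, (P (deviating sg eps v n) <= (D * q ^+ n)%:E)%E].
Proof.
move=> sg1 eps0 v0.
have hal k w : w != (0, 0) -> k%:R * (sg * L) - C <= sg * log_growth k w.
  move=> w0; have h : `|sg * (log_growth k w - k%:R * L)| <= C.
    by rewrite normrM sg1 mul1r; exact: L_growth.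
  by move: h; rewrite ler_norml => /andP[h _]; lra.
have eps2 : 0 < eps / 2 by lra.
have [s s_gt0 /(_ s s_gt0 (lexx s))[D D0 decay]] := moment_decay sg1 hal eps2.
pose m := moment (- (s * sg)).
have tm : tame annulus m by exact: tame_moment.
exists (D * m v), (expR (- (s * (eps / 2)))); split.
- by rewrite mulr_ge0// expR_ge0.
- by rewrite expR_gt0 expR_lt1 oppr_lt0 mulr_gt0.
(* The moment is at least [a] on the deviating event. In Markov's inequality [a] contributes the
   rate [eps] and the decay of the moment gives up [eps / 2]. *)
move=> n; pose a := expR (s * (n%:R * eps - sg * (n%:R * L))).
have a0 : 0 < a by exact: expR_gt0.
have mS := measurable_trajectory iid measurable_act v n.
have mg : measurable_fun setT (EFin \o (fun o => m (S v n o))).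
  apply/measurable_EFinP; exact: (measurableT_comp tm.1 mS).
have := @le_integral_comp_abse _ _ _ P setT measurableT _ a id
  (@measurable_id _ _ _) (fun r h => h) (fun a1 a2 _ _ h => h) mg a0.
rewrite setTI.
have -> : (\int[P]_o `|(EFin \o (fun o => m (S v n o))) o| = (iter n T m v)%:E)%E.
  rewrite -(integral_trajectory iid measurable_act annulus_cover (@annulus_step) v n tm).
    by apply: eq_integral => o _ /=; rewrite ger0_norm// expR_ge0.
  by move=> y; exact: expR_ge0.
move=> h.
have sub : (P (deviating sg eps v n) <=
    P [set o : Omega | (a%:E <= `|(EFin \o (fun o => m (S v n o))) o|)%E])%E.
  apply: le_measure; rewrite ?inE.
  - exact: measurable_deviating.
  - rewrite -[X in measurable X]setTI.
    apply: emeasurable_fun_c_infty => //; exact: measurableT_comp.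
  move=> o /= dw; rewrite lee_fin ger0_norm ?expR_ge0// /a /m /moment ler_expR.
  have := ler_wpM2l (ltW s_gt0) dw; lra.
have dl := decay n v v0.
rewrite -(@lee_pmul2l _ a%:E)//; apply: le_trans (lee_wpmul2l _ sub) _.
  by rewrite lee_fin ltW.
apply: le_trans h _; rewrite -EFinM lee_fin; apply: le_trans dl _.
rewrite -/m le_eqVlt; apply/orP; left; apply/eqP.
have -> : a * (D * m v * expR (- (s * (eps / 2))) ^+ n) =
    D * (a * expR (- (s * (eps / 2))) ^+ n) * m v by ring.
rewrite /a -!expRM_natl -expRD; congr (_ * expR _ * _).
by field.
Qed.

Lemma ell_trajectory_cvg v : v != (0, 0) ->
  {ae P, forall o, (fun n => n.+1%:R^-1 * ell (S v n.+1 o)) @ \oo --> L}.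
Proof.
move=> v0.
(* Countably many accuracies [1 / m.+1] keep the exceptional set negligible. *)
have side sg : `|sg| = 1 -> {ae P, forall o, forall m, exists N, forall n, (N <= n)%N ->
    ~ deviating sg (m.+1%:R^-1) v n o}.
  move=> sg1; apply: ae_foralln => m.
  have [|D [q [D0 q01 PD]]] := @deviating_le sg m.+1%:R^-1 v sg1 _ v0.
    by rewrite invr_gt0.
  exact: (borel_cantelli_geometric D0 q01 (measurable_deviating _ _ _) PD).
have sN1 : `|-1 : R| = 1 by rewrite normrN normr1.
apply: filterS2 (side 1 (normr1 R)) (side (-1) sN1) => o h1 h2.
apply/cvgrPdist_lt => e e0.
pose m := Num.bound (e^-1).
have me : m.+1%:R^-1 < e.
  rewrite -[ltRHS]invrK ltf_pV2 ?posrE ?invr_gt0//.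
  have : e^-1 < m%:R by apply: archi_boundP; rewrite invr_ge0 ltW.
  by move=> /lt_trans; apply; rewrite ltr_nat.
have [N1 hN1] := h1 m; have [N2 hN2] := h2 m.
exists (maxn N1 N2) => // n /=; rewrite geq_max => /andP[n1 n2].
have n0 : 0 < n.+1%:R :> R by [].
move: (hN1 n.+1 (leqW n1)) (hN2 n.+1 (leqW n2)); rewrite /deviating /=.
move=> /negP; rewrite -ltNge => k1 /negP; rewrite -ltNge => k2.
set x := ell _ in k1 k2 *.
have -> : L - n.+1%:R^-1 * x = (n.+1%:R * L - x) / n.+1%:R.
  by field; rewrite gt_eqF.
rewrite normrM normfV [`|n.+1%:R|]gtr0_norm// ltr_pdivrMr// ltr_norml.
have k3 : n.+1%:R / m.+1%:R < e * n.+1%:R by rewrite mulrC ltr_pM2r.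
move: k1 k2 k3; set t := _ / _; set y := e * _; set z := _ * L => k1 k2 k3.
by apply/andP; split; lra.
Qed.

End AlmostSure.

Lemma trajectory_act_neq0 (u : nat -> R) v n : v != (0, 0) -> trajectory act u v n != (0, 0).
Proof. by move=> v0; elim: n => //= n IH; rewrite act_eq0. Qed.

Lemma positive_lyapunov_exponent : nu (~` `[- M, M]) = 0%E ->
  exists L : R, 0 < L /\
    forall (d : measure_display) (Omega : measurableType d)
           (P : probability Omega R) (lam : nat -> Omega -> R),
      iid_law P lam nu ->
      {ae P, forall o, (fun n : nat =>
          n.+1%:R^-1 * ln (opnorm (cocycle f0 f1 E n.+1 (fun k => lam k o))))
          @ \oo --> L}.
Proof.
move=> nuM; have [L [C [L0 hL]]] := uniform_growth.
exists (L / 2); split; first lra.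
move=> d Omega P lam iid.
have e1n : (e1 : R * R) != (0, 0) by rewrite -n2_gt0 /n2 /=; lra.
have e2n : (e2 : R * R) != (0, 0) by rewrite -n2_gt0 /n2 /=; lra.
(* Almost surely no variable is ever clamped, so the walk studied is the actual cocycle. *)
have bounded : {ae P, forall o, forall k, `|lam k o| <= M}.
  apply: ae_foralln => k; exists (lam k @^-1` (~` `[- M, M])).
  have mI : measurable (~` [set` `[- M, M]] : set R).
    by apply: measurableC; exact: measurable_itv.
  case: iid => mlam [law _]; split.
  - by rewrite -[X in measurable X]setTI; exact: mlam.
  - exact: etrans (law k _ mI) nuM.
  by move=> o /= h1 h2; apply: h1; rewrite ler_norml; move: h2; rewrite in_itv.
apply: filterS3 (ell_trajectory_cvg iid hL e1n) (ell_trajectory_cvg iid hL e2n) bounded.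
move=> o c1 c2 ob.
have trajE v n : trajectory (step f0 f1 E) (lam^~ o) v n = trajectory act (lam^~ o) v n.
  by elim: n => //= n ->; rewrite /act clamp_id.
pose p n := (trajectory act (lam^~ o) e1 n.+1, trajectory act (lam^~ o) e2 n.+1).
apply: (ln_opnorm_cvg (p := p)) => // n; rewrite ?cocycle_col ?trajE//.
- exact: trajectory_act_neq0.
- exact: trajectory_act_neq0.
Qed.

End FivePoints.
End Model.

(** * Five separated balls charged by the law *)

Lemma positive_lower_bound {R : realType} {I : finType} (g : I -> R) :
  (forall i, 0 < g i) -> exists2 d : R, 0 < d & forall i, d <= g i.
Proof.
move=> g0; pose s := 1 + \sum_i (g i)^-1.
have s1 i : (g i)^-1 <= s.
  rewrite /s (bigD1 i)//= addrCA lerDl addr_ge0// sumr_ge0// => j _.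
  by rewrite invr_ge0 ltW.
have s0 : 0 < s.
  by rewrite ltr_pwDl// sumr_ge0// => j _; rewrite invr_ge0 ltW.
exists s^-1; first by rewrite invr_gt0.
by move=> i; rewrite -[leRHS]invrK lef_pV2 ?posrE ?invr_gt0.
Qed.

Lemma separated_support_balls {R : realType} (nu : probability R R) :
  card_ge (msupport nu) 5 ->
  exists (A : 'I_5 -> set R) (p0 delta b : R),
    [/\ 0 < p0, 0 < delta & [/\ forall i, measurable (A i),
      forall i, (p0%:E <= nu (A i))%E, forall i l, A i l -> `|l| <= b &
      forall i j l m, i != j -> A i l -> A j m -> delta <= `|l - m|]].
Proof.
move=> [x [x_inj x_supp]].
(* The value 1 on the diagonal keeps [gap] positive on all pairs. *)
pose gap (ij : 'I_5 * 'I_5) := if ij.1 == ij.2 then 1 else `|x ij.1 - x ij.2|.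
have [|dist dist0 hdist] := @positive_lower_bound R _ gap.
  move=> [i j]; rewrite /gap /=; case: eqVneq => // ij.
  by rewrite normr_gt0 subr_eq0 (inj_eq x_inj).
(* A third of a common lower bound for the distances leaves a distance of at least [r] between
   points of different balls. *)
pose r := dist / 3.
have r0 : 0 < r by rewrite divr_gt0.
have mB i : measurable (ball (x i) r) by exact: measurable_ball.
have nuB i : 0 < fine (nu (ball (x i) r)).
  apply: fine_gt0; rewrite (x_supp i r r0) /=.
  by rewrite -ge0_fin_numE ?measure_ge0// fin_num_measure.
have [p0 p0_gt0 hp0] := positive_lower_bound nuB.
exists (fun i => ball (x i) r), p0, r, (\sum_i `|x i| + r); split => //; split => //.
- move=> i; rewrite -[leRHS]fineK; first by rewrite lee_fin.
  exact: fin_num_measure.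
- move=> i l; rewrite /ball /= => h.
  have xi : `|x i| <= \sum_i `|x i|.
    by rewrite (bigD1 i)//= lerDl sumr_ge0.
  have : `|l| <= `|x i| + `|x i - l|.
    by rewrite -{1}(subKr (x i) l); exact: ler_normB.
  by lra.
move=> i j l m ij; rewrite /ball /= => hl hm.
have := hdist (i, j); rewrite /gap /= (negPf ij) => dij.
have tri : `|x i - x j| <= `|x i - l| + `|l - m| + `|x j - m|.
  rewrite (distrC (x j) m) (_ : x i - x j = (x i - l) + (l - m) + (m - x j)); last by ring.
  by apply: le_trans (ler_normD _ _) _; rewrite lerD2r ler_normD.
by rewrite /r in hl hm *; lra.
Qed.

Unset Implicit Arguments.

Theorem mainTheorem12 (R : realType) (f0 f1 : R) (nu : probability R R) :
  0 < f0 -> 0 < f1 ->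
  compactly_supported nu ->
  card_ge (msupport nu) 5 ->
  forall E : R,
  exists L : R, 0 < L /\
    forall (d : measure_display) (Omega : measurableType d)
           (P : probability Omega R) (lam : nat -> Omega -> R),
      iid_law P lam nu ->
      {ae P, forall w, (fun n : nat =>
          n.+1%:R^-1 * ln (opnorm (cocycle f0 f1 E n.+1 (fun k => lam k w))))
          @ \oo --> L}.
Proof.
move=> f0_gt0 f1_gt0 [M0 nuM0] supp E.
have [A [p0 [delta [b [p0_gt0 delta_gt0 [mA pA bA sepA]]]]]] :=
  separated_support_balls supp.
(* [[-M, M]] contains the interval carrying [nu] and all five balls. *)
pose M := `|M0| + `|b|.
have M_ge0 : 0 <= M by rewrite addr_ge0.
have nuM : nu (~` `[- M, M]) = 0%E.
  apply: subset_measure0 nuM0; try by apply: measurableC; exact: measurable_itv.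
  apply: subsetC => l /=; rewrite !in_itv /= => /andP[h1 h2].
  have := ler_norm M0; have := normr_ge0 b; rewrite /M.
  by move=> ? ?; apply/andP; split; lra.
have AM i l : A i l -> `|l| <= M.
  by move=> /bA; have := ler_norm b; have := normr_ge0 M0; rewrite /M; lra.
exact: (@positive_lyapunov_exponent R nu f0 f1 E M M_ge0 f0_gt0 f1_gt0 A p0 delta
  mA p0_gt0 pA delta_gt0 AM sepA nuM).
Qed.
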